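(* Let $(\sigma_n,g_n,W_n)_{n\ge 1}$ be a sequence of triples, where $\sigma_n$ is a finite (nonnegative Borel) measure on the unit circle $\mathbb T$, $g_n$ is a real-valued continuous function on $\mathbb T$, and $W_n(z)=\prod_{i=1}^n(z-b_{n,i})$ is a monic polynomial of degree $n$ all of whose zeros $b_{n,i}$ lie in the open unit disk $\mathbb D$. Write $d\sigma_n=\upsilon_n\,dm+d\sigma_n^s$ with $\sigma_n^s$ singular to $m$. Assume: (A) there is a finite measure $d\sigma=\upsilon\,dm+d\sigma^s$ on $\mathbb T$ ($\sigma^s$ singular to $m$) such that $\limsup_{n\to\infty}\int f\,d\sigma_n\le\int f\,d\sigma$ for every nonnegative continuous function $f$ on $\mathbb T$; (B) $\log\upsilon_n,\log\upsilon\in L^1(\mathbb T)$ and $\|\log\upsilon_n-\log\upsilon\|_{L^1(\mathbb T)}\to0$ as $n\to\infty$; (C) all $g_n$ belong to $\mathcal E$, a fixed compact subset of $C(\mathbb T)$; (D) $\sum_{i=1}^n(1-|b_{n,i}|)\to\infty$ as $n\to\infty$. Let $\phi_n(z)=\alpha_nz^n+\cdots$, $\alpha_n>0$, be the polynomial of degree $n$ satisfying $$\int \phi_n(\xi)\overline{\xi^k}\,\frac{e^{g_n(\xi)}d\sigma_n(\xi)}{|W_n(\xi)|^2}=0,\quad k\in\{0,\dots,n-1\},\qquad \int|\phi_n(\xi)|^2\,\frac{e^{g_n(\xi)}d\sigma_n(\xi)}{|W_n(\xi)|^2}=1 .$$ Then $$\frac{\phi_n^*(z)}{W_n^*(z)}D_n(z)=1+o_{\mathcal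 E}(1)\quad\text{and}\quad \frac{\phi_n(z)}{\phi_n^*(z)}=o_{\mathcal E}(1)\qquad\text{as } n\to\infty$$ locally uniformly in $\mathbb D$. In particular, $\alpha_nD_n(0)=1+o_{\mathcal E}(1)$ as $n\to\infty$.
   Context: $m$ is the normalized arclength measure on $\mathbb T$: $dm=(2\pi)^{-1}|d\xi|$. For a polynomial $p$ of degree at most $n$, the reciprocal polynomial with respect to the index $n$ is $p^*(z)=z^n\overline{p(1/\overline z)}$; both $\phi_n^*$ and $W_n^*(z)=\prod_{i=1}^n(1-\overline{b_{n,i}}z)$ are taken with respect to the index $n$. The function $D_n$ is the Szegő function of $e^{g_n}\sigma_n$: $$D_n(z)=D(e^{g_n}\sigma_n;z)=\exp\left(\frac12\int\frac{\xi+z}{\xi-z}\,\big(g_n(\xi)+\log\upsilon_n(\xi)\big)\,dm(\xi)\right),\quad z\in\mathbb D.$$ The symbol $o_{\mathcal E}(1)$ denotes a quantity that tends to $0$ as $n\to\infty$ uniformly with respect to the choice of the functions $g_n\in\mathcal E$ (the rate depends on $\mathcal E$ but not on the particular $g_n$). *)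

(* Defs.v *)
From HB Require Import structures.
From mathcomp Require Import all_boot all_order all_algebra.
From mathcomp Require Import complex.
From mathcomp Require Import all_classical all_reals all_analysis.
From mathcomp Require Import measurable_realfun.

Set Implicit Arguments.
Unset Strict Implicit.
Unset Printing Implicit Defensive.

Import Order.TTheory GRing.Theory Num.Theory.
Import numFieldNormedType.Exports.

Local Open Scope classical_set_scope.
Local Open Scope ring_scope.
Local Open Scope complex_scope.

(* The norm topology on R[i]: the library attaches it to abstract
   numClosedFieldTypes only, so it has to be copied to the concrete field. *)
HB.instance Definition _ (R : realType) := NormedModule.copy R[i] R[i]^o.

(* The unit circle, with the topology induced by R[i] and its Borel sets. *)
Definition circle (R : realType) := set_type [set z : R[i] | `|z| = 1].

HB.instance Definition _ (R : realType) := Uniform.on (circle R).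

Definition circle_val (R : realType) (xi : circle R) : R[i] := set_val xi.
Coercion circle_val : circle >-> complex.

Lemma normc_cis (R : realType) (t : R) : `|cos t +i* sin t| = 1 :> R[i].
Proof. by rewrite normc_def /= cos2Dsin2 sqrtr1. Qed.

Definition cis (R : realType) (t : R) : circle R :=
  SigSub (mem_set (normc_cis t)).

HB.instance Definition _ (R : realType) := isPointed.Build (circle R) (cis 0).
HB.instance Definition _ (R : realType) :=
  Measurable.copy (circle R) (g_sigma_algebraType (@open (circle R))).

Lemma continuous_cis (R : realType) : continuous (@cis R).
Proof.
apply: continuous_comp_initial => t /=.
apply/cvgrPdist_lt => e e0.
have Re0 : 0 < complex.Re e by move: e0; rewrite ltcE => /andP[].
have -> : e = (complex.Re e)%:C by rewrite RRe_real ?gtr0_real.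
have h : 0 < complex.Re e / 2 by rewrite divr_gt0.
near=> s.
apply: (@le_lt_trans _ _ (`|cos t - cos s| + `|sin t - sin s|)%:C).
  rewrite normc_def /= lecR.
  rewrite -[leRHS]ger0_norm ?addr_ge0 // -sqrtr_sqr ler_wsqrtr //.
  rewrite -(real_normK (num_real (cos t - cos s))).
  rewrite -(real_normK (num_real (sin t - sin s))).
  by rewrite [leRHS]sqrrD lerD2r lerDl mulrn_wge0 ?mulr_ge0.
rewrite ltcR (splitr (complex.Re e)) ltrD //; near: s.
  by move/cvgrPdist_lt : (@continuous_cos R t); apply.
by move/cvgrPdist_lt : (@continuous_sin R t); apply.
Unshelve. all: by end_near. Qed.

Lemma measurable_cis (R : realType) :
  @measurable_fun _ _ (measurableTypeR R) (circle R) setT (@cis R).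
Proof.
apply: measurability => //.
move=> _ [U oU <-]; rewrite setTI; apply: measurable_realfun.open_measurable.
by apply: open_comp => // x _; exact: continuous_cis.
Qed.

Definition cis_mfun (R : realType) : {mfun measurableTypeR R >-> circle R} :=
  @mfun_Sub _ _ (measurableTypeR R) (circle R) _ (mem_set (@measurable_cis R)).

Lemma pi2_gt0 (R : realType) : 0 < pi *+ 2 :> R.
Proof. by rewrite mulrn_wgt0 ?pi_gt0. Qed.

(* The measure m, dm = |d xi| / (2 pi): the image of the uniform probability
   on [0, 2 pi] under t |-> exp(it). *)
Definition arclength (R : realType) : probability (circle R) R :=
  distribution (uniform_prob (pi2_gt0 R)) (cis_mfun R).

Definition cintegral d (T : measurableType d) (R : realType)
    (mu : {measure set T -> \bar R}) (f : T -> R[i]) : R[i] :=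
  (\int[mu]_x complex.Re (f x)) +i* (\int[mu]_x complex.Im (f x)).

Definition cexp (R : realType) (z : R[i]) : R[i] :=
  (expR (complex.Re z))%:C * (cos (complex.Im z) +i* sin (complex.Im z)).

(* recip n p is p^* with respect to the index n; see recipE for its relation
   with z^n * conj (p (1 / conj z)), which does not make sense at z = 0. *)
Definition recip (R : realType) (n : nat) (p : {poly R[i]}) : {poly R[i]} :=
  \poly_(k < n.+1) (p`_(n - k))^*.

Lemma recipE (R : realType) n (p : {poly R[i]}) (z : R[i]) :
  (size p <= n.+1)%N -> z != 0 ->
  (recip n p).[z] = z ^+ n * (p.[1 / z^*%C])^*.
Proof.
move=> sp z0; rewrite div1r horner_poly (horner_coef_wide _ sp).
rewrite rmorph_sum mulr_sumr (reindex_inj rev_ord_inj) /=.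
apply: eq_bigr => i _; have le_in : (i <= n)%N by rewrite -ltnS.
have -> : z ^+ n = z ^+ (n - i) * z ^+ i by rewrite -exprD subnK.
rewrite subSS subKn // rmorphM rmorphXn fmorphV /=.
rewrite [X in X^-1](_ : _ = z) ?exprVn; last exact: conjcK.
by rewrite mulrCA -mulrA divff ?expf_neq0 // mulr1.
Qed.

Definition monic_of_zeros (R : realType) (n : nat) (b : 'I_n -> R[i]) :
    {poly R[i]} :=
  \prod_(i < n) ('X - (b i)%:P).

Lemma recip_monic_of_zeros (R : realType) n (b : 'I_n -> R[i]) (z : R[i]) :
  (recip n (monic_of_zeros b)).[z] = \prod_(i < n) (1 - (b i)^* * z).
Proof.
have sW : size (monic_of_zeros b) = n.+1.
  by rewrite size_prod_XsubC /index_enum -enumT size_enum_ord.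
have [->|z0] := eqVneq z 0.
  rewrite horner_coef0 coef_poly /= subn0 big1 => [|i _]; last first.
    by rewrite mulr0 subr0.
  have /monicP : monic_of_zeros b \is monic by apply: monic_prod_XsubC.
  by rewrite lead_coefE sW /= => ->; rewrite rmorph1.
rewrite recipE ?sW // horner_prod rmorph_prod.
rewrite -[X in z ^+ X]card_ord -prodr_const -big_split; apply: eq_bigr => i _.
rewrite !hornerE ?div1r rmorphB fmorphV /=.
rewrite [X in X^-1](_ : _ = z); last exact: conjcK.
by rewrite mulrBr divff // mulrC.
Qed.

Definition singular d (T : measurableType d) (R : realType)
    (mu nu : set T -> \bar R) :=
  exists N : set T, [/\ measurable N, mu N = 0%E & nu (~` N) = 0%E].

(* d sigma = v dm + d sigmas, with sigmas singular to m. *)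
Definition lebesgue_decomposition (R : realType)
    (sigma : set (circle R) -> \bar R) (v : circle R -> R)
    (sigmas : set (circle R) -> \bar R) :=
  [/\ measurable_fun setT v,
      forall xi, 0 <= v xi,
      singular (arclength R) sigmas &
      forall A, measurable A ->
        sigma A = (\int[arclength R]_(xi in A) (v xi)%:E + sigmas A)%E].

(* The extended logarithm lne 0 = -oo is needed here: with the library's
   ln 0 = 0, integrability would not force v > 0 almost everywhere. *)
Definition elog (R : realType) (v : circle R -> R) : circle R -> \bar R :=
  fun xi => lne (v xi)%:E.

(* D(e^g sigma; z), where v is the density of sigma; it is only used when
   log v is integrable, so the value of ln at 0 is irrelevant. *)
Definition szego (R : realType) (g v : circle R -> R) (z : R[i]) : R[i] :=
  cexp (2^-1 * cintegral (arclength R)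
    (fun xi : circle R => (circle_val xi + z) / (circle_val xi - z) * (g xi + ln (v xi))%:C)).

(* phi is the polynomial of degree n with positive leading coefficient that is
   orthonormal with respect to e^g d sigma / |W|^2.  In R[i], 0 < x means that
   x is real and positive. *)
Definition is_orthonormal_poly (R : realType)
    (sigma : {measure set (circle R) -> \bar R}) (g : circle R -> R)
    (W : {poly R[i]}) (n : nat) (phi : {poly R[i]}) :=
  let w (xi : circle R) : R[i] := (expR (g xi))%:C / `|W.[xi]| ^+ 2 in
  [/\ size phi = n.+1,
      0 < lead_coef phi,
      forall k, (k < n)%N ->
        cintegral sigma
          (fun xi : circle R => phi.[xi] * (circle_val xi ^+ k)^* * w xi) = 0 &
      cintegral sigma (fun xi : circle R => `|phi.[xi]| ^+ 2 * w xi) = 1].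

(* Main.v *)
Require Import Defs.
From HB Require Import structures.
From mathcomp Require Import all_boot all_order all_algebra.
From mathcomp Require Import complex.
From mathcomp Require Import all_classical all_reals all_analysis.
From mathcomp Require Import measurable_realfun ring lra.

Set Implicit Arguments.
Unset Strict Implicit.
Unset Printing Implicit Defensive.

Import Order.TTheory GRing.Theory Num.Theory.
Import numFieldNormedType.Exports.

Local Open Scope classical_set_scope.
Local Open Scope ring_scope.
Local Open Scope complex_scope.

(* By weak approximation there is a polynomial H with real H(0) such that
   2 Re H is L^1(m)-close to -(g + log v) and e^(2 Re H + g) has sigma-integral
   at most 1 + o(1); then e^H D is close to 1 inside the disk, and e^H is close
   to a polynomial h.  Condition (D) makes the Blaschke products W / W^* tend to
   0 locally uniformly, hence so do their backward shifts R_k / W^*, while R_k / W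
   is close to conj(xi)^k on the circle.  The combination Q = sum_k conj(h_k) R_k
   has degree n and leading coefficient conj(h(0)), and |Q / W| is close to |h| on
   the circle, so its weighted norm is at most 1 + o(1).  Orthogonality splits
   this norm as |c|^2 plus that of Q - c phi, where c is the quotient of the
   leading coefficients.  Jensen's inequality bounds |P / W^*|^2 |D|^2 at a point
   of the disk by the weighted norm of P; applied to phi^* at 0 it gives
   alpha |D(0)| <= 1, so that |c| is close to 1 and Q - c phi has small norm;
   applied to Q - c phi and to its reciprocal it transfers the asymptotics of Q
   and Q^* to phi and phi^*. *)

(** Condition (A) bounds weighted norms only from above; the matching lower bound comes from (B),
    through Jensen's inequality for the absolutely continuous part alone. The singular parts of the
    [sigma_n] are simply dropped there, and that of the limit is absorbed by a weight that is tiny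
    on a set carrying it. The Szegő function need not have continuous boundary values, which is why
    [e^(-H)] with [H] a polynomial stands in for it. Boundary-value theory is avoided throughout:
    the analytic functions that occur are uniform limits of polynomials on the closed disk, and for
    these the maximum principle and Jensen's inequality follow from the mean value property of
    polynomials. Two scales of smallness appear, since an excess of order [e] in a squared norm
    becomes a pointwise error of order [sqrt e]. Uniformity in [g] holds because [H] and [h] depend
    only on a centre [g0] and on the limit measure, so that one threshold for [n] serves a whole
    sup-norm ball around [g0]; compactness of [E] does the rest. *)

Notation cmod := (@Normc.normc _).

(** * Modulus, real and imaginary parts in [R[i]] *)

Section modulus.
Variable R : realType.
Implicit Types z w : R[i].

Lemma cmodE z : `|z| = (cmod z)%:C.
Proof. by case: z. Qed.

Lemma cmod_ge0 z : 0 <= cmod z.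
Proof. by case: z => a b; exact: sqrtr_ge0. Qed.

Lemma cmodM z w : cmod (z * w) = cmod z * cmod w.
Proof. exact: Normc.normcM. Qed.

Lemma cmodV z : cmod z^-1 = (cmod z)^-1.
Proof. exact: Normc.normcV. Qed.

Lemma cmodN z : cmod (- z) = cmod z.
Proof. exact: normcN. Qed.

Lemma cmodD z w : cmod (z + w) <= cmod z + cmod w.
Proof. exact: le_normcD. Qed.

Lemma cmodB z w : cmod (z - w) <= cmod z + cmod w.
Proof. by rewrite -(cmodN w) cmodD. Qed.

Lemma cmodBC z w : cmod (z - w) = cmod (w - z).
Proof. by rewrite -cmodN opprB. Qed.

Lemma cmod_lerB z w : cmod z - cmod w <= cmod (z - w).
Proof. by rewrite lerBlDr -[leLHS](congr1 cmod (subrK w z)) cmodD. Qed.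

Lemma cmod_distB z w : `|cmod z - cmod w| <= cmod (z - w).
Proof.
by rewrite ler_norml cmod_lerB andbT lerNl opprB cmodBC cmod_lerB.
Qed.

Lemma cmod_eq0 z : (cmod z == 0) = (z == 0).
Proof.
apply/eqP/eqP => [|->]; [exact: Normc.eq0_normc|exact: Normc.normc0].
Qed.

Lemma cmod_gt0 z : (0 < cmod z) = (z != 0).
Proof. by rewrite lt_def cmod_ge0 andbT cmod_eq0. Qed.

Lemma cmod_real (x : R) : cmod x%:C = `|x|.
Proof. by rewrite /= expr0n addr0 sqrtr_sqr. Qed.

Lemma cmod0 : cmod (0 : R[i]) = 0. Proof. exact: Normc.normc0. Qed.

Lemma cmod1 : cmod (1 : R[i]) = 1. Proof. exact: Normc.normc1. Qed.

Lemma cmodX z n : cmod (z ^+ n) = cmod z ^+ n.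
Proof.
by elim: n => [|n ih]; rewrite ?expr0 ?cmod1// !exprS cmodM ih.
Qed.

Lemma cmod_conj z : cmod z^*%C = cmod z.
Proof. by case: z => a b /=; rewrite sqrrN. Qed.

Lemma cmod_sqr z : cmod z ^+ 2 = complex.Re z ^+ 2 + complex.Im z ^+ 2.
Proof. by case: z => a b; rewrite /= sqr_sqrtr// addr_ge0// sqr_ge0. Qed.

Lemma cmod_prod (I : Type) (s : seq I) (P : pred I) (F : I -> R[i]) :
  cmod (\prod_(i <- s | P i) F i) = \prod_(i <- s | P i) cmod (F i).
Proof. by apply: (big_morph _ cmodM); exact: cmod1. Qed.

Lemma cmod_sum (I : Type) (s : seq I) (P : pred I) (F : I -> R[i]) :
  cmod (\sum_(i <- s | P i) F i) <= \sum_(i <- s | P i) cmod (F i).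
Proof.
elim/big_ind2 : _ => // [|x a y b ha hb]; first by rewrite cmod0.
by rewrite (le_trans (cmodD _ _))// lerD.
Qed.

Lemma mulC_conj z : z * z^*%C = (cmod z ^+ 2)%:C.
Proof. by rewrite -sqr_normc cmodE rmorphXn. Qed.

Lemma ltCR z (e : R) : (`|z| < e%:C) = (cmod z < e).
Proof. by rewrite cmodE ltcR. Qed.

Lemma cReD z w : complex.Re (z + w) = complex.Re z + complex.Re w.
Proof. by case: z; case: w. Qed.

Lemma cImD z w : complex.Im (z + w) = complex.Im z + complex.Im w.
Proof. by case: z; case: w. Qed.

Lemma cReN z : complex.Re (- z) = - complex.Re z.
Proof. by case: z. Qed.

Lemma cImN z : complex.Im (- z) = - complex.Im z.
Proof. by case: z. Qed.

Lemma cReB z w : complex.Re (z - w) = complex.Re z - complex.Re w.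
Proof. by rewrite cReD cReN. Qed.

Lemma cImB z w : complex.Im (z - w) = complex.Im z - complex.Im w.
Proof. by rewrite cImD cImN. Qed.

Lemma cReM z w : complex.Re (z * w) =
  complex.Re z * complex.Re w - complex.Im z * complex.Im w.
Proof. by case: z; case: w. Qed.

Lemma cImM z w : complex.Im (z * w) =
  complex.Re z * complex.Im w + complex.Im z * complex.Re w.
Proof. by case: z => a b; case: w => c d /=; rewrite [b * c]mulrC. Qed.

Lemma cRe_conj z : complex.Re z^*%C = complex.Re z. Proof. by case: z. Qed.

Lemma cIm_conj z : complex.Im z^*%C = - complex.Im z. Proof. by case: z. Qed.

Lemma Re_le_cmod z : `|complex.Re z| <= cmod z.
Proof.
rewrite -(@ler_pXn2r _ 2)// ?nnegrE ?cmod_ge0//.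
by rewrite cmod_sqr real_normK ?num_real// lerDl sqr_ge0.
Qed.

Lemma Im_le_cmod z : `|complex.Im z| <= cmod z.
Proof.
rewrite -(@ler_pXn2r _ 2)// ?nnegrE ?cmod_ge0//.
by rewrite cmod_sqr real_normK ?num_real// lerDr sqr_ge0.
Qed.

Lemma cmod_le_ReIm z : cmod z <= `|complex.Re z| + `|complex.Im z|.
Proof.
rewrite -(@ler_pXn2r _ 2)// ?nnegrE ?cmod_ge0 ?addr_ge0//.
rewrite cmod_sqr sqrrD !real_normK ?num_real//.
by rewrite lerD2r lerDl mulrn_wge0// mulr_ge0.
Qed.

Lemma complex_eqP z w : complex.Re z = complex.Re w ->
  complex.Im z = complex.Im w -> z = w.
Proof. by case: z => a b; case: w => c d /= -> ->. Qed.

Lemma ReV_mod1 z : cmod z = 1 -> z^-1 = z^*%C.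
Proof.
move=> z1; have z0 : z != 0 by rewrite -cmod_gt0 z1.
by apply: (mulfI z0); rewrite mulfV// mulC_conj z1 expr1n.
Qed.

(** Balls of [R[i]] have radii in [R[i]]; a positive complex radius is real, so real radii describe
    the same neighbourhoods. *)
Lemma nbhs_cmodP z (A : set R[i]) :
  nbhs z A <-> exists2 e : R, 0 < e & forall w, cmod (z - w) < e -> A w.
Proof.
rewrite -nbhs_ballE; split=> [[e /= e0 eA]|[e e0 eA]].
  exists (complex.Re e); first by move: e0; rewrite ltcE => /andP[].
  move=> w zw; apply: eA; rewrite -ball_normE /= cmodE.
  have -> : e = (complex.Re e)%:C by rewrite RRe_real// gtr0_real.
  by rewrite ltcR.
exists e%:C; first by rewrite /= ltcR.
by move=> w; rewrite -ball_normE /= cmodE ltcR; exact: eA.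
Qed.

Lemma continuous_cmodP (f : R[i] -> R[i]) z :
  (forall e : R, 0 < e -> exists2 d : R, 0 < d &
     forall w, cmod (z - w) < d -> cmod (f z - f w) < e) ->
  f x @[x --> z] --> f z.
Proof.
move=> h A /nbhs_cmodP[e e0 eA].
have [d d0 dA] := h e e0.
by apply/nbhs_cmodP; exists d => // w /dA; exact: eA.
Qed.

Lemma continuous_chorner (p : {poly R[i]}) : continuous ((fun z => p.[z]) : R[i] -> R[i]).
Proof.
elim/poly_ind: p => [|p c ih] z.
  have -> : (fun x => (0 : {poly R[i]}).[x]) = (fun=> 0).
    by apply/funext => x; rewrite horner0.
  exact: cst_continuous.
have -> : (fun x => (p * 'X + c%:P).[x]) = (fun x : R[i] => p.[x] * x + c : R[i]).
  by apply/funext => x; rewrite !hornerE.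
apply: (@continuousD R[i] R[i] R[i] (fun x => p.[x] * x) (fun=> c));
  last exact: cst_continuous.
by apply: continuousM; [exact: ih|exact: (fun A h => h)].
Qed.

Lemma continuous_lip1 (f : R[i] -> R) :
  (forall z w, `|f z - f w| <= cmod (z - w)) -> continuous f.
Proof.
move=> h z A; rewrite -nbhs_ballE => -[e /= e0 eA].
apply/nbhs_cmodP; exists e => // w zw; apply: eA.
by rewrite -ball_normE /=; exact: le_lt_trans zw.
Qed.

Lemma continuous_Re : continuous (@complex.Re R).
Proof.
by apply: continuous_lip1 => z w; rewrite -cReB Re_le_cmod.
Qed.

Lemma continuous_Im : continuous (@complex.Im R).
Proof.
by apply: continuous_lip1 => z w; rewrite -cImB Im_le_cmod.
Qed.

Lemma continuous_cmod : continuous (fun z : R[i] => cmod z).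
Proof. by apply: continuous_lip1 => z w; exact: cmod_distB. Qed.

End modulus.

(** * Topology of the unit circle *)

Section circle_topology.
Variable R : realType.
Implicit Types xi eta : circle R.

Lemma cmod_circle xi : cmod (circle_val xi) = 1.
Proof.
have := set_valP xi; rewrite /= -/(circle_val xi) cmodE => /complexI; exact.
Qed.

Lemma circle_neq0 xi : circle_val xi != 0.
Proof. by rewrite -cmod_gt0 cmod_circle. Qed.

Lemma continuous_circle_val : continuous (@circle_val R).
Proof. exact: initial_continuous. Qed.

Lemma nbhs_circleP xi (A : set (circle R)) : nbhs xi A <->
  exists2 d : R, 0 < d & forall eta, cmod (circle_val xi - circle_val eta) < d -> A eta.
Proof.
split=> [|[d d0 dA]].
  move=> [_ [[B oB <-] Bxi BA]].
  have /nbhs_cmodP[e e0 eB] : nbhs (circle_val xi) B.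
    exact: open_nbhs_nbhs.
  by exists e => // eta /eB Beta; apply: BA.
apply: (@filterS _ (nbhs xi) _
  (fun eta => cmod (circle_val xi - circle_val eta) < d)) => [eta|].
  exact: dA.
have h : nbhs (circle_val xi) [set w | cmod (circle_val xi - w) < d].
  by apply/nbhs_cmodP; exists d.
exact: (@continuous_circle_val xi _ h).
Qed.

Lemma cis_surj xi : exists2 t, t \in `[- pi, pi]%R & cis t = xi.
Proof.
have h : complex.Re (circle_val xi) ^+ 2 + complex.Im (circle_val xi) ^+ 2 = 1.
  by rewrite -cmod_sqr cmod_circle expr1n.
set x := complex.Re _ in h; set y := complex.Im _ in h.
have x1 : -1 <= x <= 1.
  by have := Re_le_cmod (circle_val xi); rewrite cmod_circle ler_norml.
have sE : sin (acos x) = `|y|.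
  by rewrite sin_acos// -h addrAC subrr add0r sqrtr_sqr.
have a0 := acos_ge0 x1; have api := acos_lepi x1.
have pi0 := pi_ge0 R.
have [y0|y0] := leP 0 y.
  exists (acos x); first by rewrite in_itv /=; apply/andP; split; lra.
  apply/val_inj => /=; apply/complex_eqP => /=; first by rewrite acosK.
  by rewrite sE ger0_norm.
exists (- acos x); first by rewrite in_itv /=; apply/andP; split; lra.
apply/val_inj => /=; apply/complex_eqP => /=; first by rewrite cosN acosK.
by rewrite sinN sE ltr0_norm// opprK.
Qed.

Lemma circle_compact : compact [set: circle R].
Proof.
have -> : [set: circle R] = @cis R @` `[- pi, pi]%classic.
  by apply/seteqP; split=> // xi _; have [t tpi <-] := cis_surj xi; exists t.
apply: continuous_compact; last exact: segment_compact.
exact/continuous_subspaceT/continuous_cis.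
Qed.

Lemma continuous_circle (f : circle R -> R) : continuous f ->
  forall xi (e : R), 0 < e -> exists2 d : R, 0 < d &
     forall eta, cmod (circle_val xi - circle_val eta) < d -> `|f xi - f eta| < e.
Proof.
move=> cf xi e e0; apply/nbhs_circleP.
by have /cvgrPdist_lt := cf xi; apply.
Qed.

Lemma circle_unif_continuous (f : circle R -> R) : continuous f ->
  forall e : R, 0 < e -> exists2 d : R, 0 < d & forall xi eta,
     cmod (circle_val xi - circle_val eta) < d -> `|f xi - f eta| < e.
Proof.
move=> cf e e0.
have /compact_near_coveringP := circle_compact.
(* The covering form of compactness, with the filter [0^'+] for the radius, yields one radius that
   works at all points; the halves below leave room for the triangle inequality. *)
move=> /(_ R (0^'+) (fun d xi => forall eta,
  cmod (circle_val xi - circle_val eta) < d -> `|f xi - f eta| < e)) [].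
  move=> xi _.
  have [d d0 hd] := continuous_circle cf xi (divr_gt0 e0 (ltr0n _ 2)).
  exists ([set eta | cmod (circle_val xi - circle_val eta) < d / 2],
          [set r | r < d / 2]).
    split => /=; first by apply/nbhs_circleP; exists (d / 2) => //; lra.
    by apply: nbhs_right_lt; lra.
  move=> [eta r] /= [h1 h2] zeta h3.
  have h4 := hd eta; have h5 := hd zeta.
  have h : cmod (circle_val xi - circle_val zeta) < d.
    have -> : circle_val xi - circle_val zeta =
      (circle_val xi - circle_val eta) + (circle_val eta - circle_val zeta) by ring.
    rewrite (le_lt_trans (cmodD _ _))//; lra.
  have -> : f eta - f zeta = (f xi - f zeta) - (f xi - f eta) by ring.
  rewrite (le_lt_trans (ler_normB _ _))//.
  have := h5 h; have /h4 : cmod (circle_val xi - circle_val eta) < d by lra.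
  lra.
move=> d /= d0 h; exists (d / 2); first by rewrite divr_gt0.
move=> xi eta; apply: h => //=; last by rewrite divr_gt0.
by rewrite sub0r normrN gtr0_norm; lra.
Qed.

Lemma circle_bounded (f : circle R -> R) : continuous f ->
  exists2 M : R, 0 < M & forall xi, `|f xi| <= M.
Proof.
move=> cf.
have : compact (f @` [set: circle R]).
  apply: continuous_compact; last exact: circle_compact.
  exact: continuous_subspaceT.
move=> /compact_bounded[M [_ hM]]; exists (`|M| + 1).
  by rewrite ltr_wpDl.
by move=> xi; apply: (hM (`|M| + 1)); [rewrite ltr_pwDr// ler_norm|exists xi].
Qed.

Lemma continuous_circle_measurable (f : circle R -> R) :
  continuous f -> measurable_fun setT f.
Proof.
move=> cf; apply: (measurability (@RGenOpens.G R)).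
  exact: RGenOpens.measurableE.
move=> _ [_ [a [b ->] <-]]; rewrite setTI.
apply: sub_sigma_algebra.
by apply: open_comp; [move=> x _; exact: cf|exact: interval_open].
Qed.

Lemma continuous_circle_integrable (mu : {finite_measure set (circle R) -> \bar R})
    (f : circle R -> R) :
  continuous f -> mu.-integrable setT (EFin \o f).
Proof.
move=> cf; apply: measurable_bounded_integrable => //.
- exact: fin_num_fun_lty.
- exact: continuous_circle_measurable.
- have [M M0 hM] := circle_bounded cf.
  exists M; split; first exact: num_real.
  by move=> x Mx y _; apply: le_trans (hM y) (ltW Mx).
Qed.

End circle_topology.

Notation circle_integrable mu f := (mu.-integrable setT (EFin \o f)).

(** * Integration on the circle *)

Section circle_integral.
Variables (R : realType) (mu : {finite_measure set (circle R) -> \bar R}).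
Implicit Types (f g : circle R -> R) (F G : circle R -> R[i]).

Lemma eq_circle_integrable f g : f =1 g -> circle_integrable mu f ->
  circle_integrable mu g.
Proof. by move=> /funext ->. Qed.

Lemma circle_integrableD f g : circle_integrable mu f ->
  circle_integrable mu g -> circle_integrable mu (fun xi => f xi + g xi).
Proof. by move=> hf hg; exact: (integrableD measurableT hf hg). Qed.

Lemma circle_integrableZ (c : R) f : circle_integrable mu f ->
  circle_integrable mu (fun xi => c * f xi).
Proof. by move=> hf; exact: (integrableZl measurableT c hf). Qed.

Lemma circle_integrableN f : circle_integrable mu f ->
  circle_integrable mu (fun xi => - f xi).
Proof. by move=> hf; exact: (integrableN hf). Qed.

Lemma circle_integrableB f g : circle_integrable mu f ->
  circle_integrable mu g -> circle_integrable mu (fun xi => f xi - g xi).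
Proof. by move=> hf /circle_integrableN; exact: circle_integrableD. Qed.

Lemma circle_integrable_norm f : circle_integrable mu f ->
  circle_integrable mu (fun xi => `|f xi|).
Proof. by move=> hf; apply: integrable_norm. Qed.

Lemma circle_integrable_meas f : circle_integrable mu f -> measurable_fun setT f.
Proof. by move=> /measurable_int/measurable_EFinP. Qed.

Lemma circle_integrable_le f g : measurable_fun setT f ->
  (forall xi, `|f xi| <= g xi) -> circle_integrable mu g -> circle_integrable mu f.
Proof.
move=> mf fg; apply: le_integrable => //; first exact/measurable_EFinP.
by move=> xi _ /=; rewrite lee_fin (le_trans (fg xi))// ler_norm.
Qed.

Lemma circle_integrableM f g : continuous f -> circle_integrable mu g ->
  circle_integrable mu (fun xi => f xi * g xi).
Proof.
move=> cf ig; have [M M0 hM] := circle_bounded cf.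
apply: (@circle_integrable_le _ (fun xi => M * `|g xi|)).
- apply: measurable_funM; first exact: continuous_circle_measurable.
  exact: circle_integrable_meas.
- by move=> xi; rewrite normrM ler_wpM2r.
- exact/circle_integrableZ/circle_integrable_norm.
Qed.

Lemma circle_RintegralD f g : circle_integrable mu f -> circle_integrable mu g ->
  \int[mu]_xi (f xi + g xi) = \int[mu]_xi f xi + \int[mu]_xi g xi.
Proof. exact: RintegralD. Qed.

Lemma circle_RintegralB f g : circle_integrable mu f -> circle_integrable mu g ->
  \int[mu]_xi (f xi - g xi) = \int[mu]_xi f xi - \int[mu]_xi g xi.
Proof. exact: RintegralB. Qed.

Lemma circle_RintegralZ (c : R) f : circle_integrable mu f ->
  \int[mu]_xi (c * f xi) = c * \int[mu]_xi f xi.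
Proof. exact: RintegralZl. Qed.

Lemma circle_Rintegral_le f g : circle_integrable mu f -> circle_integrable mu g ->
  (forall xi, f xi <= g xi) -> \int[mu]_xi f xi <= \int[mu]_xi g xi.
Proof. by move=> hf hg fg; apply: le_Rintegral. Qed.

Lemma circle_Rintegral_abs f : circle_integrable mu f ->
  `|\int[mu]_xi f xi| <= \int[mu]_xi `|f xi|.
Proof. exact: le_normr_Rintegral. Qed.

Definition circle_cintegrable F :=
  circle_integrable mu (fun xi => complex.Re (F xi)) /\
  circle_integrable mu (fun xi => complex.Im (F xi)).

Lemma cintegralD F G : circle_cintegrable F -> circle_cintegrable G ->
  cintegral mu (fun xi => F xi + G xi) = cintegral mu F + cintegral mu G.
Proof.
move=> [F1 F2] [G1 G2]; apply/complex_eqP => /=.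
  by rewrite -circle_RintegralD//; congr Rintegral; apply/funext => xi; rewrite cReD.
by rewrite -circle_RintegralD//; congr Rintegral; apply/funext => xi; rewrite cImD.
Qed.

Lemma cintegralZ (c : R[i]) F : circle_cintegrable F ->
  cintegral mu (fun xi => c * F xi) = c * cintegral mu F.
Proof.
move=> [F1 F2]; apply/complex_eqP; rewrite ?cReM ?cImM /=.
  rewrite -!circle_RintegralZ// -circle_RintegralB; last 2 first.
  - exact: circle_integrableZ.
  - exact: circle_integrableZ.
  by congr Rintegral; apply/funext => xi; rewrite cReM.
rewrite -!circle_RintegralZ// -circle_RintegralD; last 2 first.
- exact: circle_integrableZ.
- exact: circle_integrableZ.
by congr Rintegral; apply/funext => xi; rewrite cImM.
Qed.

Lemma cintegral_conj F : circle_cintegrable F ->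
  cintegral mu (fun xi => (F xi)^*%C) = (cintegral mu F)^*%C.
Proof.
move=> [F1 F2]; apply/complex_eqP; rewrite ?cRe_conj ?cIm_conj /=.
  by congr Rintegral; apply/funext => xi; rewrite cRe_conj.
rewrite -mulN1r -circle_RintegralZ//.
by congr Rintegral; apply/funext => xi; rewrite cIm_conj mulN1r.
Qed.

Lemma cintegrableD F G : circle_cintegrable F -> circle_cintegrable G ->
  circle_cintegrable (fun xi => F xi + G xi).
Proof.
move=> [F1 F2] [G1 G2]; split.
  apply: (eq_circle_integrable (fun xi => esym (cReD _ _))); exact: circle_integrableD.
apply: (eq_circle_integrable (fun xi => esym (cImD _ _))); exact: circle_integrableD.
Qed.

Lemma cintegrableZ (c : R[i]) F : circle_cintegrable F ->
  circle_cintegrable (fun xi => c * F xi).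
Proof.
move=> [F1 F2]; split.
  apply: (eq_circle_integrable (fun xi => esym (cReM _ _))).
  by apply: circle_integrableB; exact: circle_integrableZ.
apply: (eq_circle_integrable (fun xi => esym (cImM _ _))).
by apply: circle_integrableD; exact: circle_integrableZ.
Qed.

Lemma continuous_cintegrable F : continuous F -> circle_cintegrable F.
Proof.
move=> cF; split; apply: continuous_circle_integrable => xi;
  apply: (continuous_comp (cF xi)); [exact: continuous_Re|exact: continuous_Im].
Qed.

(** The real and imaginary parts are bounded separately, hence the factor 2. Its uses ask for
    smallness or boundedness only, so the crude constant is harmless. *)
Lemma cintegral_le F g : circle_cintegrable F -> circle_integrable mu g ->
  (forall xi, cmod (F xi) <= g xi) ->
  cmod (cintegral mu F) <= 2 * \int[mu]_xi g xi.
Proof.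
move=> [F1 F2] ig Fg; rewrite mulr_natl mulr2n.
rewrite (le_trans (cmod_le_ReIm _))//= lerD//.
  rewrite (le_trans (circle_Rintegral_abs _))// circle_Rintegral_le//.
    exact: circle_integrable_norm.
  by move=> xi; rewrite (le_trans (Re_le_cmod _)).
rewrite (le_trans (circle_Rintegral_abs _))// circle_Rintegral_le//.
  exact: circle_integrable_norm.
by move=> xi; rewrite (le_trans (Im_le_cmod _)).
Qed.

End circle_integral.

(** * Continuous functions on the circle *)

Section continuity_on_circle.
Variable R : realType.
Implicit Types F G : circle R -> R[i].

Lemma continuousCD F G : continuous F -> continuous G ->
  continuous (fun xi => F xi + G xi).
Proof. by move=> cF cG xi; apply: (@continuousD R[i] R[i] _ F G); [exact: cF|exact: cG]. Qed.

Lemma continuousCM F G : continuous F -> continuous G ->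
  continuous (fun xi => F xi * G xi).
Proof. by move=> cF cG xi; apply: (@continuousM R[i] _ F G); [exact: cF|exact: cG]. Qed.

Lemma continuousCcst (c : R[i]) : continuous (fun _ : circle R => c).
Proof. by move=> xi; exact: cst_continuous. Qed.

Lemma continuousCV F : continuous F -> (forall xi, F xi != 0) ->
  continuous (fun xi => (F xi)^-1).
Proof. by move=> cF F0 xi; apply: (@continuousV R[i] _ F); [exact: F0|exact: cF]. Qed.

Lemma continuousC_conj F : continuous F -> continuous (fun xi => (F xi)^*%C).
Proof.
move=> cF xi; apply: (continuous_comp (cF xi)).
apply: (@continuous_cmodP _ (@conjc R)) => e e0; exists e => // w h.
by rewrite -(rmorphB (@conjc R)) cmod_conj.
Qed.

Lemma continuousC_horner (p : {poly R[i]}) :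
  continuous (fun xi : circle R => p.[circle_val xi]).
Proof.
move=> xi; apply: (@continuous_comp _ _ _ (@circle_val R) (fun z => p.[z])).
  exact: continuous_circle_val.
exact: continuous_chorner.
Qed.

Lemma continuousC_Re F : continuous F -> continuous (fun xi => complex.Re (F xi)).
Proof. by move=> cF xi; apply: (continuous_comp (cF xi)); exact: continuous_Re. Qed.

Lemma continuousC_Im F : continuous F -> continuous (fun xi => complex.Im (F xi)).
Proof. by move=> cF xi; apply: (continuous_comp (cF xi)); exact: continuous_Im. Qed.

Lemma continuousRcst (c : R) : continuous (fun _ : circle R => c).
Proof. by move=> xi; exact: cst_continuous. Qed.

Lemma continuousRD (f g : circle R -> R) : continuous f -> continuous g ->
  continuous (fun xi => f xi + g xi).
Proof. by move=> cf cg xi; apply: (@continuousD R R _ f g); [exact: cf|exact: cg]. Qed.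

Lemma continuousRN (f : circle R -> R) : continuous f ->
  continuous (fun xi => - f xi).
Proof. by move=> cf xi; apply: (@continuousN R R _ f); exact: cf. Qed.

Lemma continuousRM (f g : circle R -> R) : continuous f -> continuous g ->
  continuous (fun xi => f xi * g xi).
Proof. by move=> cf cg xi; apply: (@continuousM R _ f g); [exact: cf|exact: cg]. Qed.

Lemma continuousR_expR (f : circle R -> R) : continuous f ->
  continuous (fun xi => expR (f xi)).
Proof. by move=> cf xi; apply: (continuous_comp (cf xi)); exact: continuous_expR. Qed.

Lemma continuousRV (f : circle R -> R) : continuous f -> (forall xi, f xi != 0) ->
  continuous (fun xi => (f xi)^-1).
Proof. by move=> cf f0 xi; apply: (@continuousV R _ f); [exact: f0|exact: cf]. Qed.

Lemma continuousC_cmod F : continuous F -> continuous (fun xi => cmod (F xi)).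
Proof. by move=> cF xi; apply: (continuous_comp (cF xi)); exact: continuous_cmod. Qed.

Lemma continuousC_real (f : circle R -> R) :
  continuous f -> continuous (fun xi => (f xi)%:C).
Proof.
move=> cf xi A /nbhs_cmodP[e e0 eA].
apply/nbhs_circleP; have [d d0 dA] := continuous_circle cf xi e0.
by exists d => // eta /dA h; apply: eA; rewrite -rmorphB cmod_real.
Qed.

End continuity_on_circle.

(** * Trigonometric moments of arclength *)

Section moments.
Variable R : realType.
Local Notation m := (arclength R).

Lemma arclength_Rint_cst (c : R) : \int[m]_xi c = c.
Proof. rewrite Rintegral_cst// [X in fine X](_ : _ = 1%E) ?mulr1//.
exact: probability_setT. Qed.

Lemma arclength_integral (f : circle R -> R) : continuous f ->
  (forall xi, 0 <= f xi) ->
  (\int[m]_xi (f xi)%:E =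
   (pi *+ 2)^-1%:E * \int[lebesgue_measure]_(t in `[0%R, (pi *+ 2)%R]) (f (cis t))%:E)%E.
Proof.
move=> cf f0.
have mf : measurable_fun setT (EFin \o f).
  by apply/measurable_EFinP; exact: continuous_circle_measurable.
rewrite [LHS](@ge0_integral_distribution _ _ _ _ _ (uniform_prob (pi2_gt0 R)) (cis_mfun R) (EFin \o f))//.
rewrite integral_uniform//.
- by rewrite subr0.
- by apply: measurableT_comp => //; exact: measurable_cis.
- by move=> t; rewrite /= lee_fin.
Qed.

Lemma circle_val_cisX (t : R) (k : nat) :
  circle_val (cis t) ^+ k = cos (k%:R * t) +i* sin (k%:R * t).
Proof.
elim: k => [|k ih]; first by rewrite expr0 mul0r cos0 sin0.
rewrite exprS ih; apply/complex_eqP; rewrite ?cReM ?cImM /=.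
  by rewrite -natr1 mulrDl mul1r cosD; ring.
by rewrite -natr1 mulrDl mul1r sinD; ring.
Qed.

(** The transfer to [[0, 2 pi]] in [arclength_integral] is for nonnegative integrands, so 1 is added
    to the trigonometric function; the bound on [a] and [b] makes the sum nonnegative. *)
Lemma arclength_trig (k : nat) (a b : R) : (0 < k)%N -> `|a| + `|b| <= 1 ->
  \int[m]_xi (a * complex.Re (circle_val xi ^+ k)
            + b * complex.Im (circle_val xi ^+ k)) = 0.
Proof.
move=> k0 ab.
set f := fun xi : circle R => a * complex.Re (circle_val xi ^+ k)
            + b * complex.Im (circle_val xi ^+ k).
have cX : continuous (fun xi : circle R => circle_val xi ^+ k).
  have -> : (fun xi : circle R => circle_val xi ^+ k) = (fun xi => ('X^k).[circle_val xi]).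
    by apply/funext => xi; rewrite hornerXn.
  exact: continuousC_horner.
have cf : continuous f.
  apply: continuousRD; apply: continuousRM; try exact: continuousRcst.
    exact: (continuousC_Re cX).
  exact: (continuousC_Im cX).
have f1 xi : `|f xi| <= 1.
  rewrite (le_trans (ler_normD _ _))// !normrM (le_trans _ ab)// lerD//.
    rewrite ler_piMr// (le_trans (Re_le_cmod _))//.
    by rewrite cmodX cmod_circle expr1n.
  rewrite ler_piMr// (le_trans (Im_le_cmod _))//.
  by rewrite cmodX cmod_circle expr1n.
have cf1 : continuous (fun xi => f xi + 1).
  by apply: continuousRD => //; exact: continuousRcst.
suff h : \int[m]_xi (f xi + 1) = 1.
  have := h; rewrite circle_RintegralD.
  - by rewrite arclength_Rint_cst => /eqP; rewrite -subr_eq0 addrK => /eqP.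
  - exact: continuous_circle_integrable.
  - by apply: continuous_circle_integrable; exact: continuousRcst.
rewrite /Rintegral arclength_integral//; last first.
  by move=> xi; have := f1 xi; rewrite ler_norml => /andP[h _]; lra.
(* [F] is an antiderivative of [G]. Its trigonometric part is periodic, so over a full period only
   the summand [t] contributes. *)
pose F (t : R) := (a * sin (k%:R * t) - b * cos (k%:R * t)) / k%:R + t.
pose G (t : R) := a * cos (k%:R * t) + b * sin (k%:R * t) + 1.
have kR : k%:R != 0 :> R by rewrite pnatr_eq0 -lt0n.
have dF (t : R) : is_derive t (1 : R) F (G t).
  have dk : is_derive t (1 : R) (fun t : R => k%:R * t) k%:R.
    have -> : (fun t : R => k%:R * t) = k%:R *: (@id R) by [].
    by apply: is_derive_eq; rewrite /GRing.scale /= mulr1.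
  have ds : is_derive t (1 : R) (fun t : R => sin (k%:R * t)) (cos (k%:R * t) * k%:R).
    exact: (@is_derive1_comp _ sin (fun t : R => k%:R * t)).
  have dc : is_derive t (1 : R) (fun t : R => cos (k%:R * t)) (- sin (k%:R * t) * k%:R).
    exact: (@is_derive1_comp _ cos (fun t : R => k%:R * t)).
  have -> : F = (k%:R^-1 *: (a *: (fun t : R => sin (k%:R * t)) - b *: (fun t : R => cos (k%:R * t)))) + id.
    apply/funext => x; rewrite /F fctE /=; congr (_ + _).
    by rewrite mulrC /GRing.scale.
  apply: is_derive_eq.
  rewrite /G /GRing.scale /=; field.
  by [].
have FTC : (\int[lebesgue_measure]_(t in `[0%R, (pi *+ 2)%R]) (G t)%:E =
    (F (pi *+ 2))%:E - (F 0)%:E)%E.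
  have cF (t : R) : {for t, continuous F}.
    by apply: differentiable_continuous; apply/derivable1_diffP; exact: ex_derive.
  apply: continuous_FTC2.
  - exact: pi2_gt0.
  - apply: continuous_subspaceT => t.
    have ck : {for t, continuous (fun t : R => k%:R * t)}.
      by apply: cvgMr; exact: cvg_id.
    apply: cvgD; last exact: cvg_cst.
    apply: cvgD; apply: cvgMr.
      by apply: (continuous_comp ck); exact: continuous_cos.
    by apply: (continuous_comp ck); exact: continuous_sin.
  - split.
    + by move=> t _; exact: ex_derive.
    + by apply: cvg_at_right_filter; exact: cF.
    + by apply: cvg_at_left_filter; exact: cF.
  - by move=> t _; rewrite derive1E; exact: derive_val.
have -> : (fun t => (f (cis t) + 1)%:E) = EFin \o G.
  by apply/funext => t; rewrite /f circle_val_cisX.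
rewrite FTC -EFinB -EFinM /=.
have -> : F (pi *+ 2) - F 0 = pi *+ 2.
  have h : k%:R * (pi *+ 2) = 0 + pi *+ 2 *+ k :> R by rewrite mulr_natl add0r.
  rewrite /F mulr0 h (periodicn (@sinD2pi R)) (periodicn (@cosD2pi R)).
  by ring.
by rewrite mulVf// gt_eqF// pi2_gt0.
Qed.

End moments.

Section small_powers.
Variable R : realType.

Lemma exists_small_power (c M e : R) : 0 <= c < 1 -> 0 < e ->
  exists n, c ^+ n * M < e.
Proof.
move=> /andP[c0 c1] e0.
have : geometric M c @ \oo --> 0 by apply: cvg_geometric; rewrite ger0_norm.
move=> /cvgrPdist_lt/(_ _ e0)[n _ /(_ n (leqnn n))] /=.
rewrite sub0r normrN => h; exists n.
by rewrite mulrC (le_lt_trans (ler_norm _)).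
Qed.

End small_powers.

(** * The Herglotz transform *)

Section herglotz.
Variable R : realType.
Local Notation m := (arclength R).
Implicit Types (z : R[i]) (f : circle R -> R) (p : {poly R[i]}).

Lemma cintegral_circle_horner p :
  cintegral m (fun xi => p.[circle_val xi]) = p.[0].
Proof.
have cXp (q : {poly R[i]}) k : continuous (fun xi : circle R => circle_val xi ^+ k * q.[circle_val xi]).
  have -> : (fun xi : circle R => circle_val xi ^+ k * q.[circle_val xi]) =
      (fun xi => ('X^k * q).[circle_val xi]).
    by apply/funext => xi; rewrite hornerM hornerXn.
  exact: continuousC_horner.
have X0 k : cintegral m (fun xi : circle R => circle_val xi ^+ k.+1) = 0.
  have h1 : `|1 : R| + `|0 : R| <= 1 by rewrite normr1 normr0 addr0.
  have h2 : `|0 : R| + `|1 : R| <= 1 by rewrite normr1 normr0 add0r.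
  apply/complex_eqP => /=.
    have := arclength_trig (ltn0Sn k) h1.
    by under [X in Rintegral _ _ X]eq_fun do rewrite mul1r mul0r addr0.
  have := arclength_trig (ltn0Sn k) h2.
  by under [X in Rintegral _ _ X]eq_fun do rewrite mul1r mul0r add0r.
have Xp0 (q : {poly R[i]}) k : cintegral m (fun xi : circle R => circle_val xi ^+ k.+1 * q.[circle_val xi]) = 0.
  elim/poly_ind: q k => [k|q c ih k].
    under [X in cintegral _ X]eq_fun do rewrite horner0 mulr0.
    by apply/complex_eqP => /=; rewrite arclength_Rint_cst.
  have -> : (fun xi : circle R => circle_val xi ^+ k.+1 * (q * 'X + c%:P).[circle_val xi]) =
    (fun xi => circle_val xi ^+ k.+2 * q.[circle_val xi] + c * circle_val xi ^+ k.+1).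
    by apply/funext => xi; rewrite !hornerE [in RHS]exprS; ring.
  have cX : continuous (fun xi : circle R => circle_val xi ^+ k.+1).
    have := cXp 1 k.+1.
    by under eq_fun do rewrite hornerE mulr1.
  rewrite cintegralD.
  - by rewrite ih add0r cintegralZ ?X0 ?mulr0//; apply: continuous_cintegrable.
  - by apply: continuous_cintegrable; exact: cXp.
  - by apply: cintegrableZ; apply: continuous_cintegrable.
elim/poly_ind: p => [|p c _].
  under [X in cintegral _ X]eq_fun do rewrite horner0.
  by rewrite horner0; apply/complex_eqP => /=; rewrite arclength_Rint_cst.
have -> : (fun xi : circle R => (p * 'X + c%:P).[circle_val xi]) =
    (fun xi => circle_val xi ^+ 1 * p.[circle_val xi] + c).
  by apply/funext => xi; rewrite !hornerE expr1 mulrC.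
rewrite cintegralD.
- rewrite Xp0 add0r !hornerE ?mulr0 ?add0r.
  by apply/complex_eqP => /=; rewrite arclength_Rint_cst.
- by apply: continuous_cintegrable; exact: cXp.
- by apply: continuous_cintegrable; exact: continuousCcst.
Qed.

Definition herglotz_kernel z (xi : circle R) : R[i] :=
  (circle_val xi + z) / (circle_val xi - z).

Definition herglotz z f : R[i] :=
  cintegral m (fun xi => herglotz_kernel z xi * (f xi)%:C).

Definition poisson z (xi : circle R) : R := complex.Re (herglotz_kernel z xi).

Definition poisson_mean z f : R := \int[m]_xi (poisson z xi * f xi).

Lemma cmod_circleB z xi : 1 - cmod z <= cmod (circle_val xi - z).
Proof. by rewrite -(cmod_circle xi) cmod_lerB. Qed.

Lemma cmod_circleB_gt0 z xi : cmod z < 1 -> 0 < cmod (circle_val xi - z).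
Proof. by move=> z1; rewrite (lt_le_trans _ (cmod_circleB z xi))// subr_gt0. Qed.

Lemma circleB_neq0 z xi : cmod z < 1 -> circle_val xi - z != 0.
Proof. by move=> z1; rewrite -cmod_gt0 cmod_circleB_gt0. Qed.

Definition herglotz_bound z : R := (1 + cmod z) / (1 - cmod z).

Lemma herglotz_kernel_le z xi : cmod z < 1 ->
  cmod (herglotz_kernel z xi) <= herglotz_bound z.
Proof.
move=> z1; rewrite /herglotz_kernel cmodM cmodV.
rewrite ler_pM ?invr_ge0 ?cmod_ge0//.
  by rewrite (le_trans (cmodD _ _))// cmod_circle.
by rewrite lef_pV2 ?posrE ?cmod_circleB_gt0 ?subr_gt0// cmod_circleB.
Qed.

Lemma poissonE z xi : cmod z < 1 ->
  poisson z xi = (1 - cmod z ^+ 2) / cmod (circle_val xi - z) ^+ 2.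
Proof.
move=> z1; have d0 := circleB_neq0 xi z1.
rewrite /poisson /herglotz_kernel.
set w := circle_val xi.
have -> : (w + z) / (w - z) = ((w + z) * (w - z)^*%C) * (cmod (w - z) ^- 2)%:C.
  rewrite -mulrA; congr (_ * _); apply: (mulfI d0).
  rewrite mulfV// mulrA mulC_conj -rmorphM /= mulfV// expf_neq0//.
  by rewrite gt_eqF// cmod_circleB_gt0.
rewrite cReM /= mulr0 subr0; congr (_ / _).
have := cmod_sqr w; rewrite cmod_circle expr1n => h.
rewrite cmod_sqr h.
by rewrite cReM cRe_conj cIm_conj cReB cReD cImB cImD; ring.
Qed.

Lemma poisson_ge0 z xi : cmod z < 1 -> 0 <= poisson z xi.
Proof.
move=> z1; rewrite poissonE// divr_ge0 ?sqr_ge0// subr_ge0.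
by rewrite expr_le1 ?cmod_ge0// ltW.
Qed.

Lemma poisson_le z xi : cmod z < 1 -> poisson z xi <= herglotz_bound z.
Proof.
move=> z1; rewrite (le_trans _ (herglotz_kernel_le xi z1))//.
by rewrite (le_trans (ler_norm _))// Re_le_cmod.
Qed.

Lemma continuous_herglotz_kernel z : cmod z < 1 -> continuous (herglotz_kernel z).
Proof.
move=> z1; apply: continuousCM; first last.
  apply: continuousCV; last by move=> xi; exact: circleB_neq0.
  by apply: continuousCD; [exact: continuous_circle_val|exact: continuousCcst].
by apply: continuousCD; [exact: continuous_circle_val|exact: continuousCcst].
Qed.

Lemma continuous_kernelM z (F : circle R -> R[i]) : cmod z < 1 -> continuous F ->
  continuous (fun xi => herglotz_kernel z xi * F xi).
Proof.
by move=> z1 cF; exact: (continuousCM (continuous_herglotz_kernel z1) cF).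
Qed.

Lemma continuous_poisson z : cmod z < 1 -> continuous (poisson z).
Proof. by move=> z1; exact/continuousC_Re/continuous_herglotz_kernel. Qed.

Lemma Re_herglotz z f : complex.Re (herglotz z f) = poisson_mean z f.
Proof.
rewrite /= /poisson_mean; congr Rintegral; apply/funext => xi.
by rewrite cReM /= mulr0 subr0.
Qed.

Lemma cintegrable_kernelM z f : cmod z < 1 -> circle_integrable m f ->
  circle_cintegrable m (fun xi => herglotz_kernel z xi * (f xi)%:C).
Proof.
move=> z1 fi; have cH := continuous_herglotz_kernel z1; split.
  apply: (eq_circle_integrable (f := fun xi => complex.Re (herglotz_kernel z xi) * f xi)).
    by move=> xi; rewrite [in RHS]cReM /= mulr0 subr0.
  by apply: circle_integrableM; [exact: continuousC_Re|exact: fi].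
apply: (eq_circle_integrable (f := fun xi => complex.Im (herglotz_kernel z xi) * f xi)).
  by move=> xi; rewrite [in RHS]cImM /= mulr0 add0r.
by apply: circle_integrableM; [exact: continuousC_Im|exact: fi].
Qed.

(** On the circle [conj p] is a polynomial in [1 / xi], and only its constant term survives. With
    [A q] the transform of [conj q], the relation [A q = z A(X q) + conj q(0)] iterates to
    [A(X q) = z^n A(X^n X q)]; the transforms on the right are bounded in [n], so [A(X q) = 0]. *)
Lemma herglotz_conj z p : cmod z < 1 ->
  cintegral m (fun xi => herglotz_kernel z xi * (p.[circle_val xi])^*%C) = (p.[0])^*%C.
Proof.
move=> z1; have cH := continuous_herglotz_kernel z1.
pose A (q : {poly R[i]}) := cintegral m (fun xi => herglotz_kernel z xi * (q.[circle_val xi])^*%C).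
have cHq (q : {poly R[i]}) : continuous (fun xi => herglotz_kernel z xi * (q.[circle_val xi])^*%C).
  apply: continuous_kernelM z1 _; apply: continuousC_conj; exact: continuousC_horner.
(* Since [conj xi = 1 / xi], multiplying the kernel by [1 - z conj xi] gives [1 + z conj xi], the
   conjugate of a polynomial. *)
have step q : A q = z * A ('X * q) + (q.[0])^*%C.
  have -> : (q.[0])^*%C = cintegral m (fun xi : circle R => ((1 + (z^*%C) *: 'X) * q).[circle_val xi]^*%C).
    rewrite cintegral_conj ?cintegral_circle_horner.
      by rewrite !hornerE ?mulr0 ?addr0 ?mul1r.
    by apply: continuous_cintegrable; exact: continuousC_horner.
  rewrite -cintegralZ -?cintegralD.
  - congr cintegral; apply/funext => xi; rewrite !hornerE.
    rewrite !(rmorphM, rmorphD, rmorph1) /= conjcK -(ReV_mod1 (cmod_circle xi)).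
    rewrite /herglotz_kernel.
    have h1 := circleB_neq0 xi z1; have h2 := circle_neq0 xi.
    by field; rewrite h1 h2.
  - exact: (cintegrableZ _ (continuous_cintegrable m (cHq _))).
  - by apply: continuous_cintegrable; apply: continuousC_conj; exact: continuousC_horner.
  - exact: (continuous_cintegrable m (cHq _)).
have stepX q n : A ('X * q) = z ^+ n * A ('X^n * ('X * q)).
  elim: n => [|n ih]; first by rewrite expr0 mul1r expr0 mul1r.
  rewrite ih step [in LHS]hornerM [in LHS]hornerM hornerX mul0r mulr0 conjc0 addr0.
  by rewrite mulrA -exprSr mulrA -exprS.
have AX q : A ('X * q) = 0.
  have [M M0 hM] := circle_bounded (continuousC_cmod (@continuousC_horner R q)).
  apply/eqP; rewrite -cmod_eq0 eq_le cmod_ge0 andbT; apply/ler_addgt0Pr => e e0; rewrite add0r.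
  pose K := 2 * (herglotz_bound z * M).
  have zc : 0 <= cmod z < 1 by rewrite cmod_ge0.
  have [n hn] := exists_small_power K zc e0.
  rewrite ltW// (le_lt_trans _ hn)//.
  rewrite (stepX q n) cmodM cmodX ler_wpM2l ?exprn_ge0 ?cmod_ge0//.
  rewrite (le_trans (cintegral_le (g := fun=> herglotz_bound z * M) _ _ _)).
  - by [].
  - exact: (continuous_cintegrable m (cHq _)).
  - by apply: continuous_circle_integrable; exact: continuousRcst.
  - move=> xi; rewrite !hornerE cmodM ler_pM ?cmod_ge0 ?herglotz_kernel_le//.
    rewrite cmod_conj !cmodM cmodX cmod_circle expr1n !mul1r.
    by rewrite (le_trans _ (hM xi))// ger0_norm// cmod_ge0.
  - by rewrite arclength_Rint_cst.
by rewrite -/(A p) step AX mulr0 add0r.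
Qed.

Lemma herglotz_horner z p : cmod z < 1 ->
  cintegral m (fun xi => herglotz_kernel z xi * p.[circle_val xi]) = 2 * p.[z] - p.[0].
Proof.
move=> z1; have cH := continuous_herglotz_kernel z1.
have cHq (q : {poly R[i]}) : continuous (fun xi => herglotz_kernel z xi * q.[circle_val xi]).
  apply: continuous_kernelM z1 _; exact: continuousC_horner.
have H1 : cintegral m (herglotz_kernel z) = 1.
  have := @herglotz_conj z 1 z1; rewrite hornerC conjc1 => <-.
  by congr cintegral; apply/funext => xi; rewrite hornerC conjc1 mulr1.
elim/poly_ind: p => [|p c ih].
  under [X in cintegral _ X]eq_fun do rewrite horner0 mulr0.
  by rewrite !horner0 mulr0 subr0; apply/complex_eqP => /=; rewrite arclength_Rint_cst.
(* The factor [xi] is traded for [z]: [xi] times the kernel equals [z] times the kernel plus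
   [xi + z]. What is left over is a polynomial, whose mean is its value at 0. *)
have -> : (fun xi => herglotz_kernel z xi * (p * 'X + c%:P).[circle_val xi]) =
   (fun xi => (z * (herglotz_kernel z xi * p.[circle_val xi]) + ((z%:P + 'X) * p).[circle_val xi]) + c * herglotz_kernel z xi).
  apply/funext => xi; rewrite /herglotz_kernel !(hornerM, hornerD, hornerC, hornerX).
  by have h1 := circleB_neq0 xi z1; field.
have i1 := continuous_cintegrable m (cHq p).
have i2 := continuous_cintegrable m (@continuousC_horner R ((z%:P + 'X) * p)).
have i3 := continuous_cintegrable m cH.
rewrite (cintegralD (cintegrableD (cintegrableZ z i1) i2) (cintegrableZ c i3)).
rewrite (cintegralD (cintegrableZ z i1) i2) (cintegralZ z i1) (cintegralZ c i3).
rewrite ih H1 cintegral_circle_horner.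
by rewrite !hornerE; ring.
Qed.

(** [Re p] is half of [p + conj p], whose transform is [2 p(z) - p(0) + conj p(0)]; the last two
    terms cancel because [p(0)] is real. *)
Lemma herglotz_Re p z : cmod z < 1 -> complex.Im p.[0] = 0 ->
  herglotz z (fun xi => complex.Re p.[circle_val xi]) = p.[z].
Proof.
move=> z1 p0; have cH := continuous_herglotz_kernel z1.
have -> : herglotz z (fun xi => complex.Re p.[circle_val xi]) =
    2^-1 * (cintegral m (fun xi => herglotz_kernel z xi * p.[circle_val xi]) +
     cintegral m (fun xi => herglotz_kernel z xi * (p.[circle_val xi])^*%C)).
  have c1 : continuous (fun xi => herglotz_kernel z xi * p.[circle_val xi]).
    apply: continuous_kernelM z1 _; exact: continuousC_horner.
  have c2 : continuous (fun xi => herglotz_kernel z xi * (p.[circle_val xi])^*%C).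
    apply: continuous_kernelM z1 _; apply: continuousC_conj; exact: continuousC_horner.
  have i1 := continuous_cintegrable m c1; have i2 := continuous_cintegrable m c2.
  rewrite -(cintegralD i1 i2) -(cintegralZ _ (cintegrableD i1 i2)).
  by congr cintegral; apply/funext => xi; rewrite -mulrDr addcJ; field.
rewrite herglotz_horner// herglotz_conj//.
have -> : (p.[0])^*%C = p.[0].
  by apply/complex_eqP; rewrite ?cRe_conj// cIm_conj p0 oppr0.
by field.
Qed.

Lemma poisson_mean_Re p z : cmod z < 1 ->
  poisson_mean z (fun xi => complex.Re p.[circle_val xi]) = complex.Re p.[z].
Proof.
move=> z1; pose q := p - ('i%C * (complex.Im p.[0])%:C)%:P.
have qE w : complex.Re q.[w] = complex.Re p.[w].
  by rewrite /q !hornerE cReB cReM /= !(mul0r, mulr0, subr0, mul1r).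
have -> : (fun xi => complex.Re p.[circle_val xi]) = (fun xi => complex.Re q.[circle_val xi]).
  by apply/funext => xi; rewrite qE.
rewrite -Re_herglotz herglotz_Re ?qE//.
by rewrite /q !hornerE cImB cImM /= !(mul0r, mulr0, addr0, add0r, mul1r, subrr).
Qed.

Lemma circle_integrable_poisson z f : cmod z < 1 -> circle_integrable m f ->
  circle_integrable m (fun xi => poisson z xi * f xi).
Proof. by move=> z1 fi; apply: circle_integrableM => //; exact: continuous_poisson. Qed.

Lemma poisson_mean_cst z (c : R) : cmod z < 1 -> poisson_mean z (fun=> c) = c.
Proof.
move=> z1; have := @poisson_mean_Re (c%:C)%:P z z1.
by under [X in poisson_mean _ X]eq_fun do rewrite hornerC; rewrite hornerC.
Qed.

Lemma poisson_meanD z f g : cmod z < 1 -> circle_integrable m f ->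
  circle_integrable m g ->
  poisson_mean z (fun xi => f xi + g xi) = poisson_mean z f + poisson_mean z g.
Proof.
move=> z1 fi gi; rewrite /poisson_mean.
under [X in Rintegral _ _ X]eq_fun do rewrite mulrDr.
by rewrite circle_RintegralD//; exact: circle_integrable_poisson.
Qed.

Lemma poisson_meanZ z (c : R) f : cmod z < 1 -> circle_integrable m f ->
  poisson_mean z (fun xi => c * f xi) = c * poisson_mean z f.
Proof.
move=> z1 fi; rewrite /poisson_mean.
under [X in Rintegral _ _ X]eq_fun do rewrite mulrCA.
by rewrite circle_RintegralZ//; exact: circle_integrable_poisson.
Qed.

Lemma poisson_mean_le z f g : cmod z < 1 -> circle_integrable m f ->
  circle_integrable m g -> (forall xi, f xi <= g xi) ->
  poisson_mean z f <= poisson_mean z g.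
Proof.
move=> z1 fi gi fg; apply: circle_Rintegral_le => [||xi].
- exact: circle_integrable_poisson.
- exact: circle_integrable_poisson.
- by rewrite ler_wpM2l// poisson_ge0.
Qed.

Lemma herglotzD z f g : cmod z < 1 -> circle_integrable m f ->
  circle_integrable m g ->
  herglotz z (fun xi => f xi + g xi) = herglotz z f + herglotz z g.
Proof.
move=> z1 fi gi; rewrite /herglotz -cintegralD; try exact: cintegrable_kernelM.
by congr cintegral; apply/funext => xi; rewrite rmorphD mulrDr.
Qed.

Lemma herglotz_le z f : cmod z < 1 -> circle_integrable m f ->
  cmod (herglotz z f) <= 2 * herglotz_bound z * \int[m]_xi `|f xi|.
Proof.
move=> z1 fi; have nf := circle_integrable_norm fi.
rewrite -mulrA -circle_RintegralZ//.
apply: cintegral_le; first exact: cintegrable_kernelM.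
  exact: circle_integrableZ.
move=> xi; rewrite cmodM cmod_real ler_wpM2r//; exact: herglotz_kernel_le.
Qed.

End herglotz.

Definition horner_simp := (hornerD, hornerN, hornerM, hornerC, hornerX, hornerZ, hornerXn).

(** * Uniform approximation by real parts of polynomials *)

Section trigonometric_approximation.
Variable R : realType.
Local Notation m := (arclength R).
Implicit Types (z : R[i]) (f : circle R -> R).

(** Near [xi] uniform continuity gives the term [e]; at distance at least [d] the crude bound [2 M]
    is dominated by the quadratic term. The square is chosen because the Poisson mean of
    [|eta - xi|^2] is explicit. *)
Lemma circle_modulus f (e : R) : continuous f -> 0 < e ->
  exists2 K : R, 0 <= K & forall xi eta,
    `|f eta - f xi| <= e + K * cmod (circle_val eta - circle_val xi) ^+ 2.
Proof.
move=> cf e0; have [d d0 hd] := circle_unif_continuous cf e0.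
have [M M0 hM] := circle_bounded cf.
exists (2 * M / d ^+ 2); first by rewrite divr_ge0 ?sqr_ge0// mulr_ge0// ltW.
move=> xi eta; have [h|h] := ltP (cmod (circle_val eta - circle_val xi)) d.
  rewrite (le_trans (ltW (hd _ _ h)))// lerDl mulr_ge0 ?sqr_ge0//.
  by rewrite divr_ge0 ?sqr_ge0// mulr_ge0// ltW.
rewrite (le_trans (ler_normB _ _))//.
have h1 : 2 * M <= 2 * M / d ^+ 2 * cmod (circle_val eta - circle_val xi) ^+ 2.
  rewrite -mulrA ler_peMr//; first by rewrite mulr_ge0// ltW.
  by rewrite mulrC ler_pdivlMr ?exprn_gt0// mul1r lerXn2r// nnegrE ?cmod_ge0// ltW.
have := hM xi; have := hM eta; lra.
Qed.

(* Korovkin: the Poisson means at [rho xi] of [1] and of [|eta - xi|^2] are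
   explicit, and they control every continuous function. *)
Lemma poisson_mean_approx f (e : R) : continuous f -> 0 < e ->
  exists2 rho : R, 0 < rho < 1 & forall xi,
    `|f xi - poisson_mean (rho%:C * circle_val xi) f| < e.
Proof.
move=> cf e0; have e20 : 0 < e / 2 by lra.
have [K K0 hK] := circle_modulus cf e20.
(* Here [t = 1 - rho]: the Poisson mean of [|eta - xi|^2] at [rho xi] turns out to be [2 t]. *)
have [t [t0 t1 q2]] : exists t, [/\ 0 < t, t < 1 & K * (2 * t) < e / 2].
  have den : 0 < 2 * e + 8 * (K + 1) by lra.
  exists (e / (2 * e + 8 * (K + 1))); split; first by rewrite divr_gt0.
    by rewrite ltr_pdivrMr//; lra.
  rewrite mulrCA mulrA mulrA ltr_pdivrMr//.
  by nra.
pose rho := 1 - t.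
have r01 : 0 < rho < 1 by rewrite /rho; apply/andP; split; lra.
exists rho => // xi; set z := _ * circle_val xi.
have /andP[r0 r1] := r01.
have z1 : cmod z < 1 by rewrite /z cmodM cmod_real cmod_circle mulr1 gtr0_norm.
have fi : circle_integrable m f by exact: continuous_circle_integrable.
(* On the circle [|eta - xi|^2 = 2 - 2 Re(conj xi * eta)], the real part of a polynomial, so its
   Poisson mean is an evaluation. *)
pose p : {poly R[i]} := 2%:P - (2 * (circle_val xi)^*%C) *: 'X.
have pE eta : complex.Re p.[circle_val eta] = cmod (circle_val eta - circle_val xi) ^+ 2.
  rewrite cmod_sqr /p !hornerE cReB cImB.
  have := cmod_sqr (circle_val eta); have := cmod_sqr (circle_val xi).
  rewrite !cmod_circle expr1n => h1 h2.
  rewrite cReB.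
  have -> : complex.Re (2 : R[i]) = 2 by [].
  rewrite -mulrA cReM.
  have -> : complex.Re (2 : R[i]) = 2 by [].
  have -> : complex.Im (2 : R[i]) = 0 by rewrite /= addr0.
  rewrite cReM cRe_conj cIm_conj mul0r subr0.
  transitivity (1 + 1 - 2 * (complex.Re (circle_val xi) * complex.Re (circle_val eta) - - complex.Im (circle_val xi) * complex.Im (circle_val eta))); first by ring.
  by move: h1 h2; lra.
have pz : complex.Re p.[z] = 2 * (1 - rho).
  rewrite /p !horner_simp /z.
  have -> : 2 * (circle_val xi)^*%C * (rho%:C * circle_val xi) =
     2 * (rho%:C * (circle_val xi * (circle_val xi)^*%C)) by ring.
  rewrite mulC_conj cmod_circle expr1n mulr1 cReB.
  have -> : (2 : R[i]) = (2 : R)%:C by rewrite rmorph_nat.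
  by rewrite -rmorphM /=; ring.
have i0 (c : R) : circle_integrable m (fun=> c).
  by apply: continuous_circle_integrable; exact: continuousRcst.
have ip : circle_integrable m (fun eta => complex.Re p.[circle_val eta]).
  by apply: continuous_circle_integrable; apply: continuousC_Re; exact: continuousC_horner.
(* The cases [s = 1] and [s = -1] give the two halves of the estimate from one comparison. *)
have ub (s : R) : `|s| <= 1 -> s * poisson_mean z f <= s * f xi + (e / 2 + K * (2 * (1 - rho))).
  move=> s1; rewrite -poisson_meanZ//.
  rewrite -pz -(poisson_mean_Re p z1) -(poisson_meanZ K z1 ip).
  rewrite -(poisson_mean_cst (s * f xi) z1) -(poisson_mean_cst (e / 2) z1).
  have iKp := circle_integrableZ K ip.
  rewrite -(poisson_meanD z1 (i0 _) iKp) -poisson_meanD//; last first.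
    exact: circle_integrableD.
  apply: poisson_mean_le => //; first exact: circle_integrableZ.
    by apply: circle_integrableD => //; exact: circle_integrableD.
  move=> eta; rewrite pE -lerBlDl -mulrBr (le_trans _ (hK xi eta))//.
  by rewrite (le_trans (ler_norm _))// normrM ler_piMl.
have h1 := ub 1; have h2 := ub (-1).
rewrite normrN normr1 in h2; rewrite normr1 in h1.
have := h1 (lexx _); have := h2 (lexx _).
have -> : 1 - rho = t by rewrite /rho; ring.
move: (poisson_mean z f) (f xi) (K * _) q2 => a b c q2 h3 h4.
by clear -q2 h3 h4; rewrite ltr_norml; apply/andP; split; lra.
Qed.

(** Taylor expansion with integral remainder. The kernel is [1 + 2 z / (xi - z)], and [1 / (xi - z)
    = conj xi + z conj xi / (xi - z)] on the circle, so each step splits off one coefficient. The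
    constant 4 combines the 2 of the kernel with the 2 of [cintegral_le]. *)
Lemma herglotz_taylor f n : circle_integrable m f ->
  exists2 G : {poly R[i]}, complex.Im G.[0] = 0 & forall z, cmod z < 1 ->
    cmod (herglotz z f - G.[z]) <=
      cmod z ^+ n * (4 * \int[m]_xi `|f xi| / (1 - cmod z)).
Proof.
move=> fi; have nf := circle_integrable_norm fi.
pose T k z := cintegral m (fun xi => ((circle_val xi)^*%C ^+ k / (circle_val xi - z)) * (f xi)%:C).
pose a k := cintegral m (fun xi => ((circle_val xi)^*%C ^+ k) * (f xi)%:C).
have ci (F : circle R -> R[i]) : continuous F -> circle_cintegrable m (fun xi => F xi * (f xi)%:C).
  move=> cF; split.
    apply: (eq_circle_integrable (f := fun xi => complex.Re (F xi) * f xi)).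
      by move=> xi; rewrite cReM /= mulr0 subr0.
    by apply: circle_integrableM; [exact: continuousC_Re|exact: fi].
  apply: (eq_circle_integrable (f := fun xi => complex.Im (F xi) * f xi)).
    by move=> xi; rewrite cImM /= mulr0 add0r.
  by apply: circle_integrableM; [exact: continuousC_Im|exact: fi].
have cX k : continuous (fun xi : circle R => (circle_val xi)^*%C ^+ k).
  elim: k => [|k ih]; first by under eq_fun do rewrite expr0; exact: continuousCcst.
  have -> : (fun xi : circle R => (circle_val xi)^*%C ^+ k.+1) =
    (fun xi => (circle_val xi)^*%C * (circle_val xi)^*%C ^+ k).
    by apply/funext => xi; rewrite exprS.
  apply: continuousCM; last exact: ih.
  by apply: continuousC_conj; exact: continuous_circle_val.
have cV z : cmod z < 1 -> continuous (fun xi : circle R => (circle_val xi - z)^-1).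
  move=> z1; apply: continuousCV; last by move=> xi; exact: circleB_neq0.
  by apply: continuousCD; [exact: continuous_circle_val|exact: continuousCcst].
have iT k z : cmod z < 1 -> circle_cintegrable m (fun xi => ((circle_val xi)^*%C ^+ k / (circle_val xi - z)) * (f xi)%:C).
  by move=> z1; apply: ci; exact: (continuousCM (cX k) (cV z z1)).
have ia k : circle_cintegrable m (fun xi => ((circle_val xi)^*%C ^+ k) * (f xi)%:C).
  by apply: ci; exact: cX.
have T_step k z : cmod z < 1 -> T k z = a k.+1 + z * T k.+1 z.
  move=> z1; rewrite /T /a -(cintegralZ z (iT k.+1 z z1)).
  rewrite -(cintegralD (ia k.+1) (cintegrableZ z (iT k.+1 z z1))).
  congr cintegral; apply/funext => xi.
  have h1 := circleB_neq0 xi z1.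
  rewrite !exprS -(ReV_mod1 (cmod_circle xi)).
  have h2 := circle_neq0 xi.
  set X := (_^-1) ^+ k.
  by field; rewrite h1 h2.
have hT z : cmod z < 1 -> herglotz z f = a 0%N + 2 * z * T 0%N z.
  move=> z1; rewrite /T /a -(cintegralZ (2 * z) (iT 0%N z z1)).
  rewrite -(cintegralD (ia 0%N) (cintegrableZ (2 * z) (iT 0%N z z1))).
  congr cintegral; apply/funext => xi.
  have h1 := circleB_neq0 xi z1.
  by rewrite !expr0 /herglotz_kernel; field.
have [G hG] : exists G : {poly R[i]}, forall z, cmod z < 1 -> T 0%N z = G.[z] + z ^+ n * T n z.
  elim: n => [|k [G hG]].
    by exists 0 => z z1; rewrite horner0 expr0 add0r mul1r.
  exists (G + a k.+1 *: 'X^k) => z z1.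
  rewrite hG// T_step// !horner_simp exprSr; ring.
exists ((a 0%N)%:P + 2 *: ('X * G)).
  rewrite !horner_simp mul0r mulr0 addr0 /=.
  under [X in Rintegral _ _ X]eq_fun do rewrite mulr0 mul0r addr0.
  by rewrite arclength_Rint_cst.
move=> z z1; rewrite hT// hG// !horner_simp.
have -> : a 0%N + 2 * z * (G.[z] + z ^+ n * T n z) - (a 0%N + 2 * (z * G.[z])) =
   z ^+ n * (2 * z * T n z) by ring.
rewrite cmodM cmodX ler_wpM2l ?exprn_ge0 ?cmod_ge0//.
have z10 : 0 < 1 - cmod z by rewrite subr_gt0.
have hTn : cmod (T n z) <= 2 * ((1 - cmod z)^-1 * \int[m]_xi `|f xi|).
  rewrite -circle_RintegralZ//; apply: cintegral_le; first exact: iT.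
    exact: circle_integrableZ.
  move=> xi; rewrite !cmodM cmod_real ler_wpM2r// cmodX cmod_conj cmod_circle expr1n mul1r cmodV.
  by rewrite lef_pV2 ?posrE ?cmod_circleB_gt0// cmod_circleB.
have c2 : cmod (2 : R[i]) = 2 by rewrite -(rmorph_nat (real_complex R)) cmod_real gtr0_norm.
rewrite !cmodM c2.
have -> : 4 * \int[m]_xi `|f xi| / (1 - cmod z) = 2 * (2 * ((1 - cmod z)^-1 * \int[m]_xi `|f xi|)) by ring.
rewrite -mulrA ler_wpM2l// (le_trans _ hTn)// ler_piMl ?cmod_ge0// ltW//.
Qed.

(** The Poisson mean at [rho xi] is the real part of the Herglotz transform, which a Taylor
    polynomial [G] approximates uniformly on [|z| = rho]; the dilation [G(rho X)] brings this back
    to the unit circle. *)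
Lemma trigonometric_approximation f (e : R) : continuous f -> 0 < e ->
  exists2 H : {poly R[i]}, complex.Im H.[0] = 0 &
    forall xi, `|f xi - complex.Re H.[circle_val xi]| < e.
Proof.
move=> cf e0; have e20 : 0 < e / 2 by lra.
have [rho /andP[r0 r1] hr] := poisson_mean_approx cf e20.
have fi : circle_integrable m f by exact: continuous_circle_integrable.
have r01 : 0 <= rho < 1 by rewrite ltW.
have [n hn] := exists_small_power (4 * \int[m]_xi `|f xi| / (1 - rho)) r01 e20.
have [G G0 hG] := herglotz_taylor n fi.
exists (G \Po (rho%:C *: 'X)).
  by rewrite horner_comp !hornerE ?mulr0.
move=> xi; rewrite horner_comp !hornerE.
set z := _ * circle_val xi.
have zr : cmod z = rho by rewrite /z cmodM cmod_real cmod_circle mulr1 gtr0_norm.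
have z1 : cmod z < 1 by rewrite zr.
have := hr xi; rewrite -/z -Re_herglotz => h1.
have := hG z z1; rewrite zr => /le_lt_trans/(_ hn) h2.
have h3 : `|complex.Re (herglotz z f) - complex.Re G.[z]| < e / 2.
  by rewrite -cReB (le_lt_trans (Re_le_cmod _)).
have -> : f xi - complex.Re G.[z] = (f xi - complex.Re (herglotz z f)) + (complex.Re (herglotz z f) - complex.Re G.[z]) by ring.
by rewrite (le_lt_trans (ler_normD _ _))//; lra.
Qed.

End trigonometric_approximation.

(** * The complex exponential *)

Section complex_exponential.
Variable R : realType.
Implicit Types z w : R[i].

Lemma cexpD z w : cexp (z + w) = cexp z * cexp w.
Proof.
rewrite /cexp cReD cImD expRD cosD sinD.
by apply/complex_eqP; rewrite ?cReM ?cImM /=; ring.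
Qed.

Lemma cmod_cexp z : cmod (cexp z) = expR (complex.Re z).
Proof.
rewrite /cexp cmodM cmod_real ger0_norm ?expR_ge0//=.
by rewrite cos2Dsin2 sqrtr1 mulr1.
Qed.

Lemma cexp0 : cexp (0 : R[i]) = 1.
Proof. by rewrite /cexp /= expR0 cos0 sin0 mul1r. Qed.

Lemma cexp_real (x : R) : cexp x%:C = (expR x)%:C.
Proof. by rewrite /cexp /= cos0 sin0 mulr1. Qed.

Lemma cexp_neq0 z : cexp z != 0.
Proof. by rewrite -cmod_gt0 cmod_cexp expR_gt0. Qed.

Lemma cexpX z n : cexp (n%:R * z) = cexp z ^+ n.
Proof.
elim: n => [|n ih]; first by rewrite mul0r cexp0 expr0.
by rewrite -natr1 mulrDl mul1r cexpD ih exprSr.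
Qed.

Lemma is_derive_expansion (f : R -> R) (x df e : R) :
  is_derive x (1 : R) f df -> 0 < e ->
  exists2 d : R, 0 < d & forall h, `|h| < d -> `|f (x + h) - f x - df * h| <= e * `|h|.
Proof.
move=> fdf e0.
have : h^-1 *: (f (h *: (1 : R) + x) - f x) @[h --> (0 : R)^'] --> df.
  by rewrite -(derive_val (is_derive := fdf)); exact: (@ex_derive _ _ _ _ _ _ _ fdf).
move=> /cvgrPdist_le/(_ e e0)[d /= d0 hd]; exists d => // h hlt.
have [->|h0] := eqVneq h 0; first by rewrite addr0 subrr mulr0 subr0 normr0 mulr0.
have := hd h; rewrite /= sub0r normrN => /(_ hlt h0).
rewrite /GRing.scale /= mulr1 (addrC h x) => hh.
have -> : f (x + h) - f x - df * h = - ((df - h^-1 * (f (x + h) - f x)) * h) by field.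
by rewrite normrN normrM ler_wpM2r.
Qed.

Lemma cexp_expansion (e : R) : 0 < e -> exists2 d : R, 0 < d &
  forall w, cmod w < d -> cmod (cexp w - 1 - w) <= e * cmod w.
Proof.
(* The real and imaginary parts of the error are at most [4 k |w|] and [5 k |w|], so [16 k <= e] is
   ample. *)
move=> e0; have [k [k0 k1 ke]] : exists k : R, [/\ 0 < k, k <= 1 & k <= e / 16].
  exists (Num.min 1 (e / 16)); split; last 2 first.
  - by rewrite ge_min lexx.
  - by rewrite ge_min lexx orbT.
  - by rewrite lt_min ltr01 divr_gt0.
have [d1 d10 h1] := is_derive_expansion (is_derive_expR (0 : R)) k0.
have [d2 d20 h2] := is_derive_expansion (is_derive_sin (0 : R)) k0.
have [d3 d30 h3] := is_derive_expansion (is_derive_cos (0 : R)) k0.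
exists (Num.min (Num.min d1 d2) (Num.min d3 k)).
  by rewrite !lt_min d10 d20 d30 k0.
move=> w; rewrite !lt_min => /andP[/andP[w1 w2] /andP[w3 wk]].
have rw := Re_le_cmod w; have iw := Im_le_cmod w.
set x := complex.Re w in rw; set y := complex.Im w in iw.
have := h1 x (le_lt_trans rw w1); have := h2 y (le_lt_trans iw w2).
have := h3 y (le_lt_trans iw w3).
rewrite !add0r expR0 sin0 cos0 oppr0 mul0r !mul1r ?addr0 !subr0 ?addr0 => hc hs he.
have w0 := cmod_ge0 w.
set c := cmod w in w0 w1 w2 w3 wk rw iw *.
have he1 : `|expR x - 1| <= 2 * c.
  have -> : expR x - 1 = (expR x - 1 - x) + x by ring.
  rewrite (le_trans (ler_normD _ _))//.
  have : k * `|x| <= c by rewrite (le_trans _ rw)// ler_piMl.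
  by lra.
have e3 : `|expR x| <= 3.
  have -> : expR x = (expR x - 1) + 1 by ring.
  rewrite (le_trans (ler_normD _ _))// normr1; lra.
have kc (a : R) : `|a| <= c -> k * `|a| <= k * c by move=> ac; rewrite ler_wpM2l// ltW.
have reE : complex.Re (cexp w - 1 - w) = expR x * (cos y - 1) + (expR x - 1 - x).
  by rewrite !cReB /cexp cReM /= -/x -/y; ring.
have imE : complex.Im (cexp w - 1 - w) = expR x * (sin y - y) + (expR x - 1) * y.
  by rewrite !cImB /cexp cImM /= -/x -/y; ring.
rewrite (le_trans (cmod_le_ReIm _))// reE imE.
have r1 : `|expR x * (cos y - 1) + (expR x - 1 - x)| <= 4 * (k * c).
  rewrite (le_trans (ler_normD _ _))// normrM.
  have := kc x rw; have := kc y iw => ky kx.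
  have : `|expR x| * `|cos y - 1| <= 3 * (k * c).
    by rewrite ler_pM// (le_trans hc).
  by lra.
have r2 : `|expR x * (sin y - y) + (expR x - 1) * y| <= 5 * (k * c).
  rewrite (le_trans (ler_normD _ _))// !normrM.
  have := kc y iw => ky.
  have a1 : `|expR x| * `|sin y - y| <= 3 * (k * c).
    by rewrite ler_pM// (le_trans hs).
  have a2 : `|expR x - 1| * `|y| <= 2 * k * c.
    by rewrite ler_pM// (le_trans he1)// ler_wpM2l// ltW.
  by lra.
have : k * c <= e / 16 * c by rewrite ler_wpM2r.
have : 0 <= e * c by rewrite mulr_ge0// ltW.
by lra.
Qed.

Lemma cmod_subX (a b : R[i]) (r : R) n : cmod a <= r -> cmod b <= r -> 1 <= r ->
  cmod (a ^+ n - b ^+ n) <= n%:R * r ^+ n * cmod (a - b).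
Proof.
move=> ar br r1; have r0 : 0 <= r by lra.
elim: n => [|n ih]; first by rewrite !expr0 subrr cmod0 mul0r mul0r.
have -> : a ^+ n.+1 - b ^+ n.+1 = a * (a ^+ n - b ^+ n) + (a - b) * b ^+ n.
  by rewrite !exprS; ring.
rewrite (le_trans (cmodD _ _))// !cmodM.
have h1 : cmod a * cmod (a ^+ n - b ^+ n) <= r * (n%:R * r ^+ n * cmod (a - b)).
  by rewrite ler_pM ?cmod_ge0.
have h2 : cmod (a - b) * cmod (b ^+ n) <= cmod (a - b) * r ^+ n.+1.
  rewrite ler_wpM2l ?cmod_ge0// cmodX.
  rewrite (@le_trans _ _ (r ^+ n))//; first by rewrite lerXn2r ?nnegrE ?cmod_ge0.
  by rewrite exprS ler_peMl// exprn_ge0.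
rewrite (le_trans (lerD h1 h2))// exprS -natr1 le_eqVlt; apply/orP; left.
by apply/eqP; ring.
Qed.

(** [e^z] is the [N]-th power of [e^(z/N)], which differs from [1 + z/N] by at most [k M / N].
    Raising to the power [N] costs a factor [N e^M], so the total error [k M e^M] does not involve
    [N], and [k] is chosen accordingly. *)
Lemma cexp_polynomial_approx (M e : R) : 0 <= M -> 0 < e ->
  exists N : nat, forall z, cmod z <= M ->
    cmod (cexp z - (1 + N%:R^-1 * z) ^+ N) < e.
Proof.
move=> M0 e0; pose k := e / (2 * expR M * (M + 1)).
have eM := expR_gt0 M.
have k0 : 0 < k by rewrite divr_gt0// !mulr_gt0//; lra.
have [d d0 hd] := cexp_expansion k0.
pose N := (Num.trunc (M / d)).+1.
have N0 : 0 < N%:R :> R by rewrite ltr0n.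
have Nd : M / N%:R < d.
  by rewrite ltr_pdivrMr// mulrC -ltr_pdivrMr// truncnS_gt.
exists N => z zM.
have NC : (N%:R : R[i]) != 0 by rewrite pnatr_eq0.
have cN : cmod (N%:R^-1 * z) = cmod z / N%:R.
  by rewrite cmodM cmodV -(rmorph_nat (real_complex R)) cmod_real gtr0_norm// mulrC.
set w := _^-1 * z in cN *.
have wM : cmod w <= M / N%:R by rewrite cN ler_wpM2r ?invr_ge0// ltW.
have -> : cexp z = cexp w ^+ N by rewrite -cexpX /w mulrA mulfV// mul1r.
have h1 : cmod (cexp w - (1 + w)) <= k * (M / N%:R).
  have -> : cexp w - (1 + w) = cexp w - 1 - w by ring.
  rewrite (le_trans (hd _ (le_lt_trans wM Nd)))// ler_wpM2l//; exact: ltW.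
have h2 : cmod (cexp w) <= expR (M / N%:R).
  rewrite cmod_cexp ler_expR (le_trans _ wM)// (le_trans (ler_norm _))//.
  exact: Re_le_cmod.
have h3 : cmod (1 + w) <= expR (M / N%:R).
  rewrite (le_trans (cmodD _ _))// cmod1 (le_trans _ (expR_ge1Dx _))//.
  by rewrite lerD2l.
have h4 : 1 <= expR (M / N%:R).
  by rewrite -expR0 ler_expR divr_ge0// ltW.
rewrite (le_lt_trans (cmod_subX N h2 h3 h4))//.
rewrite -expRM_natl (_ : N%:R * (M / N%:R) = M); last by rewrite mulrC divfK// gt_eqF.
rewrite (@le_lt_trans _ _ (N%:R * expR M * (k * (M / N%:R))))//.
  by rewrite ler_wpM2l// mulr_ge0// ltW.
have -> : N%:R * expR M * (k * (M / N%:R)) = e * (M / (2 * (M + 1))).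
  rewrite /k; field.
  by rewrite !gt_eqF//; lra.
rewrite gtr_pMr// ltr_pdivrMr//; lra.
Qed.

End complex_exponential.

(** * The disk algebra and Jensen's inequality *)

Section disk_algebra.
Variable R : realType.
Local Notation m := (arclength R).
Implicit Types (z : R[i]) (f g : R[i] -> R[i]) (p : {poly R[i]}).

(** The disk algebra, as the uniform closure of the polynomials on the closed disk. This encoding
    makes every property of polynomials that is stable under uniform limits available without
    complex differentiability; values outside the closed disk are irrelevant. *)
Definition disk_algebra f := forall e : R, 0 < e ->
  exists p : {poly R[i]}, forall z, cmod z <= 1 -> cmod (f z - p.[z]) < e.

Lemma disk_algebra_horner p : disk_algebra (fun z => p.[z]).
Proof. by move=> e e0; exists p => z _; rewrite subrr cmod0. Qed.

Lemma horner_disk_bounded p :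
  exists2 M : R, 0 <= M & forall z, cmod z <= 1 -> cmod p.[z] <= M.
Proof.
exists (\sum_(i < size p) cmod p`_i).
  by apply: sumr_ge0 => i _; exact: cmod_ge0.
move=> z z1; rewrite horner_coef (le_trans (cmod_sum _ _ _))//.
apply: ler_sum => i _; rewrite cmodM cmodX ler_piMr ?cmod_ge0//.
by rewrite exprn_ile1// cmod_ge0.
Qed.

Lemma disk_algebra_bounded f : disk_algebra f ->
  exists2 M : R, 0 <= M & forall z, cmod z <= 1 -> cmod (f z) <= M.
Proof.
move=> /(_ 1 ltr01)[p hp]; have [M M0 hM] := horner_disk_bounded p.
exists (M + 1); first by rewrite addr_ge0.
move=> z z1; rewrite -(subrK p.[z] (f z)) addrC (le_trans (cmodD _ _))//.
by rewrite lerD ?hM// ltW// hp.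
Qed.

Lemma disk_algebraM f g : disk_algebra f -> disk_algebra g ->
  disk_algebra (fun z => f z * g z).
Proof.
move=> hf hg e e0.
have [M M0 hM] := disk_algebra_bounded hf.
have M1 : 0 < M + 1 by rewrite ltr_wpDl.
have [q hq] := hg (e / 2 / (M + 1)) (divr_gt0 (divr_gt0 e0 (ltr0n _ 2)) M1).
have [K K0 hK] := horner_disk_bounded q.
have K1 : 0 < K + 1 by rewrite ltr_wpDl.
have [p hp] := hf (e / 2 / (K + 1)) (divr_gt0 (divr_gt0 e0 (ltr0n _ 2)) K1).
exists (p * q) => z z1; rewrite hornerM.
have -> : f z * g z - p.[z] * q.[z] = f z * (g z - q.[z]) + (f z - p.[z]) * q.[z] by ring.
rewrite (le_lt_trans (cmodD _ _))// !cmodM (splitr e) ltr_leD//.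
  rewrite (@le_lt_trans _ _ ((M + 1) * cmod (g z - q.[z])))//.
    by rewrite ler_wpM2r ?cmod_ge0// (le_trans (hM z z1))// lerDl.
  by rewrite mulrC -ltr_pdivlMr// hq.
rewrite (@le_trans _ _ (cmod (f z - p.[z]) * (K + 1)))//.
  by rewrite ler_wpM2l ?cmod_ge0// (le_trans (hK z z1))// lerDl.
by rewrite -ler_pdivlMr// ltW// hp.
Qed.

Lemma disk_algebra_geometric (b : R[i]) : cmod b < 1 ->
  disk_algebra (fun z => (1 - b * z)^-1).
Proof.
move=> b1 e e0; have b10 : 0 < 1 - cmod b by rewrite subr_gt0.
have [n hn] : exists n, cmod b ^+ n * (1 - cmod b)^-1 < e.
  by apply: exists_small_power => //; rewrite cmod_ge0.
exists (\sum_(i < n) (b ^+ i) *: 'X^i) => z z1.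
have bz : cmod (b * z) <= cmod b by rewrite cmodM ler_piMr ?cmod_ge0.
have d : 1 - cmod b <= cmod (1 - b * z).
  by rewrite -[X in X - _](@cmod1 R) (le_trans _ (cmod_lerB _ _))// lerD2l lerN2.
have d0 : 1 - b * z != 0 by rewrite -cmod_gt0 (lt_le_trans b10).
have -> : (\sum_(i < n) (b ^+ i) *: 'X^i).[z] = (1 - (b * z) ^+ n) / (1 - b * z).
  rewrite horner_sum.
  under eq_bigr do rewrite hornerZ hornerXn -exprMn.
  apply: (mulIf d0); rewrite divfK//.
  by rewrite -[RHS]opprB subrX1; ring.
have -> : (1 - b * z)^-1 - (1 - (b * z) ^+ n) / (1 - b * z) = (b * z) ^+ n / (1 - b * z).
  by field.
rewrite cmodM cmodV cmodX (le_lt_trans _ hn)//.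
rewrite ler_pM ?exprn_ge0 ?invr_ge0 ?cmod_ge0//.
  by rewrite lerXn2r ?nnegrE ?cmod_ge0.
by rewrite lef_pV2// posrE// (lt_le_trans b10).
Qed.

Lemma disk_algebra_prod (n : nat) (F : 'I_n -> R[i] -> R[i]) :
  (forall i, disk_algebra (F i)) -> disk_algebra (fun z => \prod_(i < n) F i z).
Proof.
elim: n F => [|n ih] F hF.
  move=> e e0; exists 1 => z _.
  by rewrite big_ord0 hornerC subrr cmod0.
have := disk_algebraM (hF ord0) (ih (fun i => F (lift ord0 i)) (fun i => hF _)).
move=> h e e0; have [p hp] := h e e0; exists p => z z1.
by rewrite big_ord_recl hp.
Qed.

Lemma disk_algebra_cexp p : disk_algebra (fun z => cexp p.[z]).
Proof.
move=> e e0; have [M M0 hM] := horner_disk_bounded p.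
have [N hN] := cexp_polynomial_approx M0 e0.
exists ((1 + N%:R^-1 *: p) ^+ N) => z z1.
rewrite horner_exp !(hornerD, hornerZ, hornerC).
exact: hN (hM z z1).
Qed.

Lemma disk_algebra_continuous f : disk_algebra f ->
  continuous (fun xi : circle R => f (circle_val xi)).
Proof.
move=> hf xi A /nbhs_cmodP[e e0 eA].
have e30 : 0 < e / 3 by rewrite divr_gt0.
have [p hp] := hf _ e30.
have : nbhs p.[circle_val xi] [set w | cmod (p.[circle_val xi] - w) < e / 3].
  by apply/nbhs_cmodP; exists (e / 3).
move=> /(@continuousC_horner R p xi) /nbhs_circleP[d d0 hd].
apply/nbhs_circleP; exists d => // eta /hd /= h; apply: eA.
have h1 : cmod (f (circle_val xi) - p.[circle_val xi]) < e / 3 by rewrite hp// cmod_circle.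
have h2 : cmod (f (circle_val eta) - p.[circle_val eta]) < e / 3 by rewrite hp// cmod_circle.
have -> : f (circle_val xi) - f (circle_val eta) = (f (circle_val xi) - p.[circle_val xi])
  + (p.[circle_val xi] - p.[circle_val eta]) - (f (circle_val eta) - p.[circle_val eta]) by ring.
rewrite (le_lt_trans (cmodB _ _))//.
rewrite (@le_lt_trans _ _ (cmod (f (circle_val xi) - p.[circle_val xi]) +
  cmod (p.[circle_val xi] - p.[circle_val eta]) + cmod (f (circle_val eta) - p.[circle_val eta])))//.
  by rewrite lerD2r cmodD.
by lra.
Qed.

Lemma continuous_cmod_sqr (F : circle R -> R[i]) : continuous F ->
  continuous (fun xi => cmod (F xi) ^+ 2).
Proof.
move=> cF; have -> : (fun xi => cmod (F xi) ^+ 2) = (fun xi => cmod (F xi) * cmod (F xi)).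
  by apply/funext => xi; rewrite expr2.
by apply: continuousRM; exact: continuousC_cmod.
Qed.

(** With [c = p(z)], the Poisson mean of [|p - c|^2] is nonnegative; its cross term is the real part
    of the polynomial [q], with mean [-2 |c|^2]. *)
Lemma horner_subharmonic p z : cmod z < 1 ->
  cmod p.[z] ^+ 2 <= poisson_mean z (fun xi => cmod p.[circle_val xi] ^+ 2).
Proof.
move=> z1; set c := p.[z].
have ip : circle_integrable m (fun xi => cmod p.[circle_val xi] ^+ 2).
  by apply: continuous_circle_integrable; apply: continuous_cmod_sqr; exact: continuousC_horner.
pose q := (-2 * c^*%C) *: p.
have iq : circle_integrable m (fun xi => complex.Re q.[circle_val xi]).
  by apply: continuous_circle_integrable; apply: continuousC_Re; exact: continuousC_horner.
have i0 (a : R) : circle_integrable m (fun=> a).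
  by apply: continuous_circle_integrable; exact: continuousRcst.
have qc : complex.Re q.[z] = - 2 * cmod c ^+ 2.
  rewrite /q hornerZ -/c -mulrA (mulrC (c^*%C)) mulC_conj.
  have -> : (-2 : R[i]) = (-2 : R)%:C by rewrite rmorphN rmorph_nat.
  by rewrite -rmorphM.
have h0 : 0 <= poisson_mean z (fun xi => cmod p.[circle_val xi] ^+ 2 +
    (complex.Re q.[circle_val xi] + cmod c ^+ 2)).
  rewrite -(poisson_mean_cst 0 z1); apply: poisson_mean_le => //.
    by apply: circle_integrableD => //; exact: circle_integrableD.
  move=> xi; set w := p.[circle_val xi].
  have -> : cmod w ^+ 2 + (complex.Re q.[circle_val xi] + cmod c ^+ 2) = cmod (w - c) ^+ 2.
    rewrite /q hornerZ -/w !cmod_sqr cReB cImB !cReM cRe_conj cIm_conj.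
    have -> : (-2 : R[i]) = (-2 : R)%:C by rewrite rmorphN rmorph_nat.
    by rewrite cImM cRe_conj cIm_conj /=; ring.
  exact: sqr_ge0.
rewrite !poisson_meanD// in h0; last exact: circle_integrableD.
rewrite poisson_mean_Re// qc poisson_mean_cst// in h0.
move: h0; move: (poisson_mean _ _) (cmod c ^+ 2) => a b.
by clear; lra.
Qed.

Lemma disk_algebra_subharmonic f z : disk_algebra f -> cmod z < 1 ->
  cmod (f z) ^+ 2 <= poisson_mean z (fun xi => cmod (f (circle_val xi)) ^+ 2).
Proof.
move=> hf z1; have [M M0 hM] := disk_algebra_bounded hf.
have i0 (a : R) : circle_integrable m (fun=> a).
  by apply: continuous_circle_integrable; exact: continuousRcst.
have ifs : circle_integrable m (fun xi => cmod (f (circle_val xi)) ^+ 2).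
  by apply: continuous_circle_integrable; apply: continuous_cmod_sqr; exact: disk_algebra_continuous.
apply/ler_addgt0Pr => e e0.
pose d := Num.min 1 (e / (2 * (2 * M + 1))).
have D0 : 0 < 2 * (2 * M + 1) by lra.
have d0 : 0 < d by rewrite lt_min ltr01 divr_gt0.
have d1 : d <= 1 by rewrite ge_min lexx.
have de : 2 * (d * (2 * M + 1)) <= e.
  by rewrite mulrCA -ler_pdivlMr// ge_min lexx orbT.
have [p hp] := hf d d0.
have close w : cmod w <= 1 -> `|cmod (f w) ^+ 2 - cmod p.[w] ^+ 2| <= d * (2 * M + 1).
  move=> w1; rewrite subr_sqr normrM ler_pM//.
    by rewrite (le_trans (cmod_distB _ _))// ltW// hp.
  rewrite ger0_norm ?addr_ge0 ?cmod_ge0//.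
  have h1 : cmod p.[w] <= M + 1.
    rewrite -(subrK (f w) p.[w]) addrC (le_trans (cmodD _ _))// lerD ?hM//.
    by rewrite cmodBC (le_trans (ltW (hp w w1))).
  have := hM w w1; lra.
have h1 := close z (ltW z1).
have h2 : poisson_mean z (fun xi => cmod p.[circle_val xi] ^+ 2) <=
  poisson_mean z (fun xi => cmod (f (circle_val xi)) ^+ 2) + d * (2 * M + 1).
  rewrite -[X in _ + X](poisson_mean_cst _ z1) -poisson_meanD//.
  apply: poisson_mean_le => //.
  - by apply: continuous_circle_integrable; apply: continuous_cmod_sqr; exact: continuousC_horner.
  - exact: circle_integrableD.
  - move=> xi; have := close (circle_val xi); rewrite cmod_circle => /(_ (lexx _)).
    by rewrite ler_norml => /andP[? ?]; lra.
have h3 := horner_subharmonic p z1.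
move: h1; rewrite ler_norml => /andP[_ h1].
move: h1 h2 h3 de; move: (poisson_mean _ _) (poisson_mean _ _) (d * _) (cmod (f z) ^+ 2) (cmod p.[z] ^+ 2).
by clear; move=> *; lra.
Qed.

(** Inside the disk this is subharmonicity of [|f|^2] against a constant; a boundary point is itself
    a point of the circle. *)
Lemma disk_algebra_max f z (c : R) : disk_algebra f -> cmod z <= 1 ->
  (forall xi : circle R, cmod (f (circle_val xi)) <= c) -> cmod (f z) <= c.
Proof.
move=> hf; rewrite le_eqVlt => /predU1P[z1 hc|z1 hc].
  have zP : [set w : R[i] | `|w| = 1] z by rewrite /= cmodE z1.
  exact: (hc (SigSub (mem_set zP))).
have c0 : 0 <= c by rewrite (le_trans _ (hc (cis 0)))// cmod_ge0.
rewrite -(@ler_pXn2r _ 2)// ?nnegrE ?cmod_ge0//.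
rewrite (le_trans (disk_algebra_subharmonic hf z1))//.
rewrite -(poisson_mean_cst (c ^+ 2) z1); apply: poisson_mean_le => //.
- by apply: continuous_circle_integrable; apply: continuous_cmod_sqr; exact: disk_algebra_continuous.
- by apply: continuous_circle_integrable; exact: continuousRcst.
- by move=> xi; rewrite lerXn2r ?nnegrE ?cmod_ge0.
Qed.

(** Subharmonicity of [log |f|] without taking logarithms on the circle, so zeros of [f] cause no
    trouble. If [Re H] approximates [psi], then [f e^(-H/2)] is in the disk algebra and its squared
    modulus is at most [e^e] on the circle; subharmonicity of that square at [z] gives the claim up
    to [2 e]. *)
Lemma disk_algebra_log_subharmonic f z (psi : circle R -> R) : disk_algebra f ->
  cmod z < 1 -> continuous psi ->
  (forall xi, cmod (f (circle_val xi)) ^+ 2 <= expR (psi xi)) ->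
  cmod (f z) ^+ 2 <= expR (poisson_mean z psi).
Proof.
move=> hf z1 cpsi hpsi.
have ipsi : circle_integrable m psi by exact: continuous_circle_integrable.
have i0 (a : R) : circle_integrable m (fun=> a).
  by apply: continuous_circle_integrable; exact: continuousRcst.
have key (e : R) : 0 < e -> cmod (f z) ^+ 2 <= expR (poisson_mean z psi + 2 * e).
  move=> e0; have [H H0 hH] := trigonometric_approximation cpsi e0.
  pose G := (- (2^-1 : R[i])) *: H.
  have GE w : complex.Re G.[w] = - (2^-1 * complex.Re H.[w]).
    rewrite /G hornerZ (_ : - 2^-1 = (- 2^-1 : R)%:C); last first.
      by rewrite rmorphN fmorphV rmorph_nat.
    by rewrite cReM /= mul0r subr0 mulNr.
  have := disk_algebra_subharmonic (disk_algebraM hf (disk_algebra_cexp G)) z1.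
  have -> : cmod (f z * cexp G.[z]) ^+ 2 = cmod (f z) ^+ 2 * expR (- complex.Re H.[z]).
    by rewrite cmodM exprMn cmod_cexp -expRM_natl GE; congr (_ * expR _); field.
  move=> h1.
  have h2 : poisson_mean z (fun xi => cmod (f (circle_val xi) * cexp G.[circle_val xi]) ^+ 2) <= expR e.
    rewrite -(poisson_mean_cst (expR e) z1); apply: poisson_mean_le => //.
      apply: continuous_circle_integrable; apply: continuous_cmod_sqr.
      exact: (disk_algebra_continuous (disk_algebraM hf (disk_algebra_cexp G))).
    move=> xi; rewrite cmodM exprMn cmod_cexp -expRM_natl GE.
    rewrite (@le_trans _ _ (expR (psi xi) * expR (- complex.Re H.[circle_val xi])))//.
      rewrite (_ : 2%:R * - (2^-1 * complex.Re H.[circle_val xi]) = - complex.Re H.[circle_val xi]); last by field.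
      by rewrite ler_wpM2r// expR_ge0.
    rewrite -expRD ler_expR; have := hH xi; rewrite ltr_norml => /andP[_ /ltW].
    by [].
  have h3 : complex.Re H.[z] <= poisson_mean z psi + e.
    rewrite -poisson_mean_Re// -[X in _ + X](poisson_mean_cst e z1) -poisson_meanD//.
    apply: poisson_mean_le => //.
    - by apply: continuous_circle_integrable; apply: continuousC_Re; exact: continuousC_horner.
    - exact: circle_integrableD.
    - by move=> xi; have := hH xi; rewrite ltr_norml => /andP[? _]; lra.
  have h4 : cmod (f z) ^+ 2 <= expR (e + complex.Re H.[z]).
    rewrite expRD -ler_pdivrMr ?expR_gt0// -expRN.
    exact: le_trans h1 h2.
  by rewrite (le_trans h4)// ler_expR; lra.
have [->|f0] := eqVneq (f z) 0; first by rewrite cmod0 expr0n expR_ge0.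
have f0' : 0 < cmod (f z) ^+ 2 by rewrite exprn_gt0// cmod_gt0.
rewrite -(lnK f0') ler_expR; apply/ler_addgt0Pr => e e0.
rewrite -ler_expR lnK//.
have := key (e / 2); rewrite (_ : 2 * (e / 2) = e); last by field.
by apply; rewrite divr_gt0.
Qed.

End disk_algebra.

Section jensen.
Variable R : realType.
Local Notation m := (arclength R).
Implicit Types (z : R[i]) (f : R[i] -> R[i]) (U w : circle R -> R).

(** Replacing [f] by [min(f, g)], equal to it almost everywhere, reduces to a pointwise
    comparison. *)
Lemma ae_Rintegral_le (mu : {finite_measure set (circle R) -> \bar R}) (f g : circle R -> R) :
  circle_integrable mu f -> circle_integrable mu g ->
  {ae mu, forall xi, f xi <= g xi} -> \int[mu]_xi f xi <= \int[mu]_xi g xi.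
Proof.
move=> fi gi fg; pose h := fun xi => Num.min (f xi) (g xi).
have mf := circle_integrable_meas fi; have mg := circle_integrable_meas gi.
have mh : measurable_fun setT h by exact: measurable_minr.
have hi : circle_integrable mu h.
  apply: (@circle_integrable_le _ _ _ (fun xi => `|f xi| + `|g xi|)) => //.
    by move=> xi; rewrite /h /Num.min; case: ifP => _; rewrite ?lerDl ?lerDr.
  by apply: circle_integrableD; exact: circle_integrable_norm.
have -> : \int[mu]_xi f xi = \int[mu]_xi h xi.
  congr fine; apply: ae_eq_integral => //.
  - exact/measurable_EFinP.
  - exact/measurable_EFinP.
  - by apply: filterS fg => xi fgxi _; rewrite /h min_l.
by apply: circle_Rintegral_le => // xi; rewrite /h ge_min lexx orbT.
Qed.

Lemma continuousR_ln (f : circle R -> R) : continuous f -> (forall xi, 0 < f xi) ->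
  continuous (fun xi => ln (f xi)).
Proof.
move=> cf f0 xi; apply: (@continuous_comp _ _ _ f (@ln R)); first exact: cf.
exact: continuous_ln.
Qed.

(* Jensen's inequality for the probability measure [poisson z dm], applied to
   [ln (|f|^2 + d) + U] *)
Lemma disk_algebra_jensen f U w z : disk_algebra f -> cmod z < 1 ->
  circle_integrable m U -> circle_integrable m w -> (forall xi, 0 <= w xi) ->
  {ae m, forall xi, expR (U xi) = w xi} ->
  cmod (f z) ^+ 2 * expR (poisson_mean z U) <=
    poisson_mean z (fun xi => cmod (f (circle_val xi)) ^+ 2 * w xi).
Proof.
move=> hf z1 iU iw w0 Uw.
have cf2 : continuous (fun xi : circle R => cmod (f (circle_val xi)) ^+ 2).
  by apply: continuous_cmod_sqr; exact: disk_algebra_continuous.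
have ifw : circle_integrable m (fun xi => cmod (f (circle_val xi)) ^+ 2 * w xi).
  exact: circle_integrableM.
have i0 (a : R) : circle_integrable m (fun=> a).
  by apply: continuous_circle_integrable; exact: continuousRcst.
have key (d : R) : 0 < d -> cmod (f z) ^+ 2 * expR (poisson_mean z U) <=
    poisson_mean z (fun xi => cmod (f (circle_val xi)) ^+ 2 * w xi) + d * poisson_mean z w.
  (* Adding [d] keeps the logarithm finite and continuous at zeros of [f]; [d] is sent to 0 at the
     end. *)
  move=> d0; pose h (xi : circle R) := cmod (f (circle_val xi)) ^+ 2 + d.
  have h0 xi : 0 < h xi by rewrite ltr_wpDl// sqr_ge0.
  have ch : continuous h by apply: continuousRD => //; exact: continuousRcst.
  pose psi xi := ln (h xi).
  have cpsi : continuous psi by exact: continuousR_ln.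
  have ipsi : circle_integrable m psi by exact: continuous_circle_integrable.
  have psiE xi : expR (psi xi) = h xi by rewrite lnK// posrE.
  have h1 : cmod (f z) ^+ 2 <= expR (poisson_mean z psi).
    by apply: disk_algebra_log_subharmonic => // xi; rewrite psiE lerDl ltW.
  pose c := poisson_mean z psi + poisson_mean z U.
  rewrite (@le_trans _ _ (expR c))//.
    by rewrite expRD ler_wpM2r// expR_ge0.
  have iV : circle_integrable m (fun xi => psi xi + U xi) by exact: circle_integrableD.
  (* The tangent line of the exponential at [c]: it lies below [exp(psi + U)], and its Poisson mean
     is exactly [e^c] because [c] is the mean of [psi + U]. *)
  have iT : circle_integrable m (fun xi => expR c * ((psi xi + U xi) + (1 - c))).
    by apply: circle_integrableZ; exact: circle_integrableD.
  have -> : expR c = poisson_mean z (fun xi => expR c * ((psi xi + U xi) + (1 - c))).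
    rewrite poisson_meanZ//; last exact: circle_integrableD.
    rewrite poisson_meanD// poisson_meanD// poisson_mean_cst// -/c.
    by rewrite addrCA subrr addr0 mulr1.
  rewrite -poisson_meanZ// -poisson_meanD//; last exact: circle_integrableZ.
  apply: ae_Rintegral_le.
  - exact: circle_integrable_poisson.
  - apply: circle_integrable_poisson => //.
    by apply: circle_integrableD => //; exact: circle_integrableZ.
  - apply: filterS Uw => xi Uwxi.
    rewrite ler_wpM2l ?poisson_ge0// -mulrDl -/(h xi) -psiE -Uwxi -expRD.
    set x := psi xi + U xi.
    have -> : expR x = expR c * expR (x - c) by rewrite -expRD addrC subrK.
    rewrite ler_wpM2l ?expR_ge0// (le_trans _ (expR_ge1Dx _))//.
    by rewrite addrCA.
apply/ler_addgt0Pr => e e0.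
have p0 : 0 <= poisson_mean z w.
  rewrite -(poisson_mean_cst 0 z1); exact: poisson_mean_le.
have p1 : 0 < poisson_mean z w + 1 by rewrite ltr_wpDl.
rewrite (le_trans (key (e / (poisson_mean z w + 1)) (divr_gt0 e0 p1)))// lerD2l.
by rewrite mulrAC ler_pdivrMr// ler_wpM2l ?lerDl// ltW.
Qed.

End jensen.

(** * Integration against a decomposed measure *)

Section decomposition.
Variable R : realType.
Local Notation m := (arclength R).
Variables (sigma : {finite_measure set (circle R) -> \bar R}) (v : circle R -> R).
Variable sigmas : {measure set (circle R) -> \bar R}.
Hypothesis dec : lebesgue_decomposition sigma v sigmas.

Let mv : measurable_fun setT v. Proof. by case: dec. Qed.
Let v0 xi : 0 <= v xi. Proof. by case: dec. Qed.

Local Open Scope ereal_scope.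
Import HBNNSimple.

Let decomposition_indic (A : set (circle R)) : measurable A ->
  \int[sigma]_xi (\1_A xi)%:E =
  \int[m]_xi ((\1_A xi)%:E * (v xi)%:E) + \int[sigmas]_xi (\1_A xi)%:E.
Proof.
move=> mA; rewrite !integral_indic// setIT.
have [_ _ _ decA] := dec; rewrite [LHS](decA A mA); congr (_ + _).
rewrite integral_mkcond; apply: eq_integral => xi _.
rewrite patchE indicE; case: ifPn => _; first by rewrite mul1e.
by rewrite mul0e.
Qed.

Let decomposition_nnsfun (h : {nnsfun circle R >-> R}) :
  \int[sigma]_xi (h xi)%:E =
  \int[m]_xi ((h xi)%:E * (v xi)%:E) + \int[sigmas]_xi (h xi)%:E.
Proof.
have mr (r : R) : measurable (h @^-1` [set r]) by exact: measurable_sfunP.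
have rI (r : R) xi : 0 <= (r * \1_(h @^-1` [set r]) xi)%:E.
  by rewrite EFinM nnfun_muleindic_ge0.
have mrI (r : R) : measurable_fun setT (fun xi => (r * \1_(h @^-1` [set r]) xi)%:E).
  by apply/measurable_EFinP; apply: measurable_funM.
have mrIv (r : R) : measurable_fun setT (fun xi => (r * \1_(h @^-1` [set r]) xi)%:E * (v xi)%:E).
  by apply: emeasurable_funM => //; exact/measurable_EFinP.
under [LHS]eq_integral do rewrite fimfunE -fsumEFin//.
under [in X in _ = X + _]eq_integral.
  move=> xi _; rewrite fimfunE -fsumEFin// ge0_mule_fsuml//; over.
under [in X in _ = _ + X]eq_integral do rewrite fimfunE -fsumEFin//.
rewrite /= !ge0_integral_fsum//; last first.
  by move=> r xi _; rewrite mule_ge0// lee_fin.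
rewrite -fsbig_split//=; apply: eq_fsbigr => r rr.
have r0 : (0 <= r)%R.
  by move: rr; rewrite inE => -[xi _ <-].
under eq_integral do rewrite EFinM.
rewrite ge0_integralZl//; last by apply/measurable_EFinP.
under [in X in _ = X + _]eq_integral do rewrite EFinM -muleA.
rewrite ge0_integralZl//; last 2 first.
- by apply: emeasurable_funM; apply/measurable_EFinP.
- by move=> xi _; rewrite mule_ge0// lee_fin.
under [in X in _ = _ + X]eq_integral do rewrite EFinM.
rewrite ge0_integralZl//; last by apply/measurable_EFinP.
rewrite -ge0_muleDr//; last 2 first.
- by apply: integral_ge0 => xi _; rewrite mule_ge0// lee_fin.
- exact: integral_ge0.
by rewrite decomposition_indic.
Qed.

Lemma decomposition_integral (F : circle R -> \bar R) :
  measurable_fun setT F -> (forall xi, 0 <= F xi) ->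
  \int[sigma]_xi F xi = \int[m]_xi (F xi * (v xi)%:E) + \int[sigmas]_xi F xi.
Proof.
move=> mF F0; pose h := nnsfun_approx measurableT mF.
have hF xi : EFin \o h^~ xi @ \oo --> F xi.
  by apply: cvg_nnsfun_approx.
have nd xi : {homo (fun n => (h n xi)%:E) : a b / (a <= b)%N >-> a <= b}.
  by move=> a b ab; rewrite lee_fin; exact/lefP/nd_nnsfun_approx.
have cv (mu : {measure set (circle R) -> \bar R}) :
    \int[mu]_xi (h n xi)%:E @[n --> \oo] --> \int[mu]_xi F xi.
  have -> : \int[mu]_xi F xi = \int[mu]_xi (limn (fun n => (h n xi)%:E)).
    by apply: eq_integral => xi _; apply/esym/cvg_lim => //; exact: hF.
  apply: cvg_monotone_convergence => //.
  - by move=> n; exact/measurable_EFinP.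
  - by move=> n xi _; rewrite lee_fin.
have cvm : \int[m]_xi ((h n xi)%:E * (v xi)%:E) @[n --> \oo] -->
    \int[m]_xi (F xi * (v xi)%:E).
  have -> : \int[m]_xi (F xi * (v xi)%:E) = \int[m]_xi (limn (fun n => (h n xi)%:E * (v xi)%:E)).
    apply: eq_integral => xi _; apply/esym/cvg_lim => //.
    by apply: cvgeZr => //; exact: hF.
  apply: cvg_monotone_convergence => //.
  - by move=> n; apply: emeasurable_funM; apply/measurable_EFinP.
  - by move=> n xi _; rewrite mule_ge0// lee_fin.
  - by move=> xi _ a b ab; rewrite lee_wpmul2r// ?lee_fin//; exact: nd.
have cvs := cv sigma.
rewrite (_ : (fun n => \int[sigma]_xi (h n xi)%:E) = (fun n =>
  \int[m]_xi ((h n xi)%:E * (v xi)%:E) + \int[sigmas]_xi (h n xi)%:E)) in cvs; last first.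
  by apply/funext => n; rewrite decomposition_nnsfun.
apply: (cvg_unique _ cvs) => //; apply: cvgeD; [|exact: cvm|exact: cv].
apply: ge0_adde_def; rewrite inE; apply: integral_ge0 => xi _ //.
by rewrite mule_ge0// lee_fin.
Qed.

Local Close Scope ereal_scope.

Lemma density_integrable (F : circle R -> R) : continuous F ->
  circle_integrable m (fun xi => F xi * v xi).
Proof.
move=> cF; apply: circle_integrableM => //.
apply/integrableP; split; first exact/measurable_EFinP.
have := @decomposition_integral (cst 1%E) (measurable_cst _) (fun=> lee01).
rewrite integral_cst// mul1e => h.
have : (sigma setT < +oo)%E by exact: fin_num_fun_lty.
rewrite [X in (X < _)%E -> _]h.
apply: le_lt_trans; rewrite -[leLHS]adde0 leeD//; last exact: integral_ge0.
rewrite le_eqVlt; apply/orP; left; apply/eqP; apply: eq_integral => xi _.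
by rewrite mul1e /= ger0_norm.
Qed.

(** The singular part contributes a nonnegative amount. This is how a bound by the density alone, as
    Jensen's inequality provides, becomes one by [sigma]. *)
Lemma density_integral_le (F : circle R -> R) : continuous F -> (forall xi, 0 <= F xi) ->
  \int[m]_xi (F xi * v xi) <= \int[sigma]_xi F xi.
Proof.
move=> cF F0.
have iF : circle_integrable sigma F by exact: continuous_circle_integrable.
rewrite fine_le//.
- by apply: integrable_fin_num => //; exact: density_integrable.
- exact: integrable_fin_num.
rewrite (@decomposition_integral (EFin \o F)).
- by rewrite leeDl//; apply: integral_ge0 => xi _; rewrite lee_fin.
- by apply/measurable_EFinP; exact: continuous_circle_measurable.
- by move=> xi; rewrite lee_fin.
Qed.

End decomposition.

(** * Density of continuous functions and Szegő weights *)

Section continuous_density.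
Variable R : realType.
Variables mu1 mu2 : {finite_measure set (circle R) -> \bar R}.
Implicit Types (f g : circle R -> R).

Let bounded_integrable (mu : {finite_measure set (circle R) -> \bar R}) f (M : R) :
  measurable_fun setT f -> (forall xi, `|f xi| <= M) -> circle_integrable mu f.
Proof.
move=> mf fM; apply: (@circle_integrable_le _ _ _ (fun=> M)) => //.
by apply: continuous_circle_integrable; exact: continuousRcst.
Qed.

Lemma bounded_dominated_cvg (mu : {finite_measure set (circle R) -> \bar R})
    (h : circle R -> R) (f_ : nat -> circle R -> R) :
  circle_integrable mu h -> (forall n, measurable_fun setT (f_ n)) ->
  (forall n xi, `|f_ n xi| <= h xi) ->
  (forall xi, f_ n xi @[n --> \oo] --> (0 : R)) ->
  forall e : R, 0 < e -> \forall n \near \oo, \int[mu]_xi `|f_ n xi| < e.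
Proof.
move=> hi mf fh f0 e e0.
have := @dominated_convergence _ _ _ mu setT measurableT
  (fun n => EFin \o (fun xi => `|f_ n xi|)) (cst 0%E) (EFin \o h).
case.
- by move=> n; apply/measurable_EFinP; exact: measurableT_comp.
- exact: measurable_cst.
- apply: aeW => xi _ /=; apply: cvg_EFin; first by apply: nearW.
  by rewrite -[X in _ --> X](@normr0 _ R); apply: cvg_norm; exact: f0.
- exact: hi.
- by apply: aeW => xi n _ /=; rewrite lee_fin normr_id.
move=> _ _; rewrite integral0 => /fine_cvgP[_] /cvgrPdist_lt/(_ e e0).
apply: filterS => n /=; rewrite sub0r normrN; apply: le_lt_trans.
exact: ler_norm.
Qed.

(** The same [phi] must serve both measures: a Szegő weight is controlled through its logarithm in
    [L^1(m)] and through its exponential in [L^1(sigma)]. *)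
Definition continuously_approximable f := forall e : R, 0 < e ->
  exists2 phi, continuous phi &
    \int[mu1]_xi `|f xi - phi xi| < e /\ \int[mu2]_xi `|f xi - phi xi| < e.

Let Rint_norm_triangle (mu : {finite_measure set (circle R) -> \bar R}) f g :
  circle_integrable mu f -> circle_integrable mu g ->
  \int[mu]_xi `|f xi + g xi| <= \int[mu]_xi `|f xi| + \int[mu]_xi `|g xi|.
Proof.
move=> fi gi; rewrite -circle_RintegralD; try exact: circle_integrable_norm.
apply: circle_Rintegral_le.
- exact/circle_integrable_norm/circle_integrableD.
- by apply: circle_integrableD; exact: circle_integrable_norm.
- by move=> xi; exact: ler_normD.
Qed.

Lemma approximableD f g (M : R) : measurable_fun setT f -> measurable_fun setT g ->
  (forall xi, `|f xi| <= M) -> (forall xi, `|g xi| <= M) ->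
  continuously_approximable f -> continuously_approximable g ->
  continuously_approximable (fun xi => f xi + g xi).
Proof.
move=> mf mg fM gM hf hg e e0; have e20 : 0 < e / 2 by rewrite divr_gt0.
have [phi cphi [f1 f2]] := hf _ e20; have [psi cpsi [g1 g2]] := hg _ e20.
exists (fun xi => phi xi + psi xi); first exact: continuousRD.
have E xi : f xi + g xi - (phi xi + psi xi) = (f xi - phi xi) + (g xi - psi xi) by ring.
have H (mu : {finite_measure set (circle R) -> \bar R}) :
    \int[mu]_xi `|f xi - phi xi| < e / 2 -> \int[mu]_xi `|g xi - psi xi| < e / 2 ->
    \int[mu]_xi `|f xi + g xi - (phi xi + psi xi)| < e.
  move=> h1 h2; under [X in Rintegral _ _ X]eq_fun do rewrite E.
  have i1 := circle_integrableB (bounded_integrable mu mf fM) (continuous_circle_integrable mu cphi).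
  have i2 := circle_integrableB (bounded_integrable mu mg gM) (continuous_circle_integrable mu cpsi).
  apply: le_lt_trans (Rint_norm_triangle i1 i2) _.
  by rewrite (splitr e); exact: ltrD.
by split; exact: H.
Qed.

Lemma approximableZ (c : R) f (M : R) : measurable_fun setT f ->
  (forall xi, `|f xi| <= M) -> continuously_approximable f ->
  continuously_approximable (fun xi => c * f xi).
Proof.
move=> mf fM hf e e0; have c0 : 0 < `|c| + 1 by rewrite ltr_wpDl.
have [phi cphi [f1 f2]] := hf _ (divr_gt0 e0 c0).
exists (fun xi => c * phi xi); first by apply: continuousRM => //; exact: continuousRcst.
have H (mu : {finite_measure set (circle R) -> \bar R}) :
    \int[mu]_xi `|f xi - phi xi| < e / (`|c| + 1) ->
    \int[mu]_xi `|c * f xi - c * phi xi| < e.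
  move=> h1; under [X in Rintegral _ _ X]eq_fun do rewrite -mulrBr normrM.
  have ifp : circle_integrable mu (fun xi => f xi - phi xi).
    apply: circle_integrableB; first exact: (bounded_integrable _ mf fM).
    exact: continuous_circle_integrable.
  rewrite circle_RintegralZ; last exact: circle_integrable_norm.
  have i0 : 0 <= \int[mu]_xi `|f xi - phi xi| by exact: Rintegral_ge0.
  rewrite (@le_lt_trans _ _ ((`|c| + 1) * \int[mu]_xi `|f xi - phi xi|))//.
    by rewrite ler_wpM2r// lerDl.
  by rewrite mulrC -ltr_pdivlMr.
by split; exact: H.
Qed.

Lemma approximable_lim f (M : R) : measurable_fun setT f -> (forall xi, `|f xi| <= M) ->
  (forall e : R, 0 < e -> exists g, [/\ measurable_fun setT g,
     (exists K : R, forall xi, `|g xi| <= K), continuously_approximable g,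
     \int[mu1]_xi `|f xi - g xi| < e & \int[mu2]_xi `|f xi - g xi| < e]) ->
  continuously_approximable f.
Proof.
move=> mf fM h e e0; have e20 : 0 < e / 2 by rewrite divr_gt0.
have [g [mg [K gK] hg g1 g2]] := h _ e20.
have [phi cphi [p1 p2]] := hg _ e20; exists phi => //.
have E xi : f xi - phi xi = (f xi - g xi) + (g xi - phi xi) by ring.
have H (mu : {finite_measure set (circle R) -> \bar R}) :
    \int[mu]_xi `|f xi - g xi| < e / 2 -> \int[mu]_xi `|g xi - phi xi| < e / 2 ->
    \int[mu]_xi `|f xi - phi xi| < e.
  move=> h1 h2; under [X in Rintegral _ _ X]eq_fun do rewrite E.
  have ig := bounded_integrable mu mg gK.
  have i1 := circle_integrableB (bounded_integrable mu mf fM) ig.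
  have i2 := circle_integrableB ig (continuous_circle_integrable mu cphi).
  apply: le_lt_trans (Rint_norm_triangle i1 i2) _.
  by rewrite (splitr e); exact: ltrD.
by split; exact: H.
Qed.

Lemma approximable_pointwise_lim f (f_ : nat -> circle R -> R) (M : R) :
  measurable_fun setT f -> (forall n, measurable_fun setT (f_ n)) ->
  (forall xi, `|f xi| <= M) -> (forall n xi, `|f_ n xi| <= M) ->
  (forall xi, f_ n xi @[n --> \oo] --> f xi) ->
  (forall n, continuously_approximable (f_ n)) -> continuously_approximable f.
Proof.
move=> mf mf_ fM f_M cvf h; apply: (approximable_lim mf fM) => e e0.
have H (mu : {finite_measure set (circle R) -> \bar R}) :
    \forall n \near \oo, \int[mu]_xi `|f xi - f_ n xi| < e.
  apply: (@bounded_dominated_cvg mu (fun=> M + M) (fun n xi => f xi - f_ n xi)) => //.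
  - by apply: continuous_circle_integrable; exact: continuousRcst.
  - by move=> n; exact: measurable_funB.
  - by move=> n xi; rewrite (le_trans (ler_normB _ _))// lerD.
  - move=> xi; rewrite -[X in _ --> X](subrr (f xi)).
    by apply: cvgB; [exact: cvg_cst|exact: cvf].
near \oo => n; exists (f_ n); split => //.
- by exists M => xi; exact: f_M.
- by near: n; exact: H.
- by near: n; exact: H.
Unshelve. all: by end_near. Qed.

Lemma approximable_continuous f : continuous f -> continuously_approximable f.
Proof.
move=> cf e e0; exists f => //.
have H (mu : {finite_measure set (circle R) -> \bar R}) : \int[mu]_xi `|f xi - f xi| < e.
  under [X in Rintegral _ _ X]eq_fun do rewrite subrr normr0.
  by rewrite Rintegral_cst// mul0r.
by split.
Qed.

Lemma indic_norm_le1 (A : set (circle R)) xi : `|\1_A xi : R| <= 1.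
Proof. by rewrite indicE; case: (_ \in _); rewrite ?normr1 ?normr0. Qed.

(** The continuous functions [1 - exp(- n dist(xi, complement of A))] converge pointwise to the
    indicator. The whole circle is treated apart, since the distance to the empty set is
    meaningless. *)
Lemma approximable_open (A : set (circle R)) : open A ->
  continuously_approximable (\1_A : circle R -> R).
Proof.
move=> oA; have [AT|/existsNP[eta0 Aeta0]] := pselect (forall xi, A xi).
  have -> : A = setT by apply/seteqP; split.
  apply: approximable_continuous; rewrite (_ : \1_ _ = fun=> 1).
    exact: continuousRcst.
  by apply/funext => xi; rewrite indicE in_setT.
pose S (xi : circle R) := [set cmod (circle_val xi - circle_val eta) | eta in ~` A].
pose d (xi : circle R) : R := inf (S xi).
have S0 xi : S xi !=set0 by exists (cmod (circle_val xi - circle_val eta0)); exists eta0.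
have lS xi : lbound (S xi) 0 by move=> _ [eta _ <-]; exact: cmod_ge0.
have hS xi : has_inf (S xi) by split; [exact: S0|exists 0; exact: lS].
have d0 xi : 0 <= d xi by apply: lb_le_inf; [exact: S0|exact: lS].
have dle xi eta : ~ A eta -> d xi <= cmod (circle_val xi - circle_val eta).
  by move=> h; apply: ge_inf; [exists 0; exact: lS|exists eta].
have dlip xi eta : d xi <= cmod (circle_val xi - circle_val eta) + d eta.
  rewrite -lerBlDl; apply: lb_le_inf; first exact: S0.
  move=> _ [zeta hz <-]; rewrite lerBlDl (le_trans (dle xi zeta hz))//.
  have -> : circle_val xi - circle_val zeta = (circle_val xi - circle_val eta) +
    (circle_val eta - circle_val zeta) by ring.
  exact: cmodD.
have cd : continuous d.
  move=> xi B; rewrite -nbhs_ballE => -[r /= r0 rB].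
  apply/nbhs_circleP; exists r => // eta h; apply: rB; rewrite /ball /=.
  rewrite (le_lt_trans _ h)// ler_norml lerBlDr dlip andbT.
  by rewrite lerNl opprB lerBlDr cmodBC dlip.
have dN xi : ~ A xi -> d xi = 0.
  move=> h; apply/eqP; rewrite eq_le d0 andbT.
  by rewrite (le_trans (dle xi xi h))// subrr cmod0.
have dA xi : A xi -> 0 < d xi.
  move=> h; have : nbhs xi A by exact: open_nbhs_nbhs.
  move=> /nbhs_circleP[r r0 hr]; rewrite (lt_le_trans r0)//.
  apply: lb_le_inf; first exact: S0.
  by move=> _ [eta heta <-]; rewrite leNgt; apply/negP => /hr.
pose f_ (n : nat) xi := 1 - expR (- (n%:R * d xi)).
have cf_ n : continuous (f_ n).
  apply: continuousRD; first exact: continuousRcst.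
  apply: continuousRN; apply: continuousR_expR; apply: continuousRN.
  by apply: continuousRM => //; exact: continuousRcst.
apply: (@approximable_pointwise_lim _ f_ 1).
- apply: measurable_indic; exact: sub_sigma_algebra.
- by move=> n; exact: continuous_circle_measurable.
- exact: indic_norm_le1.
- move=> n xi; rewrite ger0_norm /f_.
    by rewrite gerBl expR_ge0.
  by rewrite subr_ge0 -expR0 ler_expR oppr_le0 mulr_ge0.
- move=> xi; have [h|h] := pselect (A xi).
    rewrite indicE mem_set//= -[X in _ --> X](subr0 (1 : R)) /f_.
    apply: cvgB; first exact: cvg_cst.
    have E (n : nat) : expR (- (n%:R * d xi)) = expR (- d xi) ^+ n.
      by rewrite -mulrN expRM_natl.
    under eq_fun do rewrite E.
    by apply: cvg_expr; rewrite ger0_norm ?expR_ge0// expR_lt1 oppr_lt0 dA.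
  rewrite indicE memNset//= /f_ dN//.
  under eq_fun do rewrite mulr0 oppr0 expR0 subrr.
  exact: cvg_cst.
- by move=> n; exact: approximable_continuous.
Qed.

(** A Dynkin class argument: open sets are stable under intersection and generate the Borel sets,
    and approximability passes to proper differences and increasing unions. *)
Lemma approximable_indic (A : set (circle R)) : measurable A ->
  continuously_approximable (\1_A : circle R -> R).
Proof.
pose D := [set A : set (circle R) | measurable A /\ continuously_approximable (\1_A : circle R -> R)].
suff h : <<s setT, @open (circle R) >> `<=` D by move=> /h[].
apply: lambda_system_subset.
- by move=> U V oU oV; exact: openI.
- split => //.
  + split; first exact: measurableT.
    by apply: approximable_open; exact: openT.
  + move=> U V VU [mA hA] [mB hB]; split; first exact: measurableD.
    have -> : \1_(U `\` V) = (fun xi => \1_U xi + (-1) * \1_V xi) :> (circle R -> R).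
      apply/funext => xi; rewrite !indicE in_setD mulN1r.
      have [xB|xB] := boolP (xi \in V); last by rewrite andbT subr0.
      by rewrite andbF (mem_set (VU _ (set_mem xB))) subrr.
    have mB1 : measurable_fun setT (fun xi => (-1) * \1_V xi : R).
      by apply: measurable_funM => //; exact: measurable_indic.
    have mA1 : measurable_fun setT (\1_U : circle R -> R) by exact: measurable_indic.
    have nB xi : `|(-1) * \1_V xi : R| <= 1 by rewrite mulN1r normrN indic_norm_le1.
    apply: (approximableD mA1 mB1 (indic_norm_le1 U) nB hA).
    apply: (approximableZ _ _ (indic_norm_le1 V) hB).
    exact: measurable_indic.
  + move=> F ndF hF.
    have mF n : measurable (F n) by have [] := hF n.
    have mU : measurable (\bigcup_n F n) by exact: bigcup_measurable.
    split => //; apply: (@approximable_pointwise_lim _ (fun n => \1_(F n)) 1).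
    * exact: measurable_indic.
    * by move=> n; exact: measurable_indic.
    * exact: indic_norm_le1.
    * by move=> n xi; exact: indic_norm_le1.
    * move=> xi; have [[k _ Fk]|h] := pselect ((\bigcup_n F n) xi).
        rewrite indicE mem_set; last by exists k.
        apply: cvg_near_cst; near=> n.
        rewrite indicE mem_set//.
        have kn : (k <= n)%N by near: n; exact: nbhs_infty_ge.
        by have /subsetPset := ndF _ _ kn; exact.
      rewrite indicE memNset//; apply: cvg_near_cst; apply: nearW => n.
      by rewrite indicE memNset// => Fn; apply: h; exists n.
    * by move=> n; have [] := hF n.
- move=> U oU; split; last exact: approximable_open.
  exact: sub_sigma_algebra.
- by move=> X _ xi _.
Unshelve. all: by end_near. Qed.

Lemma approximable_bounded f (c : R) : measurable_fun setT f ->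
  (forall xi, 0 <= f xi <= c) -> continuously_approximable f.
Proof.
move=> mf fc.
(* Binary digits: subtracting [c / 2] where [f] is at least [c / 2] leaves a function with values in
   [[0, c / 2]], so each step halves the error at the cost of one indicator. Quantifying over [c]
   makes the induction go through. *)
have key n : forall (c : R) (f : circle R -> R), measurable_fun setT f ->
    (forall xi, 0 <= f xi <= c) -> exists g, [/\ measurable_fun setT g,
      (forall xi, `|g xi| <= 2 * c), continuously_approximable g &
      forall xi, `|f xi - g xi| <= c * 2^-1 ^+ n].
  elim: n => [|n ih] {mf fc}c {}f mf fc.
    have c0 : 0 <= c by have /andP[] := fc (cis 0); exact: le_trans.
    exists (fun=> 0); split.
    - exact: measurable_cst.
    - by move=> xi; rewrite normr0 mulr_ge0.
    - by apply: approximable_continuous; exact: continuousRcst.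
    - by move=> xi; rewrite subr0 expr0 mulr1; have /andP[? ?] := fc xi; rewrite ger0_norm.
  have c0 : 0 <= c by have /andP[] := fc (cis 0); exact: le_trans.
  pose A := f @^-1` `[c / 2, +oo[.
  have mA : measurable A by rewrite -[A]setTI; exact: mf.
  have mA1 : measurable_fun setT (fun xi => c / 2 * \1_A xi).
    by apply: measurable_funM => //; exact: measurable_indic.
  have AE xi : \1_A xi = (c / 2 <= f xi)%R%:R :> R.
    rewrite indicE; congr ((nat_of_bool _)%:R); apply/idP/idP.
      by rewrite inE /A /= in_itv /= andbT.
    by move=> h; rewrite inE /A /= in_itv /= andbT.
  have nA xi : `|c / 2 * \1_A xi| <= c.
    rewrite AE normrM ger0_norm; last by rewrite divr_ge0.
    by case: (c / 2 <= f xi); rewrite ?normr1 ?normr0 ?mulr1 ?mulr0//; lra.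
  have [|xi|g [mg gM hg fg]] := ih (c / 2) (fun xi => f xi - c / 2 * \1_A xi).
  - exact: measurable_funB.
  - have /andP[f0 f1] := fc xi; rewrite AE; case: (leP (c / 2) (f xi)) => h; rewrite /= ?mulr1 ?mulr0; apply/andP; split; lra.
  exists (fun xi => g xi + c / 2 * \1_A xi); split.
  - exact: measurable_funD.
  - move=> xi; rewrite (le_trans (ler_normD _ _))//.
    by have := gM xi; have := nA xi; lra.
  - apply: (@approximableD _ _ c) => //.
      by move=> xi; rewrite (le_trans (gM xi))//; lra.
    apply: (approximableZ _ _ (indic_norm_le1 A)); first exact: measurable_indic.
    exact: approximable_indic.
  - move=> xi; have := fg xi; rewrite exprS mulrA.
    by rewrite opprD addrA addrAC.
have fM xi : `|f xi| <= c by have /andP[? ?] := fc xi; rewrite ger0_norm.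
apply: (approximable_lim mf fM) => e e0.
pose T := fine (mu1 setT) + fine (mu2 setT).
have T1 : 0 <= fine (mu1 setT) by exact: fine_ge0.
have T2 : 0 <= fine (mu2 setT) by exact: fine_ge0.
have h01 : 0 <= (2^-1 : R) < 1 by apply/andP; split; lra.
have [n hn] := exists_small_power (c * T) h01 e0.
have [g [mg gM hg fg]] := key n c f mf fc.
exists g; split => //; first by exists (2 * c).
  apply: le_lt_trans hn; rewrite (le_trans (@circle_Rintegral_le _ _ _ (fun=> c * 2^-1 ^+ n) _ _ _))//.
  - apply: circle_integrable_norm; apply: circle_integrableB; [exact: (bounded_integrable _ mf fM)|exact: (bounded_integrable _ mg gM)].
  - by apply: continuous_circle_integrable; exact: continuousRcst.
  - rewrite Rintegral_cst// (mulrC c) -mulrA ler_wpM2l ?exprn_ge0 ?invr_ge0//.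
    have c0 : 0 <= c by have /andP[] := fc (cis 0); exact: le_trans.
    by rewrite ler_wpM2l// lerDl.
apply: le_lt_trans hn; rewrite (le_trans (@circle_Rintegral_le _ _ _ (fun=> c * 2^-1 ^+ n) _ _ _))//.
- apply: circle_integrable_norm; apply: circle_integrableB; [exact: (bounded_integrable _ mf fM)|exact: (bounded_integrable _ mg gM)].
- by apply: continuous_circle_integrable; exact: continuousRcst.
- rewrite Rintegral_cst// (mulrC c) -mulrA ler_wpM2l ?exprn_ge0 ?invr_ge0//.
  have c0 : 0 <= c by have /andP[] := fc (cis 0); exact: le_trans.
  by rewrite ler_wpM2l// lerDr.
Qed.

End continuous_density.

Section szego_weight.
Variable R : realType.
Local Notation m := (arclength R).
Variables (sigma : {finite_measure set (circle R) -> \bar R}) (v : circle R -> R).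
Variable sigmas : {measure set (circle R) -> \bar R}.
Hypothesis dec : lebesgue_decomposition sigma v sigmas.

Lemma singular_part_le (A : set (circle R)) : measurable A -> (sigmas A <= sigma A)%E.
Proof.
move=> mA; have [_ v0 _ decA] := dec; rewrite (decA A mA) leeDr//.
by apply: integral_ge0 => xi _; rewrite lee_fin.
Qed.

Lemma total_mass_fin : sigma setT \is a fin_num.
Proof. by rewrite ge0_fin_numE//; exact: fin_num_fun_lty. Qed.

Definition clamp (L x : R) := Num.max (- L) (Num.min L x).

Lemma clamp_norm L x : 0 <= L -> `|clamp L x| <= L.
Proof.
by move=> L0; rewrite /clamp ler_norml le_max lexx /= ge_max ge_min lexx /=; lra.
Qed.

Lemma clamp_lip L x y : `|clamp L x - clamp L y| <= `|x - y|.
Proof.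
wlog xy : x y / x <= y.
  move=> h; have [|/ltW] := leP x y; first exact: h.
  by move=> /h; rewrite distrC (distrC y).
rewrite (distrC x) (distrC _ (clamp L y)) /clamp.
rewrite [leRHS]ger0_norm ?subr_ge0//.
rewrite ler_norml /Num.max /Num.min; apply/andP; clear dec.
split; case: (ltP L y) => ?; case: (ltP L x) => ?; case: (ltP (- L) L) => ?;
  case: (ltP (- L) x) => ?; case: (ltP (- L) y) => ?; lra.
Qed.

Lemma continuous_clamp L (f : circle R -> R) : continuous f ->
  continuous (fun xi => clamp L (f xi)).
Proof.
move=> cf xi A; rewrite -nbhs_ballE => -[r /= r0 rA].
have [d d0 hd] := continuous_circle cf xi r0.
apply/nbhs_circleP; exists d => // eta /hd h; apply: rA; rewrite /ball /=.
exact: le_lt_trans (clamp_lip _ _ _) h.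
Qed.

Lemma measurable_clamp L (f : circle R -> R) : measurable_fun setT f ->
  measurable_fun setT (fun xi => clamp L (f xi)).
Proof.
move=> mf; apply: (@measurable_maxr _ _ _ setT (fun=> - L) (fun xi => Num.min L (f xi))).
  exact: measurable_cst.
by apply: (@measurable_minr _ _ _ setT (fun=> L) f) => //; exact: measurable_cst.
Qed.

Lemma clamp_id L x : `|x| <= L -> clamp L x = x.
Proof.
by rewrite ler_norml => /andP[h1 h2]; rewrite /clamp min_r// max_r.
Qed.

Lemma clamp_norm_le L x : 0 <= L -> `|clamp L x| <= `|x|.
Proof.
move=> L0; have := clamp_lip L x 0; rewrite (@clamp_id _ 0) ?normr0//.
by rewrite !subr0.
Qed.

(** The truncated logarithm inverts [x] up to a factor at most 1 unless [ln x > L], where the weight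
    is [e^(-L)]. At [x = 0] the product vanishes whatever [ln 0] is. *)
Lemma clamp_log_ratio L (x : R) : 0 <= L -> 0 <= x ->
  expR (- clamp L (ln x)) * x <= 1 + expR (- L) * x.
Proof.
move=> L0; rewrite le_eqVlt => /predU1P[<-|x0]; first by rewrite !mulr0 addr0.
have [h|h] := leP (ln x) L; last first.
  rewrite /clamp min_l ?(ltW h)// max_r ?lerDr//; lra.
rewrite /clamp min_r// -[X in _ * X <= _](lnK x0) -expRD.
rewrite (@le_trans _ _ 1)//.
  by rewrite -[leRHS]expR0 ler_expR addrC subr_le0 le_max lexx orbT.
by rewrite lerDl mulr_ge0 ?expR_ge0// ltW.
Qed.

Lemma expR_lip (L a b : R) : `|a| <= L -> `|b| <= L ->
  expR a <= expR b + expR L * `|a - b|.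
Proof.
move=> aL bL; have h : expR a * (1 + (b - a)) <= expR b.
  rewrite -[in leRHS](subrK a b) [in leRHS]addrC expRD ler_wpM2l ?expR_ge0//.
  exact: expR_ge1Dx.
have h1 : expR a <= expR L.
  by rewrite ler_expR (le_trans (ler_norm _)).
have h2 : expR a * (a - b) <= expR L * `|a - b|.
  by rewrite (@le_trans _ _ (expR a * `|a - b|))// ?ler_wpM2l ?ler_wpM2r ?expR_ge0 ?ler_norm.
by move: h h2; rewrite !mulrDr !mulr1 !mulrN; lra.
Qed.

Lemma lt_halves (e a c d : R) : a < e / 2 -> d < e / 2 -> c <= 1 + d -> c + a < 1 + e.
Proof. by clear; lra. Qed.

(** A measurable first version of the weight, with [N] the set carrying the singular part. Each of
    the two parts of [sigma] contributes at most [e^(-L)] times the total mass, besides the 1 that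
    comes from [v * (1 / v)]. *)
Lemma szego_weight_measurable (L : R) (N : set (circle R)) :
  0 <= L -> measurable N -> sigmas (~` N) = 0%E ->
  let u0 := fun xi => if xi \in N then - L else - clamp L (ln (v xi)) in
  measurable_fun setT u0 /\
  \int[sigma]_xi expR (u0 xi) <= 1 + 2 * expR (- L) * fine (sigma setT).
Proof.
move=> L0 mN N0 u0; have [mv v0 _ decA] := dec.
have mu0 : measurable_fun setT u0.
  apply: measurable_fun_ifT.
  - apply: (measurable_fun_bool true); rewrite setTI (_ : _ @^-1` _ = N)//.
    by apply/seteqP; split => xi /=; [move/set_mem|move/mem_set].
  - exact: measurable_cst.
  - apply: measurableT_comp => //; apply: measurable_clamp.
    by apply: measurableT_comp => //; exact: measurable_ln.
split => //.
have meu : measurable_fun setT (fun xi => expR (u0 xi)) by exact: measurableT_comp.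
have meu' : measurable_fun setT (EFin \o (fun xi => expR (u0 xi))) by exact/measurable_EFinP.
have sfin := total_mass_fin.
have mass : (\int[m]_xi (v xi)%:E <= sigma setT)%E.
  by rewrite (decA _ measurableT) leeDl.
rewrite -lee_fin; apply: (@le_trans _ _ (\int[sigma]_xi (expR (u0 xi))%:E)%E).
  (* Finiteness of the extended integral is not known at this point; if it is infinite, the
     comparison is trivial. *)
  rewrite /Rintegral; have [h|] := boolP ((\int[sigma]_xi (expR (u0 xi))%:E)%E \is a fin_num).
    by rewrite fineK.
  rewrite ge0_fin_numE; last by apply: integral_ge0 => xi _; rewrite lee_fin expR_ge0.
  by rewrite -leNgt leye_eq => /eqP ->; rewrite leey.
rewrite (decomposition_integral dec meu'); last by move=> xi; rewrite lee_fin expR_ge0.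
apply: (@le_trans _ _ ((1 + (expR (- L))%:E * sigma setT) + (expR (- L))%:E * sigma setT)%E).
  apply: leeD.
    apply: (@le_trans _ _ (\int[m]_xi (1 + (expR (- L) * v xi)%:E)%E)%E).
      apply: ge0_le_integral => //.
      - by move=> xi _; rewrite mule_ge0// lee_fin ?expR_ge0.
      - by apply: emeasurable_funM => //; exact/measurable_EFinP.
      - apply: emeasurable_funD => //.
        by apply/measurable_EFinP; apply: measurable_funM => //.
      - move=> xi _; rewrite -EFinM -EFinD lee_fin /u0; case: ifP => _.
          by rewrite lerDr.
        exact: clamp_log_ratio.
    rewrite ge0_integralD//; last 2 first.
    - by move=> xi _; rewrite lee_fin mulr_ge0 ?expR_ge0.
    - by apply/measurable_EFinP; apply: measurable_funM.
    have -> : (\int[m]_(_ in setT) 1%E = 1%E)%E.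
      by rewrite integral_cst// mul1e; exact: probability_setT.
    rewrite leeD2l//.
    under eq_integral do rewrite EFinM.
    rewrite ge0_integralZl//; last 2 first.
    - exact/measurable_EFinP.
    - by move=> xi _; rewrite lee_fin.
    by rewrite lee_wpmul2l// lee_fin expR_ge0.
  apply: (@le_trans _ _ (\int[sigmas]_xi (expR (- L))%:E)%E).
    apply: ae_ge0_le_integral => //; first by move=> xi _; rewrite lee_fin expR_ge0.
    exists (~` N); split => //; first exact: measurableC.
    move=> xi /= h; apply: contra_not h => /= xN _ /=.
    by rewrite /u0 mem_set.
  rewrite integral_cst// lee_wpmul2l ?lee_fin ?expR_ge0//.
  exact: singular_part_le.
rewrite -(fineK sfin) -!EFinM -!EFinD lee_fin; lra.
Qed.

(* The weight [exp u] is a continuous substitute for [1 / v] which is tiny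
   where the singular part of [sigma] lives. *)
Lemma szego_weight (e : R) : circle_integrable m (fun xi => ln (v xi)) -> 0 < e ->
  exists u : circle R -> R, [/\ continuous u,
    \int[m]_xi `|u xi + ln (v xi)| < e &
    \int[sigma]_xi expR (u xi) < 1 + e].
Proof.
move=> iv e0; have [mv v0 [N [mN mN0 sN0]] _] := dec.
have e20 : 0 < e / 2 by rewrite divr_gt0.
have s0 : 0 <= fine (sigma setT) by exact: fine_ge0.
have mlv : measurable_fun setT (fun xi => ln (v xi)) by exact: circle_integrable_meas iv.
have ev1 : \forall n \near \oo, \int[m]_xi `|ln (v xi) - clamp n%:R (ln (v xi))| < e / 2.
  apply: (@bounded_dominated_cvg _ _ (fun xi => 2 * `|ln (v xi)|)) => //.
  - by apply: circle_integrableZ; exact: circle_integrable_norm.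
  - by move=> n; apply: measurable_funB => //; exact: measurable_clamp.
  - move=> n xi; rewrite (le_trans (ler_normB _ _))//.
    by have := @clamp_norm_le n%:R (ln (v xi)) (ler0n _ _); lra.
  - move=> xi; apply: cvg_near_cst; near=> n.
    rewrite clamp_id ?subrr//; near: n.
    exact: nbhs_infty_ger.
have ev2 : \forall n \near \oo, 2 * expR (- n%:R) * fine (sigma setT) < e / 2.
  have /cvgrPdist_lt : (expR (- n%:R) : R) @[n --> \oo] --> 0 by exact: cvgn_expR.
  have q0 : 0 < e / 2 / (2 * fine (sigma setT) + 1).
    by rewrite divr_gt0// ltr_wpDl// mulr_ge0.
  move=> /(_ _ q0); apply: filterS => n; rewrite sub0r normrN ger0_norm ?expR_ge0//.
  rewrite ltr_pdivlMr; last by rewrite ltr_wpDl// mulr_ge0.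
  apply: le_lt_trans; rewrite mulrDr mulr1 -mulrA mulrCA lerDl expR_ge0//.
have [n [h1 h2]] : exists n : nat,
    \int[m]_xi `|ln (v xi) - clamp n%:R (ln (v xi))| < e / 2 /\
    2 * expR (- n%:R) * fine (sigma setT) < e / 2.
  by near \oo => n; exists n; split; near: n.
pose L : R := n%:R; rewrite -/L in h1 h2.
have L0 : 0 <= L by exact: ler0n.
have [] := szego_weight_measurable L0 mN sN0.
set u0 := (fun xi => _) => mu0 h3.
have u0L xi : `|u0 xi| <= L.
  by rewrite /u0; case: ifP => _; rewrite normrN; [rewrite ger0_norm|exact: clamp_norm].
have iu0 (mu : {finite_measure set (circle R) -> \bar R}) : circle_integrable mu u0.
  apply: (@circle_integrable_le _ _ _ (fun=> L)) => //.
  by apply: continuous_circle_integrable; exact: continuousRcst.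
(* The shift by [L] moves the values into [[0, 2 L]], as [approximable_bounded] requires. *)
have happ : continuously_approximable m sigma (fun xi => u0 xi + L).
  apply: (@approximable_bounded _ _ _ _ (2 * L)).
    by apply: measurable_funD => //; exact: measurable_cst.
  move=> xi; have := u0L xi; rewrite ler_norml => /andP[h4 h5].
  by rewrite -lerBlDr sub0r h4 mulr_natl mulr2n lerD2r.
(* The first bound is what truncation leaves of [e / 2] in [L^1(m)]; the second pays for the
   Lipschitz constant [e^L] of the exponential on [[-L, L]] in [L^1(sigma)]. *)
pose t := Num.min (e / 2 - \int[m]_xi `|ln (v xi) - clamp L (ln (v xi))|)
   ((e / 2) / expR L).
have t0 : 0 < t by rewrite lt_min subr_gt0 h1 divr_gt0// expR_gt0.
have [phi0 cphi0 [p1 p2]] := happ t t0.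
(* Clamping brings the approximant back into [[-L, L]], where that Lipschitz bound applies, and does
   not increase its distance to [u0]. *)
pose phi xi := clamp L (phi0 xi - L).
have cphi : continuous phi.
  by apply: continuous_clamp; apply: continuousRD => //; exact: continuousRcst.
have phiL xi : `|phi xi| <= L by exact: clamp_norm.
have dist (mu : {finite_measure set (circle R) -> \bar R}) :
    \int[mu]_xi `|u0 xi - phi xi| <= \int[mu]_xi `|u0 xi + L - phi0 xi|.
  apply: circle_Rintegral_le.
  - apply/circle_integrable_norm/circle_integrableB => //.
    exact: continuous_circle_integrable.
  - apply/circle_integrable_norm/circle_integrableB.
      apply: circle_integrableD => //.
      by apply: continuous_circle_integrable; exact: continuousRcst.
    exact: continuous_circle_integrable.
  - move=> xi; rewrite -[X in `|X - _|](clamp_id (u0L xi)).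
    rewrite (le_trans (clamp_lip _ _ _))//.
    by rewrite opprB addrA.
have i1 (mu : {finite_measure set (circle R) -> \bar R}) :
    circle_integrable mu (fun xi => `|u0 xi - phi xi|).
  apply/circle_integrable_norm/circle_integrableB => //.
  exact: continuous_circle_integrable.
have i2 : circle_integrable m (fun xi => `|ln (v xi) - clamp L (ln (v xi))|).
  apply/circle_integrable_norm/circle_integrableB => //.
  apply: (@circle_integrable_le _ _ _ (fun xi => `|ln (v xi)|)).
  - exact: measurable_clamp.
  - by move=> xi; exact: clamp_norm_le.
  - exact: circle_integrable_norm.
exists phi; split => //.
  apply: (@le_lt_trans _ _ (\int[m]_xi (`|u0 xi - phi xi| + `|ln (v xi) - clamp L (ln (v xi))|))).
    apply: ae_Rintegral_le.
    - apply/circle_integrable_norm/circle_integrableD => //.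
      exact: continuous_circle_integrable.
    - exact: circle_integrableD.
    - exists N; split => // xi /= h; apply: contrapT => xN; apply: h.
      rewrite /u0 memNset//.
      have -> : phi xi + ln (v xi) = - (- clamp L (ln (v xi)) - phi xi) + (ln (v xi) - clamp L (ln (v xi))) by ring.
      by rewrite (le_trans (ler_normD _ _))// normrN.
  rewrite circle_RintegralD//.
  have := le_lt_trans (dist m) p1; rewrite /t lt_min => /andP[+ _].
  rewrite ltrBrDr => /lt_trans; apply.
  by rewrite ltr_pdivrMr// ltr_pMr// ltr1n.
have ieu0 : circle_integrable sigma (fun xi => expR (u0 xi)).
  apply: (@circle_integrable_le _ _ _ (fun=> expR L)).
  - exact: measurableT_comp.
  - move=> xi; rewrite ger0_norm ?expR_ge0// ler_expR.
    by rewrite (le_trans (ler_norm _)).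
  - by apply: continuous_circle_integrable; exact: continuousRcst.
apply: (@le_lt_trans _ _ (\int[sigma]_xi (expR (u0 xi) + expR L * `|u0 xi - phi xi|))).
  apply: circle_Rintegral_le.
  - by apply: continuous_circle_integrable; exact: continuousR_expR.
  - by apply: circle_integrableD => //; exact: circle_integrableZ.
  - by move=> xi; rewrite distrC; exact: expR_lip.
rewrite circle_RintegralD//; last exact: circle_integrableZ.
rewrite circle_RintegralZ//.
have := le_lt_trans (dist sigma) p2; rewrite /t lt_min => /andP[_].
rewrite ltr_pdivlMr ?expR_gt0// mulrC => h4.
exact: (lt_halves h4 h2 h3).
Unshelve. all: by end_near. Qed.

End szego_weight.

(** * Backward shifts of Blaschke products *)

Section backward_shift.
Variable R : realType.
Implicit Types (z : R[i]) (n : nat).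

Variables (n : nat) (b : 'I_n -> R[i]).
Hypothesis b1 : forall i, cmod (b i) < 1.

Local Notation W := (monic_of_zeros b).
Local Notation W' := (recip n W).

Lemma size_monic_of_zeros : size W = n.+1.
Proof. by rewrite size_prod_XsubC /index_enum -enumT size_enum_ord. Qed.

Lemma lead_coef_monic_of_zeros : lead_coef W = 1.
Proof. by apply/monicP; exact: monic_prod_XsubC. Qed.

Lemma recip_neq0 z : cmod z <= 1 -> W'.[z] != 0.
Proof.
move=> z1; rewrite recip_monic_of_zeros; apply/prodf_neq0 => i _.
rewrite subr_eq0 eq_sym; apply/eqP => h.
have : cmod ((b i)^*%C * z) < 1.
  rewrite cmodM cmod_conj (le_lt_trans _ (b1 i))// ler_piMr ?cmod_ge0//.
by rewrite h cmod1 ltxx.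
Qed.

Lemma recip0 : W'.[0] = 1.
Proof. by rewrite recip_monic_of_zeros big1// => i _; rewrite mulr0 subr0. Qed.

Lemma disk_algebra_recipV (p : {poly R[i]}) : disk_algebra (fun z => p.[z] / W'.[z]).
Proof.
apply: disk_algebraM; first exact: disk_algebra_horner.
have -> : (fun z => W'.[z]^-1) = (fun z => \prod_(i < n) (1 - (b i)^*%C * z)^-1).
  by apply/funext => z; rewrite recip_monic_of_zeros prodfV.
by apply: disk_algebra_prod => i; apply: disk_algebra_geometric; rewrite cmod_conj.
Qed.

Lemma recip_circle (p : {poly R[i]}) (xi : circle R) : (size p <= n.+1)%N ->
  (recip n p).[circle_val xi] = circle_val xi ^+ n * (p.[circle_val xi])^*%C.
Proof.
move=> sp; rewrite recipE// ?circle_neq0//; congr (_ * (p.[_])^*%C).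
by rewrite div1r -(ReV_mod1 (cmod_circle xi)) invrK.
Qed.

Lemma cmod_recip_circle (p : {poly R[i]}) (xi : circle R) : (size p <= n.+1)%N ->
  cmod (recip n p).[circle_val xi] = cmod p.[circle_val xi].
Proof.
by move=> sp; rewrite recip_circle// cmodM cmodX cmod_circle expr1n mul1r cmod_conj.
Qed.

Lemma recip_lin (c : R[i]) (p q : {poly R[i]}) :
  recip n (p - c *: q) = recip n p - c^*%C *: recip n q.
Proof.
apply/polyP => k; rewrite coefB coefZ !coef_poly coefB coefZ.
by case: ifP => _; rewrite ?mulr0 ?subr0// rmorphB rmorphM.
Qed.

Lemma recip_horner0 (p : {poly R[i]}) : (recip n p).[0] = (p`_n)^*%C.
Proof. by rewrite horner_coef0 coef_poly /= subn0. Qed.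

Lemma W_circle_neq0 (xi : circle R) : W.[circle_val xi] != 0.
Proof.
rewrite -cmod_gt0 -cmod_recip_circle ?size_monic_of_zeros// cmod_gt0.
by rewrite recip_neq0// cmod_circle.
Qed.

(* [shifted k / W'] is the k-th backward shift of [W / W']. *)
Fixpoint shifted k : {poly R[i]} :=
  if k is k'.+1 then drop_poly 1 (shifted k' - (shifted k').[0] *: W') else W.

Lemma shiftedS k : 'X * shifted k.+1 = shifted k - (shifted k).[0] *: W'.
Proof.
set p := _ - _; rewrite /= -/p.
have p0 : p.[0] = 0 by rewrite /p hornerD hornerN hornerZ recip0 mulr1 subrr.
rewrite -[RHS](poly_take_drop 1) expr1 mulrC.
suff -> : take_poly 1 p = 0 by rewrite add0r.
apply/polyP => i; rewrite coef_take_poly coef0; case: i => [|i]//.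
by rewrite ltnS leqn0 /= -horner_coef0 p0.
Qed.

Lemma size_recip (p : {poly R[i]}) : (size (recip n p) <= n.+1)%N.
Proof. exact: size_poly. Qed.

Lemma size_shifted k : (size (shifted k) <= n.+1)%N.
Proof.
elim: k => [|k ih]; first by rewrite /= size_monic_of_zeros.
rewrite /= size_drop_poly; apply: leq_trans (leq_subr _ _) _.
apply: leq_trans (size_polyD _ _) _; rewrite geq_max ih size_polyN.
exact: leq_trans (size_scale_leq _ _) (size_recip _).
Qed.

(** A genuine shift has degree below [n]; hence in a combination of the [shifted k] only [k = 0]
    contributes to the coefficient of index [n]. *)
Lemma size_shiftedS k : (size (shifted k.+1) <= n)%N.
Proof.
rewrite /= size_drop_poly leq_subLR add1n.
apply: leq_trans (size_polyD _ _) _; rewrite geq_max size_shifted size_polyN.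
exact: leq_trans (size_scale_leq _ _) (size_recip _).
Qed.

(** As in Schwarz's lemma: the next quotient is [(f(w) - f(0)) / w], at most [2 / rho] times the
    previous bound on [|w| = rho], and the maximum principle extends this inside. *)
Lemma shifted_bound (rho M : R) k : 0 < rho <= 1 ->
  (forall z, cmod z <= rho -> cmod (W.[z] / W'.[z]) <= M) ->
  forall z, cmod z <= rho -> cmod ((shifted k).[z] / W'.[z]) <= (2 / rho) ^+ k * M.
Proof.
move=> /andP[r0 r1] hM; elim: k => [|k ih] z zr; first by rewrite expr0 mul1r hM.
pose f w := (shifted k.+1).[w] / W'.[w].
have hf : disk_algebra (fun w => f (rho%:C * w)).
  move=> e e0; have [p hp] := disk_algebra_recipV (shifted k.+1) e0.
  exists (p \Po (rho%:C *: 'X)) => w w1; rewrite horner_comp hornerZ hornerX.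
  by apply: hp; rewrite cmodM cmod_real gtr0_norm//; apply: mulr_ile1; rewrite ?cmod_ge0// ltW.
have rC : rho%:C != 0 :> R[i] by rewrite -cmod_gt0 cmod_real normr_gt0 gt_eqF.
have zE : z = rho%:C * (z / rho%:C) by rewrite mulrC divfK.
have z1 : cmod (z / rho%:C) <= 1.
  by rewrite cmodM cmodV cmod_real gtr0_norm// ler_pdivrMr// mul1r.
rewrite -/(f z) zE; apply: (disk_algebra_max hf z1) => xi.
set w := rho%:C * _.
have wr : cmod w = rho by rewrite /w cmodM cmod_real gtr0_norm// cmod_circle mulr1.
have w0 : w != 0 by rewrite -cmod_gt0 wr.
have Ww : W'.[w] != 0 by apply: recip_neq0; rewrite wr.
have -> : f w = ((shifted k).[w] / W'.[w] - (shifted k).[0] / W'.[0]) / w.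
  rewrite /f recip0 divr1; apply: (mulIf w0); rewrite divfK//.
  have := congr1 (fun p : {poly R[i]} => p.[w]) (shiftedS k).
  rewrite hornerM hornerX hornerD hornerN hornerZ => h.
  by rewrite mulrAC (mulrC _ w) h mulrBl mulfK.
rewrite cmodM cmodV wr ler_pdivrMr//.
rewrite (le_trans (cmodB _ _))//.
have h1 := ih w; rewrite wr in h1.
have h2 := ih 0; rewrite cmod0 in h2.
rewrite (le_trans (lerD (h1 (lexx _)) (h2 (ltW r0))))//.
have -> : (2 / rho) ^+ k.+1 * M * rho = 2 * ((2 / rho) ^+ k * M).
  by rewrite exprS; field; rewrite gt_eqF.
by rewrite [leRHS]mulr_natl mulr2n.
Qed.

(** Dividing the recursion by [W] multiplies the previous quotient by [conj xi] and adds an error of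
    modulus [|(shifted k)(0)|], because [|W' / W| = 1] on the circle; the errors add up over the [k]
    steps. *)
Lemma shifted_circle (d : R) k (xi : circle R) :
  (forall j, (j < k)%N -> cmod (shifted j).[0] <= d) ->
  cmod ((shifted k).[circle_val xi] / W.[circle_val xi] - (circle_val xi)^*%C ^+ k) <= k%:R * d.
Proof.
elim: k => [_|k ih hd].
  by rewrite expr0 /= divff ?W_circle_neq0// subrr cmod0 mul0r.
have W0 := W_circle_neq0 xi; have x0 := circle_neq0 xi.
have h := congr1 (fun p : {poly R[i]} => p.[circle_val xi]) (shiftedS k).
rewrite hornerM hornerX hornerD hornerN hornerZ in h.
have -> : (shifted k.+1).[circle_val xi] / W.[circle_val xi] - (circle_val xi)^*%C ^+ k.+1 =
   (circle_val xi)^*%C * (((shifted k).[circle_val xi] / W.[circle_val xi] - (circle_val xi)^*%C ^+ k)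
    - (shifted k).[0] * (W'.[circle_val xi] / W.[circle_val xi])).
  rewrite exprS; apply: (mulfI x0); rewrite mulrBr mulrA h.
  rewrite [in RHS]mulrA -(ReV_mod1 (cmod_circle xi)) mulfV// mul1r.
  rewrite [_ * (_^-1 * _)]mulrA mulfV// mul1r; field.
  by [].
rewrite cmodM cmod_conj cmod_circle mul1r (le_trans (cmodB _ _))//.
rewrite -natr1 mulrDl mul1r lerD//; first by apply: ih => j jk; apply: hd; exact: ltnW.
rewrite cmodM cmodM cmodV cmod_recip_circle ?size_monic_of_zeros//.
by rewrite divff ?mulr1 ?hd// cmod_eq0.
Qed.

(** For one factor, [1 - |(z - a) / (1 - conj a z)|^2 = (1 - |z|^2)(1 - |a|^2) / |1 - conj a z|^2],
    where the denominator is at most 4; then [1 - x <= e^(-x)] turns the product into the sum of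
    condition (D). *)
Lemma blaschke_bound z (rho : R) : cmod z <= rho -> rho < 1 ->
  cmod (W.[z] / W'.[z]) ^+ 2 <=
    expR (- ((1 - rho ^+ 2) / 4 * \sum_(i < n) (1 - cmod (b i)))).
Proof.
move=> zr r1; have r0 : 0 <= rho by rewrite (le_trans (cmod_ge0 z)).
rewrite recip_monic_of_zeros /monic_of_zeros horner_prod -prodf_div.
rewrite cmod_prod -prodrXl mulr_sumr -sumrN expR_sum.
apply: ler_prod => i _; rewrite sqr_ge0 /=.
rewrite hornerXsubC.
set a := b i; have a1 : cmod a < 1 := b1 i.
have z1 : cmod z < 1 by rewrite (le_lt_trans zr).
have d0 : 1 - a^*%C * z != 0.
  rewrite subr_eq0 eq_sym; apply/eqP => h.
  have : cmod (a^*%C * z) < 1.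
    by rewrite cmodM cmod_conj (le_lt_trans _ a1)// ler_piMr ?cmod_ge0// ltW.
  by rewrite h cmod1 ltxx.
have D0 : 0 < cmod (1 - a^*%C * z) ^+ 2 by rewrite exprn_gt0// cmod_gt0.
have D4 : cmod (1 - a^*%C * z) ^+ 2 <= 4.
  rewrite (_ : 4 = 2 ^+ 2); last by ring.
  rewrite lerXn2r ?nnegrE ?cmod_ge0// (le_trans (cmodB _ _))// cmod1.
  rewrite cmodM cmod_conj (_ : 2 = 1 + 1); last by ring.
  by rewrite lerD2l mulr_ile1 ?cmod_ge0// ltW.
have key : cmod (1 - a^*%C * z) ^+ 2 - cmod (z - a) ^+ 2 = (1 - cmod z ^+ 2) * (1 - cmod a ^+ 2).
  rewrite !cmod_sqr !cReB !cImB cReM cImM cRe_conj cIm_conj /=; ring.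
rewrite cmodM cmodV exprMn exprVn.
have -> : cmod (z - a) ^+ 2 / cmod (1 - a^*%C * z) ^+ 2 =
   1 - (1 - cmod z ^+ 2) * (1 - cmod a ^+ 2) / cmod (1 - a^*%C * z) ^+ 2.
  by rewrite -key mulrBl divff ?gt_eqF// opprB addrCA subrr addr0.
rewrite (le_trans _ (expR_ge1Dx _))// lerD2l lerN2.
have a0 := cmod_ge0 a; have z0 := cmod_ge0 z.
have h1 : 1 - cmod a <= 1 - cmod a ^+ 2.
  by rewrite lerD2l lerN2 expr2 ler_piMl// ltW.
have h2 : 1 - rho ^+ 2 <= 1 - cmod z ^+ 2.
  by rewrite lerD2l lerN2 lerXn2r ?nnegrE.
have h3 : 0 <= 1 - rho ^+ 2 by rewrite subr_ge0 expr_le1// ltW.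
rewrite mulrAC.
rewrite (@le_trans _ _ ((1 - cmod z ^+ 2) * (1 - cmod a ^+ 2) / 4))//.
  rewrite ler_wpM2r ?invr_ge0//; apply: ler_pM => //.
  by rewrite subr_ge0 ltW.
have h4 : 0 <= (1 - cmod z ^+ 2) * (1 - cmod a ^+ 2).
  apply: mulr_ge0; first exact: le_trans h3 h2.
  by apply: le_trans h1; rewrite subr_ge0 ltW.
by rewrite ler_wpM2l// lef_pV2 ?posrE.
Qed.

End backward_shift.

Lemma Re_cintegral d (T : measurableType d) (R : realType)
    (mu : {measure set T -> \bar R}) (F : T -> R[i]) :
  complex.Re (cintegral mu F) = \int[mu]_x complex.Re (F x).
Proof. by []. Qed.

Lemma conjc_divr (R : realType) (x : R[i]) (a : R) : (x / a%:C)^*%C = x^*%C / a%:C.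
Proof. by rewrite rmorphM fmorphV; congr (_ * _^-1); exact: conjc_real. Qed.

(** * Estimates at a fixed degree *)

Section fixed_degree.
Variable R : realType.
Local Notation m := (arclength R).
Variables (sigma : {finite_measure set (circle R) -> \bar R}) (v : circle R -> R).
Variable sigmas : {measure set (circle R) -> \bar R}.
Hypothesis dec : lebesgue_decomposition sigma v sigmas.
Hypothesis iv : circle_integrable m (fun xi => ln (v xi)).
Hypothesis v_gt0 : {ae m, forall xi, 0 < v xi}.
Variables (n : nat) (b : 'I_n -> R[i]).
Hypothesis b1 : forall i, cmod (b i) < 1.
Variable g : circle R -> R.
Hypothesis cg : continuous g.

Local Notation W := (monic_of_zeros b).
Local Notation W' := (recip n W).
Local Notation D := (szego g v).

Definition orthogonality_weight (xi : circle R) : R := expR (g xi) / cmod W.[circle_val xi] ^+ 2.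
Local Notation wt := orthogonality_weight.

Definition weighted_norm (p : {poly R[i]}) : R :=
  \int[sigma]_xi (cmod p.[circle_val xi] ^+ 2 * wt xi).

Lemma W_circle_gt0 (xi : circle R) : 0 < cmod W.[circle_val xi] ^+ 2.
Proof. by rewrite exprn_gt0// cmod_gt0 W_circle_neq0. Qed.

Lemma continuous_orthogonality_weight : continuous wt.
Proof.
apply: continuousRM; first exact: continuousR_expR.
apply: continuousRV; first by apply: continuous_cmod_sqr; exact: continuousC_horner.
by move=> xi; rewrite gt_eqF// W_circle_gt0.
Qed.

Lemma orthogonality_weight_ge0 (xi : circle R) : 0 <= wt xi.
Proof. by rewrite divr_ge0 ?expR_ge0// ltW// W_circle_gt0. Qed.

Lemma weighted_norm_integrable (p : {poly R[i]}) :
  circle_integrable sigma (fun xi => cmod p.[circle_val xi] ^+ 2 * wt xi).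
Proof.
apply: continuous_circle_integrable; apply: continuousRM; last exact: continuous_orthogonality_weight.
by apply: continuous_cmod_sqr; exact: continuousC_horner.
Qed.

Lemma weighted_norm_ge0 (p : {poly R[i]}) : 0 <= weighted_norm p.
Proof. by apply: Rintegral_ge0 => xi _; rewrite mulr_ge0 ?sqr_ge0// orthogonality_weight_ge0. Qed.

Lemma weighted_norm_recip (p : {poly R[i]}) : (size p <= n.+1)%N ->
  weighted_norm (recip n p) = weighted_norm p.
Proof.
by move=> sp; congr Rintegral; apply/funext => xi; rewrite cmod_recip_circle.
Qed.

Lemma szegoE z : D z = cexp (2^-1 * herglotz z (fun xi => g xi + ln (v xi))).
Proof. by []. Qed.

Lemma integrable_log_density : circle_integrable m (fun xi => g xi + ln (v xi)).
Proof. by apply: circle_integrableD => //; exact: continuous_circle_integrable. Qed.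

Lemma cmod_szego_sqr z :
  cmod (D z) ^+ 2 = expR (poisson_mean z (fun xi => g xi + ln (v xi))).
Proof.
rewrite szegoE cmod_cexp -expRM_natl -Re_herglotz; congr expR.
rewrite (_ : (2^-1 : R[i]) = (2^-1 : R)%:C); last by rewrite fmorphV rmorph_nat.
by rewrite cReM [complex.Im _%:C]/= mul0r subr0 /= mulrA mulfV ?mul1r.
Qed.

Lemma szego_neq0 z : D z != 0.
Proof. by rewrite szegoE cexp_neq0. Qed.

(** Jensen's inequality for [p / W'] and the log-weight [g + ln v]: the left side is what it bounds,
    by [cmod_szego_sqr]. On the right, the Poisson kernel is at most [herglotz_bound z],
    [|W'| = |W|] on the circle, and [v dm] is dominated by [sigma]. *)
Lemma szego_pointwise (p : {poly R[i]}) z : cmod z < 1 ->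
  cmod (p.[z] / W'.[z] * D z) ^+ 2 <= herglotz_bound z * weighted_norm p.
Proof.
move=> z1; have hf := disk_algebra_recipV b1 p.
pose w xi := expR (g xi) * v xi.
have [mv v0 _ _] := dec.
have ig : continuous (fun xi => expR (g xi)) by exact: continuousR_expR.
have iw : circle_integrable m w by exact: (density_integrable dec ig).
have w0 xi : 0 <= w xi by rewrite mulr_ge0 ?expR_ge0.
have aew : {ae m, forall xi, expR (g xi + ln (v xi)) = w xi}.
  by apply: filterS v_gt0 => xi vxi; rewrite expRD lnK.
have := disk_algebra_jensen hf z1 integrable_log_density iw w0 aew.
rewrite -cmod_szego_sqr -exprMn -cmodM => h; apply: le_trans h _.
have cF : continuous (fun xi : circle R => cmod (p.[circle_val xi] / W'.[circle_val xi]) ^+ 2 * expR (g xi)).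
  by apply: continuousRM => //; apply: continuous_cmod_sqr; exact: (disk_algebra_continuous hf).
have FE xi : cmod (p.[circle_val xi] / W'.[circle_val xi]) ^+ 2 * expR (g xi) = cmod p.[circle_val xi] ^+ 2 * wt xi.
  rewrite cmodM cmodV cmod_recip_circle ?size_monic_of_zeros// exprMn exprVn /wt.
  by rewrite mulrAC mulrA.
have F0 xi : 0 <= cmod (p.[circle_val xi] / W'.[circle_val xi]) ^+ 2 * expR (g xi).
  by rewrite mulr_ge0 ?sqr_ge0 ?expR_ge0.
have hb0 : 0 <= herglotz_bound z.
  by apply: divr_ge0; [rewrite addr_ge0 ?cmod_ge0|rewrite subr_ge0 ltW].
have iF := density_integrable dec cF.
apply: (@le_trans _ _ (herglotz_bound z * \int[m]_xi
    (cmod (p.[circle_val xi] / W'.[circle_val xi]) ^+ 2 * expR (g xi) * v xi))).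
  rewrite -circle_RintegralZ//; apply: circle_Rintegral_le.
  - apply: circle_integrable_poisson => //.
    by apply: (eq_circle_integrable _ iF) => xi; rewrite mulrA.
  - exact: circle_integrableZ.
  - move=> xi; rewrite -[X in _ <= _ * X]mulrA ler_wpM2r ?poisson_le//.
    by rewrite mulr_ge0 ?sqr_ge0.
rewrite ler_wpM2l// (le_trans (density_integral_le dec cF F0))//.
rewrite le_eqVlt; apply/orP; left; apply/eqP.
by congr Rintegral; apply/funext => xi; rewrite FE.
Qed.

Lemma cintegral_sum (F : nat -> circle R -> R[i]) k :
  (forall i, circle_cintegrable sigma (F i)) ->
  circle_cintegrable sigma (fun xi => \sum_(i < k) F i xi) /\
  cintegral sigma (fun xi => \sum_(i < k) F i xi) = \sum_(i < k) cintegral sigma (F i).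
Proof.
move=> iF; elim: k => [|k [ih1 ih2]].
  have -> : (fun xi => \sum_(i < 0) F i xi) = (fun=> 0).
    by apply/funext => xi; rewrite big_ord0.
  split; first by apply: continuous_cintegrable; exact: continuousCcst.
  by rewrite big_ord0; apply/complex_eqP => /=; rewrite Rintegral_cst// mul0r.
have -> : (fun xi => \sum_(i < k.+1) F i xi) = (fun xi => \sum_(i < k) F i xi + F k xi).
  by apply/funext => xi; rewrite big_ord_recr.
split; first exact: cintegrableD.
by rewrite big_ord_recr /= -ih2 cintegralD.
Qed.

Variable phi : {poly R[i]}.
Hypothesis ortho : is_orthonormal_poly sigma g W n phi.
Local Notation alpha := (complex.Re (lead_coef phi)).

Lemma weightE (xi : circle R) : (expR (g xi))%:C / `|W.[circle_val xi]| ^+ 2 = (wt xi)%:C.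
Proof. by rewrite cmodE /wt rmorphM fmorphV rmorphXn. Qed.

Lemma lead_coef_real : lead_coef phi = alpha%:C /\ 0 < alpha.
Proof.
have [_ h _ _] := ortho; split; last by move: h; rewrite ltcE => /andP[].
by rewrite RRe_real// gtr0_real.
Qed.

Lemma size_ortho : size phi = n.+1. Proof. by case: ortho. Qed.

Lemma weighted_norm_phi : weighted_norm phi = 1.
Proof.
have [_ _ _ h] := ortho.
have : complex.Re (cintegral sigma (fun xi : circle R => `|phi.[circle_val xi]| ^+ 2 *
  ((expR (g xi))%:C / `|W.[circle_val xi]| ^+ 2))) = 1 by rewrite h.
rewrite Re_cintegral => <-; congr Rintegral; apply/funext => xi.
by rewrite weightE cmodE -rmorphXn -rmorphM.
Qed.

Lemma phi_orthogonal (r : {poly R[i]}) : (size r <= n)%N ->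
  cintegral sigma (fun xi => phi.[circle_val xi] * (r.[circle_val xi])^*%C * (wt xi)%:C) = 0.
Proof.
move=> sr; have [_ _ orth _] := ortho.
pose F k (xi : circle R) := (r`_k)^*%C * (phi.[circle_val xi] * (circle_val xi ^+ k)^*%C * (wt xi)%:C).
have iG k : circle_cintegrable sigma (fun xi : circle R => phi.[circle_val xi] * (circle_val xi ^+ k)^*%C * (wt xi)%:C).
  apply: continuous_cintegrable; apply: continuousCM.
    apply: continuousCM; first exact: continuousC_horner.
    apply: continuousC_conj.
    have -> : (fun xi : circle R => circle_val xi ^+ k) = (fun xi => ('X^k).[circle_val xi]).
      by apply/funext => xi; rewrite hornerXn.
    exact: continuousC_horner.
  by apply: continuousC_real; exact: continuous_orthogonality_weight.
have iF k : circle_cintegrable sigma (F k) by exact: cintegrableZ.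
have [_ h] := cintegral_sum n iF.
have -> : (fun xi => phi.[circle_val xi] * (r.[circle_val xi])^*%C * (wt xi)%:C) = (fun xi => \sum_(i < n) F i xi).
  apply/funext => xi; rewrite (horner_coef_wide _ sr) rmorph_sum mulr_sumr mulr_suml.
  apply: eq_bigr => i _; rewrite /F rmorphM /=; ring.
rewrite h big1// => i _; rewrite /F cintegralZ//.
have := orth i (ltn_ord i).
have -> : (fun xi : circle R => phi.[circle_val xi] * (circle_val xi ^+ i)^* * ((expR (g xi))%:C / `|W.[circle_val xi]| ^+ 2)) =
   (fun xi : circle R => phi.[circle_val xi] * (circle_val xi ^+ i)^*%C * (wt xi)%:C).
  by apply/funext => xi; rewrite weightE.
by move=> ->; rewrite mulr0.
Qed.

Lemma weighted_norm_extremal (Q : {poly R[i]}) (c := Q`_n / lead_coef phi) :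
  (size Q <= n.+1)%N ->
  [/\ (size (Q - c *: phi)%R <= n)%N &
   weighted_norm Q = cmod c ^+ 2 + weighted_norm (Q - c *: phi)].
Proof.
move=> sQ; have [aE a0] := lead_coef_real.
have lphi : phi`_n = lead_coef phi by rewrite lead_coefE size_ortho.
have l0 : lead_coef phi != 0 by rewrite aE -cmod_gt0 cmod_real normr_gt0 gt_eqF.
have sr : (size (Q - c *: phi)%R <= n)%N.
  apply/leq_sizeP => j; rewrite leq_eqVlt => /predU1P[<-|nj].
    by rewrite coefB coefZ lphi /c divfK// subrr.
  by rewrite coefB coefZ !nth_default ?mulr0 ?subr0// ?size_ortho// (leq_trans sQ).
split => //; set r := Q - c *: phi in sr *.
have h0 := phi_orthogonal sr.
(* The cross term of [|r + c phi|^2] is [Re(2 c phi conj r)], and it integrates to 0 by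
   orthogonality. *)
pose G (xi : circle R) := phi.[circle_val xi] * (r.[circle_val xi])^*%C * (wt xi)%:C.
have iG : circle_cintegrable sigma (fun xi => (2 * c) * G xi).
  apply: cintegrableZ; apply: continuous_cintegrable; apply: continuousCM.
    apply: continuousCM; first exact: continuousC_horner.
    by apply: continuousC_conj; exact: continuousC_horner.
  by apply: continuousC_real; exact: continuous_orthogonality_weight.
have hG : \int[sigma]_xi complex.Re ((2 * c) * G xi) = 0.
  rewrite -Re_cintegral cintegralZ; first by rewrite h0 mulr0.
  apply: continuous_cintegrable; apply: continuousCM.
    apply: continuousCM; first exact: continuousC_horner.
    by apply: continuousC_conj; exact: continuousC_horner.
  by apply: continuousC_real; exact: continuous_orthogonality_weight.
rewrite -[cmod c ^+ 2]mulr1 -weighted_norm_phi -circle_RintegralZ; last exact: weighted_norm_integrable.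
rewrite -circle_RintegralD; last 2 first.
- by apply: circle_integrableZ; exact: weighted_norm_integrable.
- exact: weighted_norm_integrable.
rewrite -[RHS]addr0 -hG -circle_RintegralD; last 2 first.
- apply: circle_integrableD; last exact: weighted_norm_integrable.
  by apply: circle_integrableZ; exact: weighted_norm_integrable.
- by case: iG.
congr Rintegral; apply/funext => xi.
have QE : Q.[circle_val xi] = r.[circle_val xi] + c * phi.[circle_val xi].
  by rewrite /r hornerD hornerN hornerZ subrK.
rewrite QE /G; set A := r.[_]; set B := phi.[_]; set t := wt xi.
have -> : 2 * c * (B * A^*%C * t%:C) = (2 * t)%:C * (c * B * A^*%C).
  have -> : (2 * t)%:C = (2 : R[i]) * t%:C by rewrite [LHS]rmorphM rmorph_nat.
  ring.
rewrite [complex.Re (_%:C * _)]cReM [complex.Im _%:C]/= [complex.Re _%:C]/= mul0r subr0.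
have -> : cmod c ^+ 2 * (cmod B ^+ 2 * t) = cmod (c * B) ^+ 2 * t.
  by rewrite (cmodM c B) exprMn mulrA.
move: (c * B) => d.
by rewrite !cmod_sqr cReD cImD cReM cRe_conj cIm_conj; ring.
Qed.

Lemma leading_coef_bound : alpha * cmod (D 0) <= 1.
Proof.
have [aE a0] := lead_coef_real.
have z0 : cmod (0 : R[i]) < 1 by rewrite cmod0.
have := szego_pointwise (recip n phi) z0.
rewrite weighted_norm_recip ?size_ortho// weighted_norm_phi mulr1.
rewrite /herglotz_bound cmod0 addr0 subr0 divr1 recip0 divr1 recip_horner0.
have -> : phi`_n = alpha%:C by rewrite -aE lead_coefE size_ortho.
rewrite conjc_real cmodM cmod_real gtr0_norm// => h.
by rewrite -(@ler_pXn2r _ 2)// ?nnegrE ?mulr_ge0 ?cmod_ge0 ?(ltW a0)// expr1n.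
Qed.

(** At 0 the Herglotz kernel is 1. Positivity of [D(0)] is what later controls the argument of the
    quotient [c], not only its modulus. *)
Lemma szego0_real : D 0 = (cmod (D 0))%:C.
Proof.
rewrite szegoE /herglotz.
have -> : cintegral m (fun xi => herglotz_kernel 0 xi * (g xi + ln (v xi))%:C) =
   (\int[m]_xi (g xi + ln (v xi)))%:C.
  have K0 (xi : circle R) : herglotz_kernel 0 xi = 1.
    by rewrite /herglotz_kernel addr0 subr0 divff// circle_neq0.
  apply/complex_eqP => /=.
    by congr Rintegral; apply/funext => xi; rewrite K0 mul1r.
  have -> : (fun xi : circle R => complex.Im (herglotz_kernel 0 xi * (g xi + ln (v xi))%:C)) = fun=> 0.
    by apply/funext => xi; rewrite K0 mul1r.
  by rewrite Rintegral_cst// mul0r.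
rewrite (_ : (2^-1 : R[i]) = (2^-1 : R)%:C); last by rewrite fmorphV rmorph_nat.
by rewrite -rmorphM cexp_real cmod_real ger0_norm ?expR_ge0.
Qed.

End fixed_degree.

(** The deterministic core, for one [n]. The data are accurate to order [e], the conclusions to
    order [s]: [szego_pointwise] bounds a square, so a weighted norm [7 e] yields the pointwise
    error [s] once [7 B e <= s^2] with [B = (1 + rho) / (1 - rho)]. *)
Lemma orthonormal_estimates (R : realType)
    (sigma : {finite_measure set (circle R) -> \bar R}) (v : circle R -> R)
    (sigmas : {measure set (circle R) -> \bar R}) (n : nat) (b : 'I_n -> R[i])
    (g : circle R -> R) (phi H h Q : {poly R[i]}) (rho s e d : R)
    (W := monic_of_zeros b) (W' := recip n W) (D := szego g v)
    (alpha := complex.Re (lead_coef phi)) :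
  lebesgue_decomposition sigma v sigmas ->
  circle_integrable (arclength R) (fun xi => ln (v xi)) ->
  {ae arclength R, forall xi, 0 < v xi} ->
  (forall i, cmod (b i) < 1) -> continuous g ->
  is_orthonormal_poly sigma g W n phi ->
  0 < rho < 1 -> 0 < s <= 80^-1 -> 0 < e <= s ->
  7 * ((1 + rho) / (1 - rho)) * e <= s ^+ 2 ->
  (forall z, cmod z <= rho -> cmod (cexp H.[z] * D z - 1) <= e) ->
  (forall z, cmod z <= 1 -> cmod (h.[z] * cexp (- H.[z]) - 1) <= e) ->
  (size Q <= n.+1)%N -> Q`_n = (h.[0])^*%C ->
  (forall xi : circle R, cmod (Q.[circle_val xi] / W.[circle_val xi] - (h.[circle_val xi])^*%C) <= d) ->
  (forall z, cmod z <= rho -> cmod (D z) * d <= e) ->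
  (forall z, cmod z <= rho -> cmod (D z) * cmod (Q.[z] / W'.[z]) <= e) ->
  weighted_norm sigma b g Q <= 1 + e ->
  forall z, cmod z <= rho ->
    cmod ((recip n phi).[z] / W'.[z] * D z - 1) <= 24 * s /\
    cmod (phi.[z] / (recip n phi).[z]) <= 8 * s.
Proof.
move=> dec iv v_gt0 b1 cg ortho /andP[rho0 rho1] /andP[s0 s1] /andP[e0 es] seB hHD hhH sQ Qn hQ hd hQW hN z zr.
have [aE a0] := lead_coef_real ortho.
have hD w : cmod w <= rho -> cmod (h.[w] * D w - 1) <= 3 * e.
  move=> wr; have w1 : cmod w <= 1 by rewrite (le_trans wr)// ltW.
  have := hHD w wr; have := hhH w w1.
  set x := h.[w] * _; set y := _ * D w.
  have -> : h.[w] * D w = x * y.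
    have E : cexp (- H.[w]) * cexp H.[w] = 1 by rewrite -cexpD addNr cexp0.
    by rewrite /x /y -mulrA (mulrA (cexp (- _))) E mul1r.
  have -> : x * y - 1 = (x - 1) * y + (y - 1) by ring.
  move=> h1 h2; rewrite (le_trans (cmodD _ _))// cmodM.
  have h3 : cmod y <= 1 + e.
    by rewrite -(subrK 1 y) addrC (le_trans (cmodD _ _))// cmod1 lerD2l.
  have h4 : cmod (x - 1) * cmod y <= e * (1 + e) by rewrite ler_pM ?cmod_ge0.
  have h5 : e * (1 + e) <= 2 * e by clear -e0 es s1; nra.
  by move: h2 h4 h5; clear; lra.
have [sr hc] := weighted_norm_extremal b1 cg ortho sQ.
set c := Q`_n / lead_coef phi in sr hc.
set r := Q - c *: phi in sr hc.
have Nr0 : 0 <= weighted_norm sigma b g r by exact: weighted_norm_ge0.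
have z00 : cmod (0 : R[i]) <= rho by rewrite cmod0 ltW.
have cE : c^*%C * alpha%:C = h.[0].
  have -> : c = (h.[0])^*%C / alpha%:C by rewrite /c Qn {1}aE.
  rewrite conjc_divr conjcK divfK//.
  by rewrite -cmod_gt0 cmod_real normr_gt0 gt_eqF.
have cD : c^*%C * (alpha * cmod (D 0))%:C = h.[0] * D 0.
  have -> : (alpha * cmod (D 0))%:C = alpha%:C * (cmod (D 0))%:C by rewrite -[RHS]rmorphM.
  by rewrite mulrA cE -[(cmod (D 0))%:C](szego0_real v g).
have aD1 : alpha * cmod (D 0) <= 1 := leading_coef_bound dec iv v_gt0 b1 cg ortho.
have aD0 : 0 <= alpha * cmod (D 0) by rewrite mulr_ge0 ?cmod_ge0// ltW.
have cc : cmod c * (alpha * cmod (D 0)) = cmod (h.[0] * D 0).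
  by rewrite -cD cmodM cmod_conj cmod_real ger0_norm.
have hD0 := hD 0 z00.
have hD0' : 1 - 3 * e <= cmod (h.[0] * D 0).
  have := cmod_lerB 1 (1 - h.[0] * D 0).
  rewrite cmod1 opprB addrCA subrr addr0 cmodBC => h1.
  by move: hD0 h1; clear; lra.
(* The product of [|c|] and [alpha |D(0)|], the latter at most 1, equals [|h(0) D(0)|]. *)
have c1 : 1 - 3 * e <= cmod c.
  by rewrite (le_trans hD0')// -cc ler_piMr ?cmod_ge0.
have ee : e <= 80^-1 by exact: le_trans es s1.
have c12 : 2^-1 <= cmod c by move: c1 ee; clear; lra.
have c2 : cmod c <= 1 + e.
  rewrite -(@ler_pXn2r _ 2)// ?nnegrE ?cmod_ge0//; last by move: e0; clear; lra.
  have : cmod c ^+ 2 <= 1 + e by move: hN Nr0; rewrite hc; clear; lra.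
  by move=> /le_trans; apply; move: e0; clear; nra.
(* [(1 + e) - (1 - 3 e)^2 = 7 e - 9 e^2]. *)
have Nr : weighted_norm sigma b g r <= 7 * e.
  have h1 : (1 - 3 * e) ^+ 2 <= cmod c ^+ 2.
    by rewrite lerXn2r ?nnegrE ?cmod_ge0//; move: ee; clear; lra.
  by move: hN h1 e0; rewrite hc; clear; nra.
have z1 : cmod z < 1 by exact: le_lt_trans rho1.
have hb : herglotz_bound z <= (1 + rho) / (1 - rho).
  rewrite /herglotz_bound ler_pM ?addr_ge0 ?invr_ge0 ?subr_ge0 ?cmod_ge0 ?lerD2l//; first exact: ltW.
  by rewrite lef_pV2 ?posrE ?subr_gt0// lerD2l lerN2.
have hb0 : 0 <= herglotz_bound z.
  by apply: divr_ge0; [rewrite addr_ge0 ?cmod_ge0|rewrite subr_ge0 ltW].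
have small p : weighted_norm sigma b g p <= 7 * e -> cmod (p.[z] / W'.[z] * D z) <= s.
  move=> hp; rewrite -(@ler_pXn2r _ 2)// ?nnegrE ?cmod_ge0// ?(ltW s0)//.
  rewrite (le_trans (szego_pointwise dec iv v_gt0 b1 cg p z1))// (le_trans _ seB)//.
  have wp : 0 <= weighted_norm sigma b g p by exact: weighted_norm_ge0.
  have -> : 7 * ((1 + rho) / (1 - rho)) * e = ((1 + rho) / (1 - rho)) * (7 * e) by ring.
  exact: ler_pM.
have hr := small r Nr.
have hrr : cmod ((recip n r).[z] / W'.[z] * D z) <= s.
  by apply: small; rewrite weighted_norm_recip// (leq_trans sr).
have zle1 : cmod z <= 1 by exact: ltW.
have W0 := recip_neq0 b1 zle1.
have D0 : D z != 0 by exact: szego_neq0.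
set F := (recip n phi).[z] / W'.[z] * D z.
(* On the circle [Q^* / W^*] is the conjugate of [Q / W], so the boundary estimate for [Q] becomes
   one for a function of the disk algebra, and the maximum principle applies. *)
have hQh : cmod ((recip n Q).[z] / W'.[z] - h.[z]) <= d.
  have hf : disk_algebra (fun w => (recip n Q - h * W').[w] / W'.[w]) by exact: disk_algebra_recipV.
  have -> : (recip n Q).[z] / W'.[z] - h.[z] = (recip n Q - h * W').[z] / W'.[z].
    by rewrite hornerD hornerN hornerM mulrBl mulfK.
  apply: (disk_algebra_max hf zle1) => xi.
  rewrite hornerD hornerN hornerM !recip_circle ?size_monic_of_zeros//.
  apply: le_trans (hQ xi).
  rewrite le_eqVlt; apply/orP; left; apply/eqP.
  rewrite -[RHS]cmod_conj rmorphB /= conjcK rmorphM fmorphV.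
  have Wc : (W.[circle_val xi])^*%C != 0.
    by rewrite -cmod_gt0 cmod_conj cmod_gt0 W_circle_neq0.
  have xn : circle_val xi ^+ n != 0 by rewrite expf_neq0// circle_neq0.
  congr cmod; field.
  by rewrite xn Wc.
(* Taking reciprocals in [Q = c phi + r] gives [conj c phi^* = Q^* - r^*]; the three errors are [e],
   [3 e] and [s]. *)
have cF : cmod (c^*%C * F - 1) <= 5 * s.
  have -> : c^*%C * F - 1 = (D z * ((recip n Q).[z] / W'.[z] - h.[z]) + (h.[z] * D z - 1))
      - (recip n r).[z] / W'.[z] * D z.
    rewrite /r recip_lin hornerD hornerN hornerZ /F; ring.
  rewrite (le_trans (cmodB _ _))//.
  have h1 := cmodD (D z * ((recip n Q).[z] / W'.[z] - h.[z])) (h.[z] * D z - 1).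
  have h2 : cmod (D z * ((recip n Q).[z] / W'.[z] - h.[z])) <= e.
    by rewrite cmodM (le_trans _ (hd z zr))// ler_wpM2l ?cmod_ge0.
  have h3 := hD z zr.
  by move: h1 h2 h3 hrr es; clear; lra.
(* Since [conj c] times the real number [alpha |D(0)|] in [[0, 1]] is [h(0) D(0)], the distance from
   [conj c] to [h(0) D(0)] is the difference of their moduli, at most [4 e]. *)
have c3 : cmod (c^*%C - 1) <= 7 * s.
  have -> : c^*%C - 1 = (h.[0] * D 0 - 1) + c^*%C * (1 - (alpha * cmod (D 0))%:C).
    by rewrite -cD; ring.
  rewrite (le_trans (cmodD _ _))//.
  have -> : cmod (c^*%C * (1 - (alpha * cmod (D 0))%:C)) = cmod c - cmod (h.[0] * D 0).
    rewrite cmodM cmod_conj -cc -(rmorph1 (real_complex R)) -rmorphB cmod_real.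
    by rewrite ger0_norm ?subr_ge0// mulrBr mulr1.
  by move: hD0 hD0' c2 es; clear; lra.
have c0 : c^*%C != 0.
  by rewrite -cmod_gt0 cmod_conj (lt_le_trans _ c12)// invr_gt0.
(* The errors [5 s] and [7 s] add up and are doubled by the division by [c], of modulus at least
   [1 / 2]. *)
have F1 : cmod (F - 1) <= 24 * s.
  have -> : F - 1 = ((c^*%C * F - 1) - (c^*%C - 1)) / c^*%C by field.
  rewrite cmodM cmodV cmod_conj ler_pdivrMr; last by rewrite (lt_le_trans _ c12)// invr_gt0.
  have h1 := cmodB (c^*%C * F - 1) (c^*%C - 1).
  have h2 : 24 * s * 2^-1 <= 24 * s * cmod c by rewrite ler_wpM2l// mulr_ge0// ltW.
  by rewrite (le_trans h1)//; move: cF c3 h2; clear; lra.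
split=> //.
have F12 : 2^-1 <= cmod F.
  have := cmod_lerB 1 (1 - F).
  rewrite cmod1 opprB addrCA subrr addr0 cmodBC => h1.
  by move: F1 h1 s1; clear; lra.
have hphi : cmod (c * (phi.[z] / W'.[z] * D z)) <= 2 * s.
  have -> : c * (phi.[z] / W'.[z] * D z) = Q.[z] / W'.[z] * D z - r.[z] / W'.[z] * D z.
    by rewrite /r hornerD hornerN hornerZ; ring.
  rewrite (le_trans (cmodB _ _))// cmodM mulrC.
  by have := hQW z zr; move: hr es; clear; lra.
have hphi' : cmod (phi.[z] / W'.[z] * D z) <= 4 * s.
  rewrite cmodM in hphi.
  have h1 : 2^-1 * cmod (phi.[z] / W'.[z] * D z) <= cmod c * cmod (phi.[z] / W'.[z] * D z).
    by rewrite ler_wpM2r ?cmod_ge0.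
  by move: h1 hphi; clear; lra.
have F0 : F != 0 by rewrite -cmod_gt0 (lt_le_trans _ F12)// invr_gt0.
have p0 : (recip n phi).[z] != 0.
  by apply: contraNneq F0; rewrite /F => ->; rewrite !mul0r.
have -> : phi.[z] / (recip n phi).[z] = (phi.[z] / W'.[z] * D z) / F.
  by rewrite /F; field; rewrite D0 W0 p0.
rewrite cmodM cmodV ler_pdivrMr; last by rewrite (lt_le_trans _ F12)// invr_gt0.
have h1 : 8 * s * 2^-1 <= 8 * s * cmod F by rewrite ler_wpM2l// mulr_ge0// ltW.
by rewrite (le_trans hphi')//; move: h1; clear; lra.
Qed.

(** * Asymptotics *)

Section asymptotics.
Variable R : realType.
Local Notation m := (arclength R).

Lemma fine_elog (v : circle R -> R) xi : 0 <= v xi -> fine (elog v xi) = ln (v xi).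
Proof.
rewrite le_eqVlt /elog => /predU1P[<-|v0]; first by rewrite le0_lneNy//= ln0.
by rewrite lne_EFin.
Qed.

Lemma integrable_ln (v : circle R -> R) : measurable_fun setT v -> (forall xi, 0 <= v xi) ->
  m.-integrable setT (elog v) -> circle_integrable m (fun xi => ln (v xi)).
Proof.
move=> mv v0; apply: le_integrable => //.
  apply/measurable_EFinP; apply: measurableT_comp => //; exact: measurable_ln.
move=> xi _ /=; rewrite -fine_elog//.
by case: (elog v xi) => [r||] //=; rewrite ?normr0 leey.
Qed.

Lemma ae_density_gt0 (v : circle R -> R) : m.-integrable setT (elog v) ->
  {ae m, forall xi, 0 < v xi}.
Proof.
move=> /(integrable_ae measurableT); apply: filterS => xi /(_ I).
apply: contraTT; rewrite -leNgt => h; by rewrite /elog le0_lneNy.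
Qed.

(** Passes from extended to real logarithms. Where a density vanishes, the integrand on the right is
    [+oo], so the comparison holds pointwise. *)
Lemma L1_ln_le (v w : circle R -> R) : (forall xi, 0 <= v xi) -> (forall xi, 0 <= w xi) ->
  circle_integrable m (fun xi => ln (v xi)) -> circle_integrable m (fun xi => ln (w xi)) ->
  m.-integrable setT (elog v) -> m.-integrable setT (elog w) ->
  ((\int[m]_xi `|ln (v xi) - ln (w xi)|)%:E <= 'N[m]_1[(fun xi => elog v xi - elog w xi)])%E.
Proof.
move=> v0 w0 iv iw ev ew; rewrite Lnorm1.
have ivw := circle_integrable_norm (circle_integrableB iv iw).
rewrite fineK; last exact: integrable_fin_num.
apply: ge0_le_integral => //.
- exact: measurable_int ivw.
- apply: measurableT_comp => //; apply: emeasurable_funB.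
    exact: measurable_int ev.
  exact: measurable_int ew.
- move=> xi _; rewrite -!fine_elog//.
  by case: (elog v xi) => [r||]; case: (elog w xi) => [r'||] //=; rewrite leey.
Qed.

Lemma limn_esup_near (u : nat -> \bar R) (L e : R) : (limn_esup u <= L%:E)%E -> 0 < e ->
  \forall n \near \oo, (u n <= (L + e)%:E)%E.
Proof.
move=> uL e0; have : (limn_esup u < (L + e)%:E)%E.
  by rewrite (le_lt_trans uL)// lte_fin ltrDl.
move=> /ereal_inf_lt[_ [V oV <-] h]; apply: filterS oV => n Vn.
by rewrite (le_trans _ (ltW h))//; apply: ereal_sup_ubound; exists n.
Qed.

Lemma nbhs_uniform_ball (g0 : {uniform circle R -> R}) (e : R) : 0 < e ->
  nbhs g0 [set g : {uniform circle R -> R} |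
    forall xi, `|(g0 : circle R -> R) xi - (g : circle R -> R) xi| < e].
Proof.
move=> e0; apply/uniform_nbhs; exists [set xy : R * R | `|xy.1 - xy.2| < e].
split; last by move=> h /= hh xi; exact: hh.
by rewrite -entourage_ballE; exists e.
Qed.

Lemma cexp_near1 (e : R) : 0 < e -> exists2 d : R, 0 < d &
  forall w : R[i], cmod w <= d -> cmod (cexp w - 1) <= e.
Proof.
move=> e0; have [d d0 hd] := cexp_expansion (@ltr01 R).
exists (Num.min (d / 2) (e / 2)); first by rewrite lt_min !divr_gt0.
move=> w; rewrite le_min => /andP[w1 w2].
have wd : cmod w < d by rewrite (le_lt_trans w1)// ltr_pdivrMr// ltr_pMr// ltr1n.
rewrite -[cexp w - 1](subrK w) (le_trans (cmodD _ _))//.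
by have := hd w wd; rewrite mul1r; lra.
Qed.

Lemma compact_disk_radius (K : set R[i]) : compact K -> K `<=` [set z | `|z| < 1] ->
  exists2 rho : R, 0 < rho < 1 & forall z, K z -> cmod z <= rho.
Proof.
move=> cK K1; have /compact_near_coveringP := cK.
move=> /(_ nat \oo (fun n z => cmod z <= 1 - n.+1%:R^-1) _) [].
  move=> z /K1 /=; rewrite cmodE ltcR => z1.
  have d0 : 0 < (1 - cmod z) / 2 by rewrite divr_gt0// subr_gt0.
  exists ([set w | cmod (z - w) < (1 - cmod z) / 2], [set n | n.+1%:R^-1 < (1 - cmod z) / 2]).
    split; first by apply/nbhs_cmodP; exists ((1 - cmod z) / 2).
    exact: near_infty_natSinv_lt (PosNum d0).
  move=> [w n] /= [h1 h2]; have := cmod_lerB w z; rewrite cmodBC => h3.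
  by move: h1 h2 h3; move: (n.+1%:R^-1) => t; clear; lra.
move=> N _ hN; exists (1 - N.+2%:R^-1).
  have t0 : 0 < (N.+2%:R^-1 : R) by rewrite invr_gt0.
  have t1 : (N.+2%:R^-1 : R) < 1 by rewrite invf_lt1// ltr1n.
  by move: t0 t1; move: (N.+2%:R^-1) => t; clear => ? ?; apply/andP; split; lra.
(* Index [N.+1] instead of [N] keeps the radius positive when [N = 0]. *)
by move=> z Kz; apply: (hN N.+1) => //=.
Qed.

(** The competitor [Q] of the extremal problem. The range has one index more than [h] has
    coefficients, so that the term [k = 0] exists even for [h = 0]. *)
Definition shifted_combination (n : nat) (b : 'I_n -> R[i]) (h : {poly R[i]}) : {poly R[i]} :=
  \sum_(k < (size h).+1) (h`_k)^*%C *: shifted b k.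

Lemma size_shifted_combination (n : nat) (b : 'I_n -> R[i]) (h : {poly R[i]}) :
  (size (shifted_combination b h) <= n.+1)%N.
Proof.
apply: leq_trans (size_sum _ _ _) _; apply/bigmax_leqP => k _.
by apply: leq_trans (size_scale_leq _ _) _; exact: size_shifted.
Qed.

Lemma coef_shifted_combination (n : nat) (b : 'I_n -> R[i]) (h : {poly R[i]}) :
  (shifted_combination b h)`_n = (h.[0])^*%C.
Proof.
rewrite coef_sum big_ord_recl /= big1 => [|k _]; last first.
  by rewrite coefZ [X in _ * X]nth_default ?mulr0//; exact: size_shiftedS.
rewrite addr0 coefZ.
have := lead_coef_monic_of_zeros b; rewrite lead_coefE size_monic_of_zeros /= => ->.
by rewrite mulr1 horner_coef0.
Qed.

Lemma shifted_combination_circle (n : nat) (b : 'I_n -> R[i]) (h : {poly R[i]}) (t : R) (xi : circle R) :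
  (forall i, cmod (b i) < 1) ->
  (forall j, (j < (size h).+1)%N -> cmod (shifted b j).[0] <= t) ->
  cmod ((shifted_combination b h).[circle_val xi] / (monic_of_zeros b).[circle_val xi]
     - (h.[circle_val xi])^*%C) <=
  (\sum_(k < (size h).+1) cmod h`_k) * ((size h).+1%:R * t).
Proof.
move=> b1 ht.
have t0 : 0 <= t by rewrite (le_trans _ (ht 0%N _))// cmod_ge0.
have -> : (shifted_combination b h).[circle_val xi] / (monic_of_zeros b).[circle_val xi]
     - (h.[circle_val xi])^*%C = \sum_(k < (size h).+1) (h`_k)^*%C *
     ((shifted b k).[circle_val xi] / (monic_of_zeros b).[circle_val xi] - (circle_val xi)^*%C ^+ k).
  rewrite (horner_coef_wide _ (leqnSn (size h))) rmorph_sum /shifted_combination horner_sum.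
  rewrite mulr_suml -sumrB; apply: eq_bigr => k _.
  by rewrite hornerZ rmorphM rmorphXn /= mulrBr mulrA.
rewrite (le_trans (cmod_sum _ _ _))// mulr_suml; apply: ler_sum => k _.
rewrite cmodM cmod_conj ler_wpM2l ?cmod_ge0//.
apply: (@le_trans _ _ (k%:R * t)); last by rewrite ler_wpM2r// ler_nat ltnW.
apply: shifted_circle => // j jk; apply: ht.
exact: ltn_trans jk (ltn_ord k).
Qed.

Lemma shifted_combination_disk (n : nat) (b : 'I_n -> R[i]) (h : {poly R[i]}) (t : R) (z : R[i]) :
  (forall k, (k < (size h).+1)%N ->
     cmod ((shifted b k).[z] / (recip n (monic_of_zeros b)).[z]) <= t) ->
  cmod ((shifted_combination b h).[z] / (recip n (monic_of_zeros b)).[z]) <=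
  (\sum_(k < (size h).+1) cmod h`_k) * t.
Proof.
move=> ht; rewrite /shifted_combination horner_sum mulr_suml.
rewrite (le_trans (cmod_sum _ _ _))// mulr_suml; apply: ler_sum => k _.
by rewrite hornerZ -mulrA cmodM cmod_conj ler_wpM2l ?cmod_ge0// ht.
Qed.

(** Only finitely many shifts are involved, so their growth [(2 / rho)^M] is a fixed factor,
    absorbed by asking the Blaschke product to be below [t'], which (D) eventually ensures. *)
Lemma shifted_near (b : forall n : nat, 'I_n -> R[i]) (rho t : R) (M : nat) :
  (forall n (i : 'I_n), cmod (b n i) < 1) ->
  (\sum_(i < n) (1 - cmod (b n i))) @[n --> \oo] --> +oo ->
  0 < rho < 1 -> 0 < t ->
  \forall n \near \oo, forall k z, (k <= M)%N -> cmod z <= rho ->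
    cmod ((shifted (b n) k).[z] / (recip n (monic_of_zeros (b n))).[z]) <= t.
Proof.
move=> b1 hD /andP[r0 r1] t0.
have q1 : 1 <= 2 / rho by rewrite ler_pdivlMr// mul1r (le_trans (ltW r1))// ler1n.
pose t' := t / (2 / rho) ^+ M.
have qM0 : 0 < (2 / rho) ^+ M by rewrite exprn_gt0// (lt_le_trans ltr01).
have t'0 : 0 < t' by rewrite divr_gt0.
have c0 : 0 < (1 - rho ^+ 2) / 4 by rewrite divr_gt0// subr_gt0 expr_lt1// ltW.
have /cvgryPge/(_ (- ln (t' ^+ 2) / ((1 - rho ^+ 2) / 4))) := hD.
apply: filterS => n hn k z kM zr.
have hB w : cmod w <= rho -> cmod ((monic_of_zeros (b n)).[w] / (recip n (monic_of_zeros (b n))).[w]) <= t'.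
  move=> wr; rewrite -(@ler_pXn2r _ 2)// ?nnegrE ?cmod_ge0// ?(ltW t'0)//.
  rewrite (le_trans (blaschke_bound (b1 n) wr r1))//.
  rewrite -[leRHS](lnK (_ : t' ^+ 2 \in Num.pos)) ?posrE ?exprn_gt0// ler_expR.
  by rewrite lerNl mulrC -ler_pdivrMr.
have r01 : 0 < rho <= 1 by rewrite r0 ltW.
rewrite (le_trans (shifted_bound (b1 n) k r01 hB zr))//.
rewrite /t' mulrCA ler_piMr ?(ltW t0)// ler_pdivrMr// mul1r.
by rewrite ler_weXn2l.
Qed.

Lemma disk_log_approximation (sigma : {finite_measure set (circle R) -> \bar R})
    (v : circle R -> R) (sigmas : {measure set (circle R) -> \bar R}) (g : circle R -> R) (e : R) :
  lebesgue_decomposition sigma v sigmas -> circle_integrable m (fun xi => ln (v xi)) ->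
  continuous g -> 0 < e -> exists H h : {poly R[i]},
  [/\ complex.Im H.[0] = 0,
    \int[m]_xi `|2 * complex.Re H.[circle_val xi] + g xi + ln (v xi)| <= e,
    \int[sigma]_xi expR (2 * complex.Re H.[circle_val xi] + g xi) <= 1 + e &
    forall z, cmod z <= 1 -> cmod (h.[z] * cexp (- H.[z]) - 1) <= e].
Proof.
move=> dec iv cg e0.
(* [d] is the accuracy both of the Szegő weight and of its trigonometric approximation: the errors
   add in [L^1(m)] and multiply, as [1 + d] and [e^d], in the exponential integral. *)
have [d [d0 d1 d2]] : exists d : R, [/\ 0 < d, 2 * d <= e & expR d * (1 + d) <= 1 + e].
  pose d := Num.min (1 / 4) (e / 4).
  have d0 : 0 < d by rewrite lt_min !divr_gt0.
  have d14 : d <= 1 / 4 by rewrite ge_min lexx.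
  have de : d <= e / 4 by rewrite ge_min lexx orbT.
  exists d; split => //; first by move: de e0; clear; lra.
  have h1 : expR d * (1 - d) <= 1.
    rewrite -[leRHS](expRxMexpNx_1 d) ler_wpM2l ?expR_ge0//.
    exact: expR_ge1Dx.
  have h2 : expR d <= 1 + 2 * d.
    rewrite -(@ler_pM2r _ (1 - d)); last by move: d14; clear; lra.
    by rewrite (le_trans h1)//; move: d0 d14; clear; nra.
  have h3 : expR d * (1 + d) <= (1 + 2 * d) * (1 + d).
    by rewrite ler_wpM2r//; move: d0; clear; lra.
  by rewrite (le_trans h3)//; move: d0 d14 de; clear; nra.
have [u [cu u1 u2]] := szego_weight dec iv d0.
have cug : continuous (fun xi => u xi - g xi).
  by apply: continuousRD => //; exact: continuousRN.
(* [Re H'] approximates [u - g], and [H] is half of [H'], so [2 Re H + g] is close to [u], hence to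
   [- ln v] in [L^1]. *)
have [H' H0 hH] := trigonometric_approximation cug d0.
pose H := (2^-1 : R)%:C *: H'.
have HE w : 2 * complex.Re H.[w] = complex.Re H'.[w].
  by rewrite /H hornerZ cReM [complex.Im _%:C]/= [complex.Re _%:C]/= mul0r subr0 mulrA mulfV ?mul1r.
have cH : continuous (fun xi : circle R => 2 * complex.Re H.[circle_val xi]).
  apply: continuousRM; first exact: continuousRcst.
  by apply: continuousC_Re; exact: continuousC_horner.
have [M M0 hM] := disk_algebra_bounded (disk_algebra_cexp (- H)).
have eM : 0 < e / (M + 1) by rewrite divr_gt0// ltr_wpDl.
have [h hh] := disk_algebra_cexp H eM.
exists H, h; split.
- by rewrite /H hornerZ cImM H0 /= mulr0 mul0r addr0.
- have i1 : circle_integrable m (fun xi => u xi + ln (v xi)).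
    by apply: circle_integrableD => //; exact: continuous_circle_integrable.
  have cHg : continuous (fun xi : circle R => 2 * complex.Re H.[circle_val xi] + g xi).
    exact: continuousRD.
  apply: (@le_trans _ _ (\int[m]_xi (`|u xi + ln (v xi)| + d))).
    apply: circle_Rintegral_le.
    + apply: circle_integrable_norm; apply: circle_integrableD => //.
      exact: continuous_circle_integrable.
    + apply: circle_integrableD; first exact: circle_integrable_norm.
      by apply: continuous_circle_integrable; exact: continuousRcst.
    + move=> xi; rewrite HE.
      have -> : complex.Re H'.[circle_val xi] + g xi + ln (v xi) =
        (u xi + ln (v xi)) - (u xi - g xi - complex.Re H'.[circle_val xi]) by ring.
      by rewrite (le_trans (ler_normB _ _))// lerD2l ltW// hH.
  rewrite circle_RintegralD; last 2 first.
  + exact: circle_integrable_norm.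
  + by apply: continuous_circle_integrable; exact: continuousRcst.
  by rewrite arclength_Rint_cst; move: u1 d1; clear; lra.
- have ieu : circle_integrable sigma (fun xi => expR (u xi)).
    by apply: continuous_circle_integrable; exact: continuousR_expR.
  apply: (@le_trans _ _ (\int[sigma]_xi (expR d * expR (u xi)))).
    apply: circle_Rintegral_le.
    + apply: continuous_circle_integrable; apply: continuousR_expR; exact: continuousRD.
    + exact: circle_integrableZ.
    + move=> xi; rewrite HE -expRD ler_expR.
      by have := hH xi; rewrite ltr_norml => /andP[h1 _]; move: h1; clear; lra.
  rewrite circle_RintegralZ// (le_trans _ d2)// ler_wpM2l ?expR_ge0//.
  exact: ltW.
- move=> z z1.
  have E : cexp H.[z] * cexp (- H.[z]) = 1 by rewrite -cexpD addrN cexp0.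
  have hMz := hM z z1; rewrite hornerN in hMz.
  rewrite -E -mulrBl cmodM (@le_trans _ _ (e / (M + 1) * M))//.
    by rewrite ler_pM ?cmod_ge0// cmodBC ltW// hh.
  by rewrite mulrAC ler_pdivrMr ?ltr_wpDl// ler_wpM2l ?lerDl// ltW.
Qed.

End asymptotics.

(** Uniformity on a sup-norm ball around [g0]. The polynomials [H] and [h], the test function for
    (A) and all thresholds for [n] are fixed before [g], which enters only through its distance to
    [g0]. *)
Lemma orthonormal_asymptotics (R : realType)
  (sigma_ : nat -> {finite_measure set (circle R) -> \bar R})
  (v_ : nat -> circle R -> R)
  (sigmas_ : nat -> {measure set (circle R) -> \bar R})
  (b : forall n : nat, 'I_n -> R[i])
  (sigma : {finite_measure set (circle R) -> \bar R})
  (v : circle R -> R)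
  (sigmas : {measure set (circle R) -> \bar R})
  (g0 : circle R -> R) (rho s : R) (m := arclength R) :
  (forall n, (0 < n)%N -> lebesgue_decomposition (sigma_ n) (v_ n) (sigmas_ n)) ->
  lebesgue_decomposition sigma v sigmas ->
  (forall n (i : 'I_n), cmod (b n i) < 1) ->
  (forall f : circle R -> R, continuous f -> (forall xi, 0 <= f xi) ->
     (limn_esup (fun n => \int[sigma_ n]_xi (f xi)%:E)
        <= \int[sigma]_xi (f xi)%:E)%E) ->
  (forall n, (0 < n)%N -> m.-integrable setT (elog (v_ n))) ->
  m.-integrable setT (elog v) ->
  ('N[m]_1[(fun xi => elog (v_ n) xi - elog v xi)]%E @[n --> \oo] --> 0%E) ->
  (\sum_(i < n) (1 - cmod (b n i))) @[n --> \oo] --> +oo ->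
  continuous g0 -> 0 < rho < 1 -> 0 < s <= 80^-1 ->
  exists2 d : R, 0 < d & \forall n \near \oo,
    forall g phi, continuous g -> (forall xi, `|g0 xi - g xi| < d) ->
    is_orthonormal_poly (sigma_ n) g (monic_of_zeros (b n)) n phi ->
    forall z, cmod z <= rho ->
    cmod ((recip n phi).[z] / (recip n (monic_of_zeros (b n))).[z] * szego g (v_ n) z - 1) <= 24 * s /\
    cmod (phi.[z] / (recip n phi).[z]) <= 8 * s.
Proof.
move=> dec_ dec b1 hA ev_ ev hB hD cg0 /andP[r0 r1] /andP[s0 s1].
have [mv v0 _ _] := dec.
have iv := integrable_ln mv v0 ev.
pose B := (1 + rho) / (1 - rho).
have B0 : 0 < B by rewrite divr_gt0 ?subr_gt0// addr_gt0.
have [e [e0 es eB]] : exists e, [/\ 0 < e, e <= s & 7 * B * e <= s ^+ 2].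
  have B7 : 0 < 7 * B by rewrite mulr_gt0.
  exists (Num.min s (s ^+ 2 / (7 * B))); split.
  - by rewrite lt_min s0 divr_gt0 ?exprn_gt0.
  - by rewrite ge_min lexx.
  - by rewrite mulrC -ler_pdivlMr// ge_min lexx orbT.
have [d0 d00 hd0] := cexp_near1 e0.
(* Three [L^1] errors of size [t] enter the exponent of [e^H D_n]: that of [H], the distance from
   [g] to [g0], and that of [ln v_n]. The room [30 t <= e] is for the norm estimate [et]. *)
have [t [t0 t10 te tB]] : exists t, [/\ 0 < t, t <= 10^-1, 30 * t <= e & B * (3 * t) <= d0].
  have B3 : 0 < 3 * B by rewrite mulr_gt0.
  exists (Num.min 10^-1 (Num.min (e / 30) (d0 / (3 * B)))); split.
  - by rewrite !lt_min invr_gt0 !divr_gt0// ltr0n.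
  - by rewrite ge_min lexx.
  - by rewrite mulrC -ler_pdivlMr// !ge_min lexx !orbT.
  - set x := Num.min _ _; have -> : B * (3 * x) = x * (3 * B) by ring.
    by rewrite -ler_pdivlMr// !ge_min lexx !orbT.
have [H [h [H0 hH1 hH2 hH3]]] := disk_log_approximation dec iv cg0 t0.
have [M' M'0 hM'] := disk_algebra_bounded (disk_algebra_cexp (- H)).
pose M := M' + 1.
have M0 : 0 < M by rewrite ltr_wpDl.
have hM z : cmod z <= 1 -> cmod (cexp (- H.[z])) <= M.
  by move=> /hM'; rewrite hornerN => /le_trans; apply; rewrite lerDl.
have expHN z : cmod (cexp H.[z]) * cmod (cexp (- H.[z])) = 1.
  by rewrite -cmodM -cexpD addrN cexp0 cmod1.
(* [2 M] will bound [|D_n|] on the disk of radius [rho], so an error [d] in [Q] costs at most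
   [t]. *)
pose d := t / (2 * M).
have dpos : 0 < d by rewrite divr_gt0// mulr_gt0.
have dM : 2 * M * d = t by rewrite mulrC divfK// gt_eqF// mulr_gt0.
clearbody d.
pose S := \sum_(k < (size h).+1) cmod h`_k.
have S0 : 0 <= S by apply: sumr_ge0 => k _; exact: cmod_ge0.
pose q := d / ((S + 1) * (size h).+1%:R).
have S1 : 0 < (S + 1) * (size h).+1%:R by rewrite mulr_gt0// ltr_wpDl.
have q0 : 0 < q by rewrite divr_gt0.
have Sq : S * ((size h).+1%:R * q) <= d.
  rewrite mulrA /q mulrCA ler_piMr ?(ltW dpos)// ler_pdivrMr// mul1r.
  by rewrite ler_wpM2r// lerDl.
have Sq' : S * q <= d.
  by rewrite (le_trans _ Sq)// ler_wpM2l// ler_peMl ?(ltW q0)// ler1n.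
(* The one function to which (A) is applied: it does not depend on [n], and it dominates
   [|Q / W|^2 e^g0] on the circle for all large [n]. *)
pose f (xi : circle R) := (cmod h.[circle_val xi] + d) ^+ 2 * expR (g0 xi).
have cf : continuous f.
  have ch : continuous (fun xi : circle R => cmod h.[circle_val xi] + d).
    apply: continuousRD; last exact: continuousRcst.
    by apply: continuousC_cmod; exact: continuousC_horner.
  have -> : f = fun xi => (cmod h.[circle_val xi] + d) * (cmod h.[circle_val xi] + d) * expR (g0 xi).
    by apply/funext => xi; rewrite /f expr2.
  apply: continuousRM; last exact: continuousR_expR.
  exact: continuousRM.
have f0 xi : 0 <= f xi by rewrite mulr_ge0 ?sqr_ge0 ?expR_ge0.
have fsigma : \int[sigma]_xi f xi <= (1 + 2 * t) ^+ 2 * (1 + t).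
  have cE : continuous (fun xi : circle R => expR (2 * complex.Re H.[circle_val xi] + g0 xi)).
    apply: continuousR_expR; apply: continuousRD => //.
    apply: continuousRM; first exact: continuousRcst.
    by apply: continuousC_Re; exact: continuousC_horner.
  apply: (@le_trans _ _ (\int[sigma]_xi ((1 + 2 * t) ^+ 2 * expR (2 * complex.Re H.[circle_val xi] + g0 xi)))).
    apply: circle_Rintegral_le.
    - exact: continuous_circle_integrable.
    - by apply: circle_integrableZ; exact: continuous_circle_integrable.
    - move=> xi; rewrite /f expRD mulrA ler_wpM2r ?expR_ge0//.
      set w := circle_val xi; have w1 : cmod w <= 1 by rewrite cmod_circle.
      have -> : (1 + 2 * t) ^+ 2 * expR (2 * complex.Re H.[w]) = ((1 + 2 * t) * cmod (cexp H.[w])) ^+ 2.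
        by rewrite exprMn cmod_cexp -expRM_natl.
      have t2 : 0 <= 1 + 2 * t by move: t0; clear; lra.
      rewrite lerXn2r ?nnegrE ?(addr_ge0 _ (ltW dpos)) ?(mulr_ge0 t2) ?cmod_ge0//.
      have hE : h.[w] = h.[w] * cexp (- H.[w]) * cexp H.[w].
        by rewrite -mulrA -cexpD addNr cexp0 mulr1.
      have h1 : cmod (h.[w] * cexp (- H.[w])) <= 1 + t.
        by rewrite -(subrK 1 (_ * _)) addrC (le_trans (cmodD _ _))// cmod1 lerD2l hH3.
      have h2 : cmod h.[w] <= (1 + t) * cmod (cexp H.[w]).
        by rewrite {1}hE cmodM ler_wpM2r// cmod_ge0.
      (* [|e^H|] is at least [1 / M] on the closed disk, which turns the additive [d] into a
         relative error. *)
      have h3 : d <= t * cmod (cexp H.[w]).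
        have h4 : 1 <= M * cmod (cexp H.[w]).
          by rewrite -(expHN w) mulrC ler_wpM2r ?cmod_ge0// hM.
        have h5 : d <= d * (M * cmod (cexp H.[w])) by rewrite ler_peMr// ltW.
        have -> : t * cmod (cexp H.[w]) = 2 * (d * (M * cmod (cexp H.[w]))) by rewrite -dM; ring.
        by move: h5 dpos; clear; lra.
      by move: h2 h3; clear; lra.
  rewrite circle_RintegralZ; last exact: continuous_circle_integrable.
  by rewrite ler_wpM2l ?sqr_ge0.
(* The factor [e^t] pays for replacing [g0] by [g], and the summand [t] for the upper limit in
   (A). *)
have et : expR t * ((1 + 2 * t) ^+ 2 * (1 + t) + t) <= 1 + e.
  have h1 : expR t * (1 - t) <= 1.
    by rewrite -[leRHS](expRxMexpNx_1 t) ler_wpM2l ?expR_ge0// expR_ge1Dx.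
  have h2 : expR t <= 1 + 2 * t.
    rewrite -(@ler_pM2r _ (1 - t)); last by move: t10; clear; lra.
    by rewrite (le_trans h1)//; move: t0 t10; clear; nra.
  have h3 : (1 + 2 * t) ^+ 2 <= 1 + 5 * t by move: t0 t10; clear; nra.
  have h4 : (1 + 2 * t) ^+ 2 * (1 + t) <= (1 + 5 * t) * (1 + t).
    by rewrite ler_wpM2r//; move: t0; clear; lra.
  have h5 : (1 + 5 * t) * (1 + t) <= 1 + 7 * t by move: t0 t10; clear; nra.
  have h6 : expR t * ((1 + 2 * t) ^+ 2 * (1 + t) + t) <= (1 + 2 * t) * (1 + 8 * t).
    rewrite ler_pM ?expR_ge0//.
      by rewrite addr_ge0 ?mulr_ge0 ?sqr_ge0//; move: t0; clear; lra.
    by move: h4 h5; clear; lra.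
  by rewrite (le_trans h6)//; move: t0 t10 te; clear; nra.
have nearA : \forall n \near \oo, \int[sigma_ n]_xi f xi <= (1 + 2 * t) ^+ 2 * (1 + t) + t.
  have if_ (mu : {finite_measure set (circle R) -> \bar R}) :
      (\int[mu]_xi (f xi)%:E = (\int[mu]_xi f xi)%:E)%E.
    by rewrite fineK//; apply: integrable_fin_num => //; exact: continuous_circle_integrable.
  have := hA f cf f0; rewrite if_ => /limn_esup_near/(_ t0).
  apply: filterS => n; rewrite if_ lee_fin => /le_trans; apply.
  by rewrite lerD2r.
have nearB : \forall n \near \oo, ('N[m]_1[(fun xi => elog (v_ n) xi - elog v xi)]%E < t%:E)%E.
  have : nbhs (0%E : \bar R) [set x | (x < t%:E)%E].
    by apply: open_nbhs_nbhs; split; [exact: open_ereal_lt_ereal|rewrite /= lte_fin].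
  exact: hB.
have r01 : 0 < rho < 1 by rewrite r0.
have nearS := shifted_near (size h) b1 hD r01 q0.
have nearP : \forall n \near \oo, (0 < n)%N by exact: nbhs_infty_gt.
exists t => //; near=> n.
have n0 : (0 < n)%N by near: n.
have hAn : \int[sigma_ n]_xi f xi <= (1 + 2 * t) ^+ 2 * (1 + t) + t by near: n; exact: nearA.
have hBn : ('N[m]_1[(fun xi => elog (v_ n) xi - elog v xi)]%E < t%:E)%E by near: n; exact: nearB.
have hSn : forall k z, (k <= size h)%N -> cmod z <= rho ->
    cmod ((shifted (b n) k).[z] / (recip n (monic_of_zeros (b n))).[z]) <= q by near: n; exact: nearS.
move=> g phi cg gg0 ortho.
have decn := dec_ n n0; have [mvn vn0 _ _] := decn.
have ivn := integrable_ln mvn vn0 (ev_ n n0).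
have L1n : \int[m]_xi `|ln (v_ n xi) - ln (v xi)| <= t.
  rewrite -lee_fin (le_trans (L1_ln_le vn0 v0 ivn iv (ev_ n n0) ev))//.
  exact: ltW.
pose W := monic_of_zeros (b n).
pose Q := shifted_combination (b n) h.
have hHD z : cmod z <= rho -> cmod (cexp H.[z] * szego g (v_ n) z - 1) <= e.
  move=> zr; have z1 : cmod z < 1 by exact: le_lt_trans r1.
  have iH : circle_integrable m (fun xi => complex.Re (2 *: H).[circle_val xi]).
    by apply: continuous_circle_integrable; apply: continuousC_Re; exact: continuousC_horner.
  have ign : circle_integrable m (fun xi => g xi + ln (v_ n xi)).
    by apply: circle_integrableD => //; exact: continuous_circle_integrable.
  have c2 : (2 : R[i]) = (2 : R)%:C by rewrite rmorph_nat.
  have ReH w : complex.Re (2 *: H).[w] = 2 * complex.Re H.[w].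
    by rewrite hornerZ c2 cReM [complex.Im _%:C]/= mul0r subr0.
  have HE : H.[z] = 2^-1 * herglotz z (fun xi => complex.Re (2 *: H).[circle_val xi]).
    rewrite herglotz_Re// ?hornerZ ?mulrA ?mulVf ?mul1r ?pnatr_eq0//.
    by rewrite c2 cImM H0 /= mulr0 mul0r addr0.
  rewrite szegoE HE -cexpD -mulrDr -herglotzD//; apply: hd0.
  have c12 : cmod (2^-1 : R[i]) = 2^-1.
    by rewrite cmodV c2 cmod_real gtr0_norm.
  rewrite cmodM c12.
  have iall := circle_integrableD iH ign.
  have h1 := herglotz_le z1 iall.
  rewrite -ler_pdivlMl ?invr_gt0// invrK (le_trans h1)// -mulrA ler_wpM2l//.
  rewrite (le_trans _ tB)// ler_pM//.
  - by apply: divr_ge0; [rewrite addr_ge0 ?cmod_ge0|rewrite subr_ge0 ltW].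
  - by apply: Rintegral_ge0.
  - rewrite /herglotz_bound /B ler_pM ?addr_ge0 ?invr_ge0 ?subr_ge0 ?cmod_ge0 ?lerD2l//; first exact: ltW.
    by rewrite lef_pV2 ?posrE ?subr_gt0// lerD2l lerN2.
  have ic (a : R) : circle_integrable m (fun=> a).
    by apply: continuous_circle_integrable; exact: continuousRcst.
  have i1 : circle_integrable m (fun xi => `|2 * complex.Re H.[circle_val xi] + g0 xi + ln (v xi)|).
    apply: circle_integrable_norm; apply: circle_integrableD => //.
    apply: continuous_circle_integrable; apply: continuousRD => //.
    apply: continuousRM; first exact: continuousRcst.
    by apply: continuousC_Re; exact: continuousC_horner.
  have i2 : circle_integrable m (fun xi => `|ln (v_ n xi) - ln (v xi)|).
    by apply: circle_integrable_norm; exact: circle_integrableB.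
  apply: (@le_trans _ _ (\int[m]_xi ((`|2 * complex.Re H.[circle_val xi] + g0 xi + ln (v xi)| + t)
     + `|ln (v_ n xi) - ln (v xi)|))).
    apply: circle_Rintegral_le.
    + exact: circle_integrable_norm.
    + by apply: circle_integrableD => //; exact: circle_integrableD.
    + move=> xi; rewrite ReH.
      set a := 2 * _.
      have -> : a + (g xi + ln (v_ n xi)) = (a + g0 xi + ln (v xi)) - (g0 xi - g xi) + (ln (v_ n xi) - ln (v xi)) by ring.
      rewrite (le_trans (ler_normD _ _))// lerD2r (le_trans (ler_normB _ _))// lerD2l.
      exact: ltW (gg0 xi).
  rewrite circle_RintegralD//; last exact: circle_integrableD.
  rewrite circle_RintegralD// [X in _ + X + _]arclength_Rint_cst.
  by move: hH1 L1n; clear; lra.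
have hDM z : cmod z <= rho -> cmod (szego g (v_ n) z) <= 2 * M.
  move=> zr; have zle1 : cmod z <= 1 by rewrite (le_trans zr)// ltW.
  have -> : szego g (v_ n) z = (cexp (- H.[z])) * (cexp H.[z] * szego g (v_ n) z).
    by rewrite mulrA -cexpD addNr cexp0 mul1r.
  rewrite cmodM (mulrC 2) ler_pM ?cmod_ge0 ?hM//.
  rewrite -(subrK 1 (_ * _)) (le_trans (cmodD _ _))// cmod1.
  have := hHD z zr; move: es s1; clear; lra.
have b1n := b1 n.
have ht j : (j < (size h).+1)%N -> cmod (shifted (b n) j).[0] <= q.
  move=> jh; have := hSn j 0 jh; rewrite cmod0 recip0 divr1; apply.
  exact: ltW.
have hQ xi : cmod (Q.[circle_val xi] / W.[circle_val xi] - (h.[circle_val xi])^*%C) <= d.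
  exact: le_trans (shifted_combination_circle _ b1n ht) Sq.
apply: (@orthonormal_estimates _ _ _ _ _ _ _ _ H h Q rho s e d decn ivn _ b1n cg ortho) => //.
- exact: ae_density_gt0 (ev_ n n0).
- by rewrite s0.
- by rewrite e0.
- by move=> z z1; rewrite (le_trans (hH3 z z1))//; move: te t0; clear; lra.
- exact: size_shifted_combination.
- exact: coef_shifted_combination.
- move=> z zr; apply: (@le_trans _ _ (2 * M * d)).
    by rewrite ler_wpM2r ?hDM// ltW.
  by rewrite dM; move: te t0; clear; lra.
- move=> z zr; apply: (@le_trans _ _ (2 * M * d)).
    rewrite ler_pM ?cmod_ge0 ?hDM//.
    apply: le_trans (shifted_combination_disk _) Sq'.
    by move=> k kh; exact: hSn.
  by rewrite dM; move: te t0; clear; lra.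
- rewrite (le_trans _ et)// (le_trans _ (ler_wpM2l (expR_ge0 t) hAn))//.
  rewrite -circle_RintegralZ; last exact: continuous_circle_integrable.
  apply: circle_Rintegral_le.
  + exact: weighted_norm_integrable.
  + by apply: circle_integrableZ; exact: continuous_circle_integrable.
  + move=> xi; rewrite /orthogonality_weight -/W.
    have -> : cmod Q.[circle_val xi] ^+ 2 * (expR (g xi) / cmod W.[circle_val xi] ^+ 2) =
        cmod (Q.[circle_val xi] / W.[circle_val xi]) ^+ 2 * expR (g xi).
      rewrite cmodM cmodV exprMn exprVn; ring.
    have hg : expR (g xi) <= expR t * expR (g0 xi).
      rewrite -expRD ler_expR; have := gg0 xi; rewrite ltr_norml => /andP[+ _].
      by clear; lra.
    have hq : cmod (Q.[circle_val xi] / W.[circle_val xi]) ^+ 2 <= (cmod h.[circle_val xi] + d) ^+ 2.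
      rewrite lerXn2r ?nnegrE ?addr_ge0 ?cmod_ge0 ?(ltW dpos)//.
      rewrite -(subrK ((h.[circle_val xi])^*%C) (_ / _)) addrC.
      by rewrite (le_trans (cmodD _ _))// cmod_conj lerD2l hQ.
    have hh := ler_pM (sqr_ge0 _) (expR_ge0 _) hq hg.
    by rewrite (le_trans hh)// /f mulrCA.
Unshelve. all: by end_near. Qed.

Theorem theorem2p1 (R : realType)
  (sigma_ : nat -> {finite_measure set (circle R) -> \bar R})
  (v_ : nat -> circle R -> R)
  (sigmas_ : nat -> {measure set (circle R) -> \bar R})
  (b : forall n : nat, 'I_n -> R[i])
  (sigma : {finite_measure set (circle R) -> \bar R})
  (v : circle R -> R)
  (sigmas : {measure set (circle R) -> \bar R})
  (E : set {uniform circle R -> R}) :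
  (* d sigma_n = v_n dm + d sigma_n^s and d sigma = v dm + d sigma^s *)
  (forall n, (0 < n)%N ->
     lebesgue_decomposition (sigma_ n) (v_ n) (sigmas_ n)) ->
  lebesgue_decomposition sigma v sigmas ->
  (* the zeros of W_n lie in the open unit disk *)
  (forall n (i : 'I_n), `|b n i| < 1) ->
  (* (A) *)
  (forall f : circle R -> R, continuous f -> (forall xi, 0 <= f xi) ->
     (limn_esup (fun n => \int[sigma_ n]_xi (f xi)%:E)
        <= \int[sigma]_xi (f xi)%:E)%E) ->
  (* (B) *)
  (forall n, (0 < n)%N -> (arclength R).-integrable setT (elog (v_ n))) ->
  (arclength R).-integrable setT (elog v) ->
  ('N[arclength R]_1[(fun xi => elog (v_ n) xi - elog v xi)]%E
     @[n --> \oo] --> 0%E) ->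
  (* (C) *)
  E `<=` [set g | continuous (g : circle R -> R)] ->
  compact E ->
  (* (D) *)
  ((\sum_(i < n) (1 - complex.Re `|b n i|)) @[n --> \oo] --> +oo) ->
  let W n := monic_of_zeros (b n) in
  [/\ forall K : set R[i], compact K -> K `<=` [set z | `|z| < 1] ->
        forall e : R, 0 < e ->
        \forall n \near \oo,
          forall (g_n : circle R -> R) (phi_n : {poly R[i]}), E g_n ->
          is_orthonormal_poly (sigma_ n) g_n (W n) n phi_n ->
          forall z, K z ->
          `|(recip n phi_n).[z] / (recip n (W n)).[z] * szego g_n (v_ n) z - 1|
            < e%:C,
      forall K : set R[i], compact K -> K `<=` [set z | `|z| < 1] ->
        forall e : R, 0 < e ->
        \forall n \near \oo,
          forall (g_n : circle R -> R) (phi_n : {poly R[i]}), E g_n ->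
          is_orthonormal_poly (sigma_ n) g_n (W n) n phi_n ->
          forall z, K z -> `|phi_n.[z] / (recip n phi_n).[z]| < e%:C &
      forall e : R, 0 < e ->
        \forall n \near \oo,
          forall (g_n : circle R -> R) (phi_n : {poly R[i]}), E g_n ->
          is_orthonormal_poly (sigma_ n) g_n (W n) n phi_n ->
          `|lead_coef phi_n * szego g_n (v_ n) 0 - 1| < e%:C].
Proof.
move=> dec_ dec b1 hA ev_ ev hB Econt cE hD W.
have cb n (i : 'I_n) : cmod (b n i) < 1 by have := b1 n i; rewrite cmodE ltcR.
have hD' : (\sum_(i < n) (1 - cmod (b n i))) @[n --> \oo] --> +oo.
  apply: cvg_trans hD; apply: near_eq_cvg; near=> n.
  by apply: eq_bigr => i _; rewrite cmodE.
(* The local statement around each [g0] in [E] becomes a single threshold for all of [E] by the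
   covering form of compactness. *)
have uniform rho s : 0 < rho < 1 -> 0 < s <= 80^-1 -> \forall n \near \oo,
    forall (g : circle R -> R) (phi : {poly R[i]}), E g ->
    is_orthonormal_poly (sigma_ n) g (W n) n phi -> forall z, cmod z <= rho ->
    cmod ((recip n phi).[z] / (recip n (W n)).[z] * szego g (v_ n) z - 1) <= 24 * s /\
    cmod (phi.[z] / (recip n phi).[z]) <= 8 * s.
  move=> hrho hs; have /compact_near_coveringP := cE.
  move=> /(_ nat \oo (fun n g => forall phi, E g ->
    is_orthonormal_poly (sigma_ n) (g : circle R -> R) (W n) n phi -> forall z, cmod z <= rho ->
    cmod ((recip n phi).[z] / (recip n (W n)).[z] * szego (g : circle R -> R) (v_ n) z - 1) <= 24 * s /\
    cmod (phi.[z] / (recip n phi).[z]) <= 8 * s) _) [].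
    move=> g0 Eg0.
    have [d d0 hd] := orthonormal_asymptotics dec_ dec cb hA ev_ ev hB hD' (Econt g0 Eg0) hrho hs.
    exists ([set g : {uniform circle R -> R} |
      forall xi, `|(g0 : circle R -> R) xi - (g : circle R -> R) xi| < d],
      [set n | forall g phi, continuous g -> (forall xi, `|(g0 : circle R -> R) xi - g xi| < d) ->
        is_orthonormal_poly (sigma_ n) g (W n) n phi -> forall z, cmod z <= rho ->
        cmod ((recip n phi).[z] / (recip n (W n)).[z] * szego g (v_ n) z - 1) <= 24 * s /\
        cmod (phi.[z] / (recip n phi).[z]) <= 8 * s]).
      by split; [exact: nbhs_uniform_ball|exact: hd].
    by move=> [g n] /= [gg0 hn] phi Eg; apply: hn => //; exact: Econt.
  by move=> N _ hN; exists N => // n Nn g phi Eg; exact: (hN n Nn g Eg phi Eg).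
have small (e : R) : 0 < e -> exists2 s, 0 < s <= 80^-1 & 24 * s < e.
  move=> e0; exists (Num.min 80^-1 (e / 25)).
    by rewrite lt_min invr_gt0 ltr0n divr_gt0//= ge_min lexx.
  have h1 : Num.min 80^-1 (e / 25) <= e / 25 by rewrite ge_min lexx orbT.
  by move: h1 e0; set x := Num.min _ _; clear; lra.
split.
- move=> K cK K1 e /small[s hs se]; have [rho hrho Krho] := compact_disk_radius cK K1.
  have := uniform rho s hrho hs; apply: filterS => n h g phi Eg op z Kz.
  by have [h1 _] := h g phi Eg op z (Krho z Kz); rewrite ltCR (le_lt_trans h1).
- move=> K cK K1 e /small[s hs se]; have [rho hrho Krho] := compact_disk_radius cK K1.
  have := uniform rho s hrho hs; apply: filterS => n h g phi Eg op z Kz.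
  have [_ h2] := h g phi Eg op z (Krho z Kz); rewrite ltCR (le_lt_trans h2)//.
  by case/andP: hs => s0 _; move: s0 se; clear; lra.
- move=> e /small[s hs se].
  (* The last claim is the first one at [z = 0], where [W^*] is 1 and [phi^*] is the conjugate of
     the real leading coefficient; any radius in [(0, 1)] would do. *)
  have hrho : 0 < (2^-1 : R) < 1 by rewrite invr_gt0 ltr0n invf_lt1 ?ltr1n.
  have := uniform _ s hrho hs; apply: filterS => n h g phi Eg op.
  have [aE _] := lead_coef_real op.
  have z0 : cmod (0 : R[i]) <= 2^-1 by rewrite cmod0 invr_ge0 ler0n.
  have [h1 _] := h g phi Eg op 0 z0; rewrite ltCR.
  move: h1; rewrite recip0 divr1 recip_horner0.
  have -> : (phi`_n)^*%C = lead_coef phi.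
    by have [sphi _ _ _] := op; rewrite aE -conjc_real -aE lead_coefE sphi.
  by move=> h1; exact: le_lt_trans h1 se.
Unshelve. all: by end_near. Qed.
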